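(* Let $\alpha\in\mathbb{R}$, let $b\ge a>0$, and let $\mu_{a,b}:=\frac{1}{\pi ab}\,\chi_{\Omega(a,b)}$ be the normalised characteristic function of $$\Omega(a,b):=\Big\{x=(x_1,x_2)\in\mathbb{R}^2:\ \frac{x_1^2}{a^2}+\frac{x_2^2}{b^2}<1\Big\}.$$ Set $c^2=b^2-a^2$ with $c\ge0$, and $$\lambda:=\frac{a-b}{a+b},\qquad h(z):=\frac{1}{z+\sqrt{z^2+c^2}}.$$ Then $$\nabla(W_\alpha\ast\mu_{a,b})(z)=\frac{1}{\pi ab}\Big(-\frac{1}{\bar z}+\frac{\alpha}{2}\frac{1}{z}-\frac{\alpha}{2}\frac{z}{\bar z^2}\Big)\ast\chi_{\Omega(a,b)}\,(z)=\frac{1}{ab}(-1-\alpha\lambda)\,z+\frac{1}{ab}\Big(\lambda+\frac{\alpha}{2}+\lambda^2\frac{\alpha}{2}\Big)\bar z$$ for every $z\in\Omega(a,b)$, and $$\nabla(W_\alpha\ast\mu_{a,b})(z)=\frac{1}{\pi ab}\Big(-\frac{1}{\bar z}+\frac{\alpha}{2}\frac{1}{z}-\frac{\alpha}{2}\frac{z}{\bar z^2}\Big)\ast\chi_{\Omega(a,b)}\,(z)=-(2+\alpha\lambda)h(\bar z)+\alpha h(z)-\alpha\big(\lambda\bar z-z+2ab\,h(\bar z)\big)h'(\bar z)$$ for every $z\in\Omega(a,b)^c$.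
   Context: The kernel is $$W_\alpha(x_1,x_2)=-\frac12\log(x_1^2+x_2^2)+\alpha\frac{x_1^2}{x_1^2+x_2^2}.$$ Points $x=(x_1,x_2)\in\mathbb{R}^2$ are identified with complex numbers $z=x_1+ix_2$, and the gradient of a real-valued function $f$ is identified with the complex number $\partial_{x_1}f+i\,\partial_{x_2}f=2\bar\partial f$, where $\bar\partial=\frac12(\partial_{x_1}+i\,\partial_{x_2})$. Convolutions are over $\mathbb{R}^2\equiv\mathbb{C}$ with respect to Lebesgue measure, e.g. $(k\ast\chi_{\Omega})(z)=\int_\Omega k(z-\xi)\,d\xi$, with $d\xi$ planar Lebesgue measure; $\chi_\Omega$ is the characteristic function of $\Omega$, and $\Omega^c$ its complement in $\mathbb{C}$. $\sqrt{z^2+c^2}$ denotes the holomorphic branch of the square root on $\mathbb{C}\setminus[-ic,ic]$ that behaves asymptotically as $z$ at infinity (for $c=0$ it equals $z$); it preserves the quadrants, i.e. $\Re(z)\,\Re(\sqrt{z^2+c^2})\ge0$ and $\Im(z)\,\Im(\sqrt{z^2+c^2})\ge0$. $h'$ is the complex derivative of $h$, and $h'(\bar z)$ is its value at $\bar z$. *)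

(* Defs.v *)
From HB Require Import structures.
From mathcomp Require Import all_boot all_order all_algebra.
From mathcomp Require Import complex.
From mathcomp Require Import lra.
From mathcomp Require Import all_classical all_reals all_analysis.

Set Implicit Arguments.
Unset Strict Implicit.
Unset Printing Implicit Defensive.

Import Order.TTheory GRing.Theory Num.Theory.
Import numFieldNormedType.Exports.

Local Open Scope classical_set_scope.
Local Open Scope ring_scope.

(* Points of the plane are pairs, on which the Lebesgue measure and the *)
(* partial derivatives live; toC is the identification with complex numbers. *)
Definition toC (R : realType) (x : R * R) : R[i] := Complex x.1 x.2.

Definition planar_lebesgue (R : realType) :=
  (@lebesgue_measure R \x @lebesgue_measure R)%E.

(* The convolution integral at x converges absolutely. *)
Definition convolvable (R : realType) (k g : R * R -> R) (x : R * R) : Prop :=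
  (@planar_lebesgue R).-integrable setT (EFin \o (fun y => k (x - y) * g y)).

Definition convolution (R : realType) (k g : R * R -> R) (x : R * R) : R :=
  \int[@planar_lebesgue R]_y (k (x - y) * g y).

(* The same for a complex-valued kernel and a real density, componentwise. *)
Definition convolvableC (R : realType) (k : R[i] -> R[i]) (g : R * R -> R)
    (x : R * R) : Prop :=
  convolvable (fun y => complex.Re (k (toC y))) g x /\
  convolvable (fun y => complex.Im (k (toC y))) g x.

Definition convolutionC (R : realType) (k : R[i] -> R[i]) (g : R * R -> R)
    (x : R * R) : R[i] :=
  Complex (convolution (fun y => complex.Re (k (toC y))) g x)
          (convolution (fun y => complex.Im (k (toC y))) g x).

Definition has_gradient (R : realType) (f : R * R -> R) (x : R * R) : Prop :=
  derivable f x (1, 0) /\ derivable f x (0, 1).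

Definition gradient (R : realType) (f : R * R -> R) (x : R * R) : R[i] :=
  Complex ('D_(1, 0) f x) ('D_(0, 1) f x).

(* At the origin, a null set, the values of the kernels are those given by *)
(* ln 0 = 0 and 0^-1 = 0. *)
Definition W (R : realType) (alpha : R) (x : R * R) : R :=
  - 2^-1 * ln (x.1 ^+ 2 + x.2 ^+ 2)
  + alpha * (x.1 ^+ 2 / (x.1 ^+ 2 + x.2 ^+ 2)).

Definition gradW_kernel (R : realType) (alpha : R) (z : R[i]) : R[i] :=
  - (1 / conjc z) + (alpha / 2)%:C%C * (1 / z)
  - (alpha / 2)%:C%C * (z / conjc z ^+ 2).

Definition Omega (R : realType) (a b : R) : set (R * R) :=
  [set x | x.1 ^+ 2 / a ^+ 2 + x.2 ^+ 2 / b ^+ 2 < 1].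

Definition mu_ell (R : realType) (a b : R) (x : R * R) : R :=
  1 / (pi * a * b) * \1_(Omega a b) x.

(* Derivatives of functions of one complex variable are derivatives over the *)
(* field R[i], i.e. complex derivatives. *)
Definition holo_at (R : realType) (f : R[i] -> R[i]) (z : R[i]) : Prop :=
  derivable (f : R[i]^o -> R[i]^o) z 1.

Definition cderiv (R : realType) (f : R[i] -> R[i]) (z : R[i]) : R[i] :=
  derive1 (f : R[i]^o -> R[i]^o) z.

(* The segment [-ic, ic]. *)
Definition slit (R : realType) (c : R) : set R[i] :=
  [set z | complex.Re z = 0 /\ - c <= complex.Im z <= c].

(* s is the branch of sqrt (z^2 + c^2) that is holomorphic off [-ic, ic] and *)
(* satisfies s z / z --> 1 at infinity. The values of s on the slit are left *)
(* free. The orders compare norms, which are real numbers inside R[i]. *)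
Definition is_sqrt_branch (R : realType) (c : R) (s : R[i] -> R[i]) : Prop :=
  [/\ forall z, ~ slit c z -> holo_at s z,
      forall z, ~ slit c z -> s z ^+ 2 = z ^+ 2 + (c ^+ 2)%:C%C
    & forall e : R, 0 < e -> exists M : R, forall z,
        M%:C%C < `|z| -> `|s z / z - 1| < e%:C%C].

Lemma Re_sqrtc_ge0 (R : realType) (u : R[i]) : 0 <= complex.Re (sqrtc u).
Proof. by case: u => p q /=; rewrite sqrtr_ge0. Qed.

Lemma sqrtc_dist (R : realType) (u v : R[i]) :
  (complex.Re (sqrtc v))%:C%C * `|sqrtc u - sqrtc v| <= `|u - v|.
Proof.
rewrite -[in leRHS](sqr_sqrtc u) -[in leRHS](sqr_sqrtc v) subr_sqr normrM mulrC.
apply: ler_wpM2l => //; apply: le_trans (normc_ge_Re _).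
rewrite lecR raddfD /= ger0_norm ?addr_ge0 ?Re_sqrtc_ge0 //.
by rewrite lerDr Re_sqrtc_ge0.
Qed.

Lemma sqrtc_holo (R : realType) (u : R[i]) :
  0 < complex.Re (sqrtc u) -> holo_at (@sqrtc R) u.
Proof.
move=> u0; set w := sqrtc u.
have w0 : sqrtc u + sqrtc u != 0.
  by apply/eqP => /(congr1 (@complex.Re R)) /eqP; rewrite raddfD /= gt_eqF ?addr_gt0.
have cont :
    (fun h : R[i]^o => sqrtc (h + u) : R[i]^o) @ (0 : R[i]^o) --> (w : R[i]^o).
  have F0 := nbhs_filter (0 : R[i]^o).
  apply: (proj2 (@cvgrPdist_lt _ R[i]^o _ _ F0 _ _)) => /= e e0.
  have d0 : 0 < e * (complex.Re w)%:C%C by rewrite mulr_gt0 // ltcR.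
  near=> h.
  have := sqrtc_dist (h + u) u; rewrite addrK => H.
  rewrite distrC -(@ltr_pM2r _ (complex.Re w)%:C%C) ?ltcR // mulrC.
  apply: le_lt_trans H _.
  by near: h; apply: (@nbhs0_lt _ R[i]^o).
apply/cvg_ex; exists ((w + w)^-1 : R[i]^o).
pose f : R[i]^o -> R[i]^o := fun h => sqrtc (h + u).
pose g : R[i]^o -> R[i]^o := fun=> w.
have F0 : Filter ((0 : R[i]^o)^') by exact: _.
have cf : f @ (0 : R[i]^o)^' --> (w : R[i]^o).
  exact: (@cvg_within_filter _ _ f (nbhs (0 : R[i]^o))).
have cg : g @ (0 : R[i]^o)^' --> (w : R[i]^o) by apply: cvg_cst.
have cfg := @cvgD _ R[i]^o _ _ F0 f g w w cf cg.
have := @cvgV R[i] _ _ F0 (f + g) (w + w) w0 cfg.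
apply: cvg_trans; apply: near_eq_cvg; near=> h.
have h0 : h != 0 by near: h; exact: nbhs_dnbhs_neq.
have s0 : sqrtc (h + u) + sqrtc u != 0.
  apply/eqP => /(congr1 (@complex.Re R)) /eqP; rewrite raddfD /= gt_eqF //.
  by rewrite ltr_wpDl // Re_sqrtc_ge0.
rewrite /= /shift /= [h *: 1]mulr1 /GRing.scale /=.
apply: (mulfI s0); rewrite divff // mulrCA [X in _ * X]mulrC -subr_sqr.
by rewrite !sqr_sqrtc addrK mulVf.
Unshelve. all: by end_near.
Qed.

(* Such a branch exists; sqrtc is the principal square root, of nonnegative *)
(* real part. *)
Lemma is_sqrt_branch_ex (R : realType) (c : R) : 0 <= c ->
  is_sqrt_branch c (fun z => z * sqrtc (1 + (c ^+ 2)%:C%C / z ^+ 2)).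
Proof.
move=> c0.
have nz z : ~ slit c z -> z != 0.
  by apply: contra_not_neq => ->; split => //=; rewrite oppr_le0 c0.
split.
- move=> z sz; have z0 := nz _ sz.
  have dz : holo_at (fun z => 1 + (c ^+ 2)%:C%C / z ^+ 2) z.
    apply: derivableD; first exact: derivable_cst.
    apply: derivableM; first exact: derivable_cst.
    apply: derivableV; first by rewrite expf_neq0.
    by apply: (@derivableX _ _ id 2); exact: derivable_id.
  apply: derivableM; first exact: derivable_id.
  apply/derivable1_diffP.
  apply: (@differentiable_comp _ _ _ _
    (fun z : R[i]^o => 1 + (c ^+ 2)%:C%C / z ^+ 2 : R[i]^o)
    (@sqrtc R : R[i]^o -> R[i]^o)).
    exact/derivable1_diffP.
  apply/derivable1_diffP; apply: sqrtc_holo.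
  rewrite lt_def Re_sqrtc_ge0 andbT; apply/eqP => w0; apply: sz.
  move: (sqr_sqrtc (1 + (c ^+ 2)%:C%C / z ^+ 2)); move: w0.
  case: (sqrtc _) => p t /= -> /(congr1 (fun v => v * z ^+ 2)).
  rewrite mulrDl mul1r divfK ?expf_neq0 //.
  case: z z0 {nz dz} => x y z0; rewrite !expr2.
  case=> /= Ere Eim.
  have t1 : 0 < 1 + t * t by rewrite ltr_pwDl // -expr2 sqr_ge0.
  have E1 : (1 + t * t) * (y * y - x * x) = c * c by lra.
  have : (1 + t * t) * (x * y) = 0 by lra.
  move/eqP; rewrite !mulf_eq0 gt_eqF //= => xy0.
  have x0 : x = 0.
    case/orP: xy0 => /eqP // y0; apply/eqP; rewrite -sqrf_eq0 expr2.
    rewrite eq_le -expr2 sqr_ge0 andbT expr2 -(pmulr_rle0 _ t1).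
    by move: E1; rewrite y0 mul0r sub0r mulrN => E1; rewrite -oppr_ge0 E1 -expr2 sqr_ge0.
  split => //=; rewrite -ler_norml -(ger0_norm c0) -ler_sqr ?nnegrE //.
  rewrite !real_normK ?num_real // !expr2 -E1 x0 mul0r subr0.
  by rewrite ler_peMl // -?expr2 ?sqr_ge0 // lerDl sqr_ge0.
- move=> z /nz z0; rewrite exprMn sqr_sqrtc mulrDr mulr1 mulrC.
  by rewrite mulrAC -mulrA divff ?mulr1 ?expf_neq0.
- move=> e e0; exists (1 + c ^+ 2 / e) => z Mz.
  have M0 : 0 < 1 + c ^+ 2 / e by rewrite ltr_pwDl // divr_ge0 ?sqr_ge0 // ltW.
  have z0 : z != 0 by rewrite -normr_gt0 (le_lt_trans _ Mz) // lecR ltW.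
  rewrite mulrAC divff // mul1r.
  have := sqrtc_dist (1 + (c ^+ 2)%:C%C / z ^+ 2) 1.
  rewrite sqrtc1 mul1r addrAC subrr add0r => /le_lt_trans; apply.
  rewrite normrM normfV normrX; case: `|z| Mz => n n'.
  rewrite ltcE /= => /andP[/eqP -> Mn].
  have n1 : 1 < n by apply: le_lt_trans Mn; rewrite lerDl divr_ge0 ?sqr_ge0 // ltW.
  have n0 : 0 < n by apply: lt_trans n1.
  rewrite ger0_norm ?lecR ?sqr_ge0 // -[Complex n 0]/(n%:C%C).
  rewrite -rmorphXn -fmorphV -rmorphM ltcR ltr_pdivrMr ?exprn_gt0 //.
  rewrite -ltr_pdivrMl // mulrC; apply: (@lt_trans _ _ n).
    by apply: le_lt_trans Mn; rewrite lerDr.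
  by rewrite expr2 ltr_pMr.
Qed.

(* Main.v *)
Require Import Defs.
From HB Require Import structures.
From mathcomp Require Import all_boot all_order all_algebra.
From mathcomp Require Import complex.
From mathcomp Require Import ring lra.
From mathcomp Require Import all_classical all_reals all_analysis.
From mathcomp Require Import measurable_realfun.

Set Implicit Arguments.
Unset Strict Implicit.
Unset Printing Implicit Defensive.

Import Order.TTheory GRing.Theory Num.Theory.
Import numFieldNormedType.Exports.

Local Open Scope classical_set_scope.
Local Open Scope ring_scope.

(* With w = z - xi, both 1/w and conj w / w^2 are combinations of the partial *)
(* derivatives of the bounded function conj w / w, so slicing the ellipse     *)
(* horizontally and vertically turns the convolutions into integrals of       *)
(* conj w / w over the boundary. There xi = p (u + lambda / u) with |u| = 1   *)
(* and p = (a + b) / 2; writing z = p (u1 + u2) with u1 u2 = lambda and       *)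
(* |u2| <= |u1| gives w = - p u (1 - u1 / u) (1 - u2 / u), and the integrals  *)
(* are evaluated by geometric series. The point z is in the open ellipse iff  *)
(* |u1| < 1, and off the slit u1 = (z + sqrt (z^2 + c^2)) / (2 p). As the     *)
(* interior and exterior formulas agree on the boundary, the convolution with *)
(* the gradient kernel is continuous; integrating it along horizontal and     *)
(* vertical segments shows that it is the gradient of the potential.          *)

(** Put X = conj w / w^2 and Y = 1 / w. The gradient kernel is a real-linear combination of X, Y and
    their conjugates, and differentiating the bounded function conj w / w at w = x - y in y.1 and
    y.2 gives X - Y and i (X + Y). The fundamental theorem of calculus on horizontal and vertical
    slices of the ellipse therefore turns the convolutions into boundary integrals
    ([integral_slices], [integral_vertical_slices]). The boundary is xi = p (u + lam / u) with |u| =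
    1, and the weights b cos t and a sin t are combinations of u and 1 / u. So only two numbers
    matter: the means over the circle of u g and of g / u, where g = conj w / w at w = z - xi
    ([convolution_gradW_of_means]).

    The equation z = p (U + lam / U) has roots u1 and u2 with u1 u2 = lam and |lam| < 1. As a
    function of u, g is rational with poles u1 and u2. If both lie in the unit disc, g is a power
    series in 1 / u; one mean vanishes and the other is linear in z and conj z
    ([boundary_means_inside]). If |u1| > 1, g has a Laurent series in u / u1 and u2 / u, and the
    means involve 1 / u1, that is h z up to a factor ([boundary_means_outside]). The case is decided
    by [Omega_root]: the quadratic form of the ellipse minus 1 has the sign of |u1|^2 - 1.

    That the gradient of the potential is this convolution is not shown by differentiating under a
    singular integral. By Fubini, the increment of the potential along a segment is the integral of
    the convolution with the derivative of the kernel, and the fundamental theorem of calculus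
    applies because that convolution is continuous ([partial_derivative_convolution]). The
    continuity is read off from the two explicit formulas, which agree on the boundary
    ([exterior_value_on_circle], [contC_at_gradient]). Absolute convergence rests on 1 / |w| <=
    |w.1|^(-1/2) |w.2|^(-1/2), which separates the variables ([inv_normc_le_rsqrt],
    [int_shifted_le]). *)

Local Notation mu := (@lebesgue_measure _).

Local Notation Re := (@complex.Re _).
Local Notation Im := (@complex.Im _).
Local Notation normc := ComplexField.Normc.normc.

(* Convertible to planar_lebesgue, but carrying a sigma-finite structure, which *)
(* is not inferred for the latter. *)
Definition plane (R : realType) : set (measurableTypeR R * measurableTypeR R)%type -> \bar R :=
  (mu \x mu)%E.

HB.instance Definition _ (R : realType) := Measure.on (@plane R).

Lemma plane_sigma_finite (R : realType) : sigma_finite setT (@plane R).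
Proof.
have /sigma_finiteP[F [TF ndF Foo]] := sigma_finiteT (@lebesgue_measure R).
exists (fun n => F n `*` F n).
  rewrite predeqE => -[x y]; split => // _.
  have /= [n _ Fnx] : (\bigcup_k F k) x by rewrite -TF.
  have /= [k _ Fky] : (\bigcup_k F k) y by rewrite -TF.
  exists (maxn n k) => //; split.
    by move: x Fnx; exact/subsetPset/ndF/leq_maxl.
  by move: y Fky; exact/subsetPset/ndF/leq_maxr.
move=> k; have [? ?] := Foo k; split; first exact: measurableX.
by rewrite /plane product_measure1E// lte_mul_pinfty// ge0_fin_numE.
Qed.

HB.instance Definition _ (R : realType) := Measure_isSigmaFinite.Build _ _ _
  (@plane R) (@plane_sigma_finite R).

(** * One-dimensional integrals: primitives and inverse square roots *)

Lemma derivable_segment_oo (R : realType) (F : R -> R) (a b : R) : a < b ->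
  (forall x, a <= x <= b -> derivable F x 1) -> derivable_oo_LRcontinuous F a b.
Proof.
move=> ab dF.
have cF x : a <= x <= b -> {for x, continuous F}.
  by move=> /dF dx; apply: differentiable_continuous; exact/derivable1_diffP.
split.
- by move=> x /[!in_itv]/= /andP[ax xb]; apply: dF; rewrite !ltW.
- by apply: cvg_at_right_filter; apply: cF; rewrite lexx ltW.
- by apply: cvg_at_left_filter; apply: cF; rewrite lexx ltW.
Qed.

Lemma FTC_segment (R : realType) (F f : R -> R) (a b : R) : a <= b ->
  (forall x, a <= x <= b -> is_derive x (1 : R) F (f x)) ->
  (forall x, a <= x <= b -> {for x, continuous f}) ->
  (\int[mu]_(x in `[a, b]) (f x)%:E = (F b - F a)%:E)%E.
Proof.
rewrite le_eqVlt => /predU1P[<- _ _|ab dF cf].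
  by rewrite set_itv1 integral_set1 subrr.
rewrite (@continuous_FTC2 _ f F)//.
- apply: continuous_in_subspaceT => x /[!inE]/= /[!in_itv]/=; exact: cf.
- by apply: derivable_segment_oo => // x /dF [].
- by move=> x /[!in_itv]/= /andP[/ltW ax /ltW xb]; rewrite derive1E;
    apply: derive_val; apply: dF; rewrite ax xb.
Qed.

(** The integrand may blow up at both ends, so the interval is exhausted by segments. On each of
    them the integral is a difference of two values of [F], and monotone convergence passes to the
    limit. *)
Lemma le_integral_oo_of_primitive (R : realType) (F f : R -> R) (a b B : R) : a < b ->
  {in `]a, b[, forall x, is_derive x (1 : R) F (f x)} ->
  {in `]a, b[, forall x, {for x, continuous f}} ->
  {in `]a, b[, forall x, 0 <= f x} ->
  {in `]a, b[, forall x, `|F x| <= B} ->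
  (\int[mu]_(x in `]a, b[) (f x)%:E <= (B *+ 2)%:E)%E.
Proof.
move=> ab dF cf f0 FB.
(* A margin tending to 0 and at most half the length, so that every segment [D n] is nonempty. *)
pose e n : R := (b - a) / 2 / n.+1%:R.
have e0 n : 0 < e n by rewrite divr_gt0// divr_gt0// subr_gt0.
have e1 n : e n <= (b - a) / 2.
  by rewrite ler_pdivrMr// ler_peMr ?ler1n// divr_ge0// subr_ge0 ltW.
pose D n := `[a + e n, b - e n]%classic.
have Dsub n : D n `<=` `]a, b[.
  move=> x; rewrite /D/= !in_itv/= => /andP[ax xb]; apply/andP; split.
    by apply: lt_le_trans ax; rewrite ltrDl.
  by apply: le_lt_trans xb _; rewrite ltrBlDr ltrDl.
have UD : \bigcup_n D n = `]a, b[%classic.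
  apply/seteqP; split => [x [n _]|x]; first exact: Dsub.
  rewrite /= in_itv/= => /andP[ax xb].
  pose d := Num.min (x - a) (b - x).
  have d0 : 0 < d by rewrite lt_min !subr_gt0 ax.
  exists (Num.truncn ((b - a) / 2 / d)) => //.
  have ed : e (Num.truncn ((b - a) / 2 / d)) <= d.
    rewrite /e ler_pdivrMr// [d * _]mulrC -ler_pdivrMr//; apply: ltW.
    exact: truncnS_gt.
  rewrite /D/= in_itv/=; apply/andP; split.
    by rewrite -lerBrDl (le_trans ed)// ge_min lexx.
  by rewrite lerBrDr -lerBrDl (le_trans ed)// ge_min lexx orbT.
have cfm : measurable_fun `]a, b[ f.
  by apply: open_continuous_measurable_fun => // x /[!inE]; exact: cf.
rewrite -UD.
have H := @ge0_nondecreasing_set_cvg_integral _ (measurableTypeR R) R D (EFin \o f) mu.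
apply: (cvge_le (F := \oo) (f := fun n => (\int[mu]_(x in D n) (f x)%:E)%E)); last first.
  apply: H.
  - apply/nondecreasing_seqP => n; apply/subsetPset => x; rewrite /D/= !in_itv/=.
    have en : e n.+1 <= e n.
      by rewrite ler_pM2l ?divr_gt0 ?subr_gt0// lef_pV2 ?posrE// ler_nat.
    move=> /andP[ax xb]; apply/andP; split; first by apply: le_trans ax; rewrite lerD2l.
    by apply: le_trans xb _; rewrite lerD2l lerN2.
  - by move=> n; exact: measurable_itv.
  - move=> n; apply: measurable_funS (Dsub n) _ => //.
    exact/measurable_EFinP.
  - by move=> n x /Dsub xab; rewrite lee_fin; exact: f0.
near=> n; have ae : a + e n <= b - e n by have := e1 n; lra.
have dFn x : a + e n <= x <= b - e n -> is_derive x (1 : R) F (f x).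
  by move=> xab; apply: dF; apply: (Dsub n).
have cfn x : a + e n <= x <= b - e n -> {for x, continuous f}.
  by move=> xab; apply: cf; apply: (Dsub n).
rewrite /D (FTC_segment ae dFn cfn) lee_fin mulr2n lerD//.
  apply: le_trans (ler_norm _) _; apply: FB; apply: (Dsub n).
  by rewrite /D/= in_itv/= lexx andbT.
rewrite lerNl; have : `|F (a + e n)| <= B.
  by apply: FB; apply: (Dsub n); rewrite /D/= in_itv/= lexx.
by rewrite ler_norml => /andP[].
Unshelve. all: by end_near. Qed.

(** A product of two such factors dominates 1 / |w| in the plane, and each factor is integrable on
    bounded intervals. The value at 0 is 0. *)
Definition rsqrt (R : realType) (t : R) : R := (Num.sqrt `|t|)^-1.

Lemma rsqrt_ge0 (R : realType) (t : R) : 0 <= rsqrt t.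
Proof. by rewrite /rsqrt invr_ge0 sqrtr_ge0. Qed.

Lemma measurable_inv (R : realType) : measurable_fun [set: R] (fun x : R => x^-1).
Proof.
(* Through real powers, whose measurability is [measurable_powR]; at 0 both sides vanish. *)
have -> : (fun x : R => x^-1) = (fun x => x * ((x ^+ 2) `^ (- 1))).
  apply/funext => x; rewrite powR_inv1 ?sqr_ge0//.
  have [->|x0] := eqVneq x 0; first by rewrite invr0 mul0r.
  by rewrite expr2 invfM mulrA divff// mul1r.
apply: measurable_funM => //.
apply: (measurableT_comp (f := fun y : R => y `^ (- 1))).
  exact: measurable_powR.
exact: measurable_funX.
Qed.

Lemma measurable_rsqrt (R : realType) : measurable_fun [set: R] (@rsqrt R).
Proof.
apply: (measurableT_comp (@measurable_inv R)).
apply: (measurableT_comp (f := fun y : R => Num.sqrt y)).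
  by apply: continuous_measurable_fun => x; exact: sqrt_continuous.
exact: normr_measurable.
Qed.

Lemma int_rsqrt (R : realType) (N tau : R) : `|tau| <= N ->
  (\int[mu]_(y in `[(- N)%R, N]) (rsqrt (tau - y))%:E
    <= (8 * Num.sqrt (N *+ 2))%:E)%E.
Proof.
rewrite ler_norml => /andP[Nt tN].
have mr : measurable_fun [set: R] (fun y => rsqrt (tau - y)).
  by apply: (measurableT_comp (@measurable_rsqrt R)); apply: measurable_funB.
have N0 : 0 <= N by lra.
(* The sign [s] is -1 to the left of [tau] and 1 to its right, so that s (x - tau) = |x - tau|; the
   primitive 2 s sqrt (s (y - tau)) is bounded by 2 sqrt (2 N). *)
have half (a b s : R) : s ^+ 2 = 1 -> - N <= a -> b <= N ->
    (forall x : R, a < x < b -> 0 < s * (x - tau)) ->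
    (\int[mu]_(y in `]a, b[) (rsqrt (tau - y))%:E
      <= (4 * Num.sqrt (N *+ 2))%:E)%E.
  move=> s2 Na bN sx.
  have ns : `|s| = 1 by apply/eqP; rewrite -(@eqrXn2 _ 2)// real_normK ?num_real// s2 expr1n.
  have alg v : 2 * s * (2^-1 * v * s) = v.
    by transitivity (s ^+ 2 * v); [field|rewrite s2 mul1r].
  have [ab|ba] := ltP a b; last first.
    rewrite set_itv_ge ?integral_set0 ?lee_fin ?mulr_ge0 ?sqrtr_ge0//.
    by rewrite bnd_simp -leNgt.
  have rE x : a < x < b -> rsqrt (tau - x) = (Num.sqrt (s * (x - tau)))^-1.
    move=> /sx; rewrite /rsqrt distrC => s0; congr (Num.sqrt _)^-1.
    by rewrite -[LHS]mul1r -ns -normrM gtr0_norm.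
  rewrite (_ : 4 * _ = (2 * Num.sqrt (N *+ 2)) *+ 2); last by rewrite mulr2n; lra.
  apply: (@le_integral_oo_of_primitive _ (fun y : R => 2 * s * Num.sqrt (s * (y - tau)))) => //.
  - move=> x xab; rewrite rE//; have s0 := sx _ xab.
    have d1 : is_derive x 1 (fun y : R => s * (y - tau)) s.
      by apply: is_derive_eq; rewrite subr0; exact: mulr1.
    have d2 := @is_derive1_comp R Num.sqrt (fun y => s * (y - tau)) _ _ _ (is_derive1_sqrt s0) d1.
    apply: (is_derive_eq (is_deriveZ (2 * s) d2)); rewrite /GRing.scale/=.
    by rewrite invfM alg.
  - move=> x xab; apply: (@continuous_comp _ _ _ (fun y => Num.sqrt `|tau - y|) (fun y => y^-1)).
      apply: continuous_comp; last exact: sqrt_continuous.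
      apply: continuous_comp; last exact: norm_continuous.
      by apply: continuousB; [exact: cst_continuous|].
    apply: inv_continuous; rewrite gt_eqF// sqrtr_gt0 normr_gt0.
    have := sx _ xab; apply: contraTneq => /eqP; rewrite subr_eq0 => /eqP ->.
    by rewrite subrr mulr0 ltxx.
  - by move=> x xab; exact: rsqrt_ge0.
  - move=> x xab; rewrite !normrM ns mulr1 ger0_norm// ger0_norm ?sqrtr_ge0//.
    rewrite ler_pM2l// ler_wsqrtr//; move: xab; rewrite in_itv/= => xab.
    rewrite (le_trans (ler_norm _))// normrM ns mul1r.
    by move: xab => /andP[? ?]; rewrite ler_norml mulr2n; lra.
have -> : (\int[mu]_(y in `[(- N)%R, N]) (rsqrt (tau - y))%:E =
  \int[mu]_(y in `[(- N)%R, tau[) (rsqrt (tau - y))%:E +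
  \int[mu]_(y in `]tau, N]) (rsqrt (tau - y))%:E)%E.
  rewrite -(@integral_setD1 _ _ tau).
  - have -> : `[- N, N]%classic `\ tau = `[- N, tau[%classic `|` `]tau, N]%classic.
      apply/seteqP; split => x /=; rewrite !in_itv/=.
        move=> [/andP[Nx xN] /eqP]; rewrite neq_lt => /orP[xt|xt]; [left|right];
          by rewrite ?Nx ?xt ?xN.
      move=> [/andP[Nx xt]|/andP[tx xN]]; split.
      + by rewrite Nx (le_trans (ltW xt)).
      + by apply/eqP; rewrite lt_eqF.
      + by rewrite xN (le_trans Nt (ltW tx)).
      + by apply/eqP; rewrite gt_eqF.
    rewrite ge0_integral_setU//=.
    + apply/measurable_EFinP; exact: measurable_funS mr.
    + by move=> x _; rewrite lee_fin rsqrt_ge0.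
    + apply/disj_setPS => x [] /=; rewrite !in_itv/= => /andP[_ xt] /andP[tx _].
      by have := lt_trans xt tx; rewrite ltxx.
  - by apply: measurableD.
  - by apply/measurable_EFinP; exact: measurable_funS mr.
rewrite (_ : 8 * _ = 4 * Num.sqrt (N *+ 2) + 4 * Num.sqrt (N *+ 2)); last by lra.
rewrite EFinD; apply: leeD.
  rewrite (integral_itv_bndoo true true) //; last first.
    by apply/measurable_EFinP; exact: measurable_funS mr.
  apply: (half _ _ (-1)) => //; first by rewrite sqrrN expr1n.
  by move=> x /andP[_ xt]; rewrite mulN1r opprB subr_gt0.
rewrite (integral_itv_bndoo false false) //; last first.
  by apply/measurable_EFinP; exact: measurable_funS mr.
apply: (half _ _ 1) => //; first by rewrite expr1n.
by move=> x /andP[xt _]; rewrite mul1r subr_gt0.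
Qed.

Definition rsqrt_on (R : realType) (N t y : R) : R :=
  rsqrt (t - y) * \1_(`[- N, N]%classic) y.

Lemma rsqrt_on_ge0 (R : realType) (N t y : R) : 0 <= rsqrt_on N t y.
Proof. by rewrite mulr_ge0 ?rsqrt_ge0// indicE ler0n. Qed.

Lemma measurable_rsqrt_on (R : realType) (N t : R) :
  measurable_fun [set: R] (rsqrt_on N t).
Proof.
apply: measurable_funM; last exact: measurable_indic.
by apply: (measurableT_comp (@measurable_rsqrt R)); apply: measurable_funB.
Qed.

Lemma int_rsqrt_on (R : realType) (N t : R) : `|t| <= N ->
  (\int[mu]_y (rsqrt_on N t y)%:E <= (8 * Num.sqrt (N *+ 2))%:E)%E.
Proof.
move=> /int_rsqrt; apply: le_trans; rewrite [leRHS]integral_mkcond epatch_indic.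
by apply: ge0_le_integral => //= *; rewrite ?lee_fin ?rsqrt_on_ge0//;
  apply/measurable_EFinP; exact: measurable_rsqrt_on.
Qed.

(** Serves to discard, one variable at a time, the lines through the singularity parallel to the
    axes, where nothing is known of the kernel. *)
Lemma integral_setT_D1 (R : realType) (f : R -> \bar R) (r : R) :
  measurable_fun setT f -> (\int[mu]_y f y = \int[mu]_(y in [set~ r]) f y)%E.
Proof.
move=> mf; rewrite -setTD integral_setD1//; first exact: measurableD.
exact: measurable_funS mf.
Qed.

(** * Absolute convergence of convolutions with weakly singular kernels *)

Section weakly_singular.
Context (R : realType) (K : R * R -> R) (Om : set (R * R)) (N C : R).
Hypotheses (mK : measurable_fun [set: R * R] K) (mOm : measurable Om).
Hypothesis OmN : forall y, Om y -> `|y.1| <= N /\ `|y.2| <= N.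
Hypothesis C0 : 0 <= C.
Hypothesis KC : forall w, `|w.1| <= N *+ 2 -> `|w.2| <= N *+ 2 ->
  w.1 != 0 -> w.2 != 0 -> `|K w| <= C * (rsqrt w.1 * rsqrt w.2).

Lemma measurable_shifted (x : R * R) :
  measurable_fun [set: R * R] (fun y => K (x - y) * \1_Om y).
Proof.
apply: measurable_funM; last exact: measurable_indic.
apply: (measurableT_comp mK); apply: measurable_fun_pair;
  by apply: measurable_funB.
Qed.

Lemma le_shifted (x y : R * R) : `|x.1| <= N -> `|x.2| <= N ->
  y.1 != x.1 -> y.2 != x.2 ->
  `|K (x - y) * \1_Om y| <= C * (rsqrt_on N x.1 y.1 * rsqrt_on N x.2 y.2).
Proof.
move=> x1 x2 y1 y2; rewrite indicE; case: (boolP (y \in Om)); last first.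
  by move=> _; rewrite mulr0 normr0; apply: mulr_ge0 => //; apply: mulr_ge0; exact: rsqrt_on_ge0.
rewrite inE => /OmN[y1N y2N]; rewrite mulr1 /rsqrt_on !indicE.
rewrite !mem_set ?mulr1; [|by rewrite /= in_itv/= -ler_norml..].
apply: KC => /=; [| |by rewrite subr_eq0 eq_sym..].
  by rewrite (le_trans (ler_normB _ _))// mulr2n lerD.
by rewrite (le_trans (ler_normB _ _))// mulr2n lerD.
Qed.

Lemma int_shifted_le (x : R * R) : `|x.1| <= N -> `|x.2| <= N ->
  (\int[mu \x mu]_y `|(K (x - y) * \1_Om y)%:E|
    <= (C * (8 * Num.sqrt (N *+ 2)) ^+ 2)%:E)%E.
Proof.
move=> x1 x2; set r := 8 * _; have r0 : 0 <= r by rewrite mulr_ge0 ?sqrtr_ge0.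
have mf : measurable_fun [set: R * R] (fun y => `|(K (x - y) * \1_Om y)%:E|%E).
  by apply: measurableT_comp => //; apply/measurable_EFinP; exact: measurable_shifted.
rewrite fubini_tonelli2//.
have mG := @measurable_fun_fubini_tonelli_G _ _ _ _ R mu _ mf (fun=> abse_ge0 _).
rewrite (integral_setT_D1 x.2)//.
have m1 (t : R) : measurable [set~ t] by exact: measurableC.
apply: (@le_trans _ _ (\int[mu]_(y in [set~ x.2]) ((C * r)%:E * (rsqrt_on N x.2 y)%:E))%E).
  apply: ge0_le_integral => //.
  - exact: m1.
  - by move=> y _; exact: integral_ge0.
  - exact: measurable_funS mG.
  - apply: measurable_funS (measurableT) (@subsetT _ _) _.
    by apply: measurable_funeM; apply/measurable_EFinP; exact: measurable_rsqrt_on.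
  move=> y /= /eqP yx; rewrite /fubini_G (integral_setT_D1 x.1); last first.
    exact: (measurable_fun_pair1 y mf).
  apply: (@le_trans _ _ (\int[mu]_(t in [set~ x.1]) ((C * rsqrt_on N x.2 y)%:E * (rsqrt_on N x.1 t)%:E))%E).
    apply: ge0_le_integral => //.
    - exact: m1.
    - by apply: measurable_funS (measurable_fun_pair1 y mf).
    - apply: measurable_funS (measurableT) (@subsetT _ _) _.
      by apply: measurable_funeM; apply/measurable_EFinP; exact: measurable_rsqrt_on.
    have alg (u v : R) : C * (u * v) = C * v * u by ring.
    move=> t /= /eqP tx; rewrite -EFinM lee_fin (le_trans (le_shifted _ _ _ _))//=.
    by rewrite alg.
  rewrite ge0_integralZl_EFin//; last 4 first.
  - exact: m1.
  - by move=> t _; rewrite lee_fin rsqrt_on_ge0.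
  - by apply: measurable_funS (measurableT) (@subsetT _ _) _; apply/measurable_EFinP; exact: measurable_rsqrt_on.
  - by rewrite mulr_ge0// rsqrt_on_ge0.
  rewrite -integral_setT_D1; last by apply/measurable_EFinP; exact: measurable_rsqrt_on.
  apply: (@le_trans _ _ ((C * rsqrt_on N x.2 y)%:E * r%:E)%E).
    apply: lee_wpmul2l; last exact: int_rsqrt_on.
    by rewrite lee_fin mulr_ge0// rsqrt_on_ge0.
  by rewrite -!EFinM mulrAC.
rewrite ge0_integralZl_EFin//; last 4 first.
- exact: m1.
- by move=> t _; rewrite lee_fin rsqrt_on_ge0.
- by apply: measurable_funS (measurableT) (@subsetT _ _) _; apply/measurable_EFinP; exact: measurable_rsqrt_on.
- by rewrite mulr_ge0.
rewrite -integral_setT_D1; last by apply/measurable_EFinP; exact: measurable_rsqrt_on.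
apply: (@le_trans _ _ ((C * r)%:E * r%:E)%E); last by rewrite -EFinM -mulrA.
by apply: lee_wpmul2l; [rewrite lee_fin mulr_ge0|exact: int_rsqrt_on].
Qed.

Lemma integrable_shifted (x : R * R) : `|x.1| <= N -> `|x.2| <= N ->
  (mu \x mu)%E.-integrable setT (EFin \o (fun y => K (x - y) * \1_Om y)).
Proof.
move=> x1 x2; apply/integrableP; split.
  by apply/measurable_EFinP; exact: measurable_shifted.
by apply: le_lt_trans (int_shifted_le x1 x2) _; rewrite ltry.
Qed.

End weakly_singular.

Lemma negligible_horizontal_line (R : realType) (c : R) :
  (@plane R).-negligible [set y : R * R | y.2 = c].
Proof.
exists (setT `*` [set c]); split.
- by apply: measurableX.
- by rewrite /plane product_measure1E//= lebesgue_measure_set1 mule0.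
- by move=> y /= yc.
Qed.

(** * Differentiation of convolutions *)

Section partial_derivative.
Context (R : realType) (k k1 : R * R -> R) (Om : set (R * R)) (N C : R).
Hypotheses (mk : measurable_fun [set: R * R] k)
  (mk1 : measurable_fun [set: R * R] k1) (mOm : measurable Om).
Hypothesis OmN : forall y, Om y -> `|y.1| <= N /\ `|y.2| <= N.
Hypothesis C0 : 0 <= C.
Hypothesis kC : forall w, `|w.1| <= N *+ 2 -> `|w.2| <= N *+ 2 ->
  w.1 != 0 -> w.2 != 0 -> `|k w| <= C * (rsqrt w.1 * rsqrt w.2).
Hypothesis k1C : forall w, `|w.1| <= N *+ 2 -> `|w.2| <= N *+ 2 ->
  w.1 != 0 -> w.2 != 0 -> `|k1 w| <= C * (rsqrt w.1 * rsqrt w.2).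
Hypothesis dk : forall u v : R, v != 0 ->
  is_derive u (1 : R) (fun t => k (t, v)) (k1 (u, v)).
Hypothesis ck1 : forall v : R, v != 0 -> continuous (fun t => k1 (t, v)).
Variable x : R * R.
Hypotheses (xN1 : `|x.1| + 1 <= N) (xN2 : `|x.2| <= N).

Let e (t : R) : R * R := x + (t, 0).

Let eN t : -1 <= t <= 1 -> `|(e t).1| <= N /\ `|(e t).2| <= N.
Proof.
move=> t1; split; rewrite /= ?addr0//.
rewrite (le_trans (ler_normD _ _))// (le_trans _ xN1)// lerD2l.
by rewrite ler_norml.
Qed.

Let V (t : R) : R := \int[@plane R]_y (k (e t - y) * \1_Om y).
Let I (t : R) : R := \int[@plane R]_y (k1 (e t - y) * \1_Om y).

Let slice_FTC (y : R * R) (h : R) : -1 <= h -> y.2 != x.2 ->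
  (\int[mu]_(t in `[(-1)%R, h]) (k1 (e t - y))%:E =
   (k (e h - y) - k (e (-1) - y))%:E)%E.
Proof.
move=> h1 yx; have yx0 : x.2 + 0 - y.2 != 0 by rewrite addr0 subr_eq0 eq_sym.
apply: (@FTC_segment R (fun t => k (e t - y)) (fun t => k1 (e t - y)) _ _ h1).
- move=> t _.
  have d1 : is_derive t (1 : R) (fun s : R => x.1 + s - y.1) (1 : R).
    by apply: is_derive_eq; rewrite ?subr0 ?add0r ?addr0.
  have := @is_derive1_comp R (fun s => k (s, x.2 + 0 - y.2))
    (fun s => x.1 + s - y.1) t _ _ (dk _ yx0) d1.
  by rewrite mulr1.
- move=> t _.
  apply: (@continuous_comp _ _ _ (fun s : R => x.1 + s - y.1)
    (fun s => k1 (s, x.2 + 0 - y.2))); last exact: ck1.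
  apply: continuousB; last exact: cst_continuous.
  by apply: continuousD; [exact: cst_continuous|].
Qed.

(** The time interval enters as an indicator in the integrand, so that Fubini can be used on the
    whole product space. *)
Let H (h : R) (p : R * (R * R)) : R :=
  k1 (e p.1 - p.2) * \1_Om p.2 * \1_(`[-1, h]%classic) p.1.

Let Hin h t y : t \in `[-1, h]%classic -> H h (t, y) = k1 (e t - y) * \1_Om y.
Proof. by move=> th; rewrite /H/= [X in _ * X]indicE th mulr1. Qed.

Let Hout h t y : t \notin `[-1, h]%classic -> H h (t, y) = 0.
Proof. by move=> th; rewrite /H/= [X in _ * X]indicE (negbTE th) mulr0. Qed.

Let measurable_H h : measurable_fun [set: R * (R * R)] (H h).
Proof.
apply: measurable_funM; last first.
  by apply: (measurableT_comp (f := (\1_(`[-1, h]%classic) : R -> R))).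
apply: measurable_funM; last first.
  by apply: (measurableT_comp (f := (\1_Om : R * R -> R))).
apply: (measurableT_comp mk1).
apply: measurable_fun_pair; apply: measurable_funB => //=.
- by apply: measurable_funD => //; exact: measurable_fst.
- by apply: (measurableT_comp measurable_fst); exact: measurable_snd.
- by apply: (measurableT_comp measurable_snd); exact: measurable_snd.
Qed.

Let r := C * (8 * Num.sqrt (N *+ 2)) ^+ 2.

Let r0 : 0 <= r. Proof. by rewrite mulr_ge0// sqr_ge0. Qed.

Let inner_H h t : h <= 1 ->
  (\int[@plane R]_y (H h (t, y))%:E = (I t * \1_(`[-1, h]%classic) t)%:E)%E.
Proof.
move=> h1; rewrite indicE; case: (boolP (t \in _)) => [|tn]; last first.
  rewrite mulr0 integral0_eq// => y _.
  by rewrite Hout.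
move=> tin; rewrite mulr1.
have /andP[t1 th] : -1 <= t <= h by move: tin; rewrite inE/= in_itv.
have [] := @eN t; first by rewrite t1 (le_trans th).
move=> e1 e2; rewrite /I /Rintegral fineK; last first.
  apply: integrable_fin_num => //.
  exact: (integrable_shifted mk1 mOm OmN C0 k1C e1 e2).
by apply: eq_integral => y _; rewrite Hin.
Qed.

Let integrable_H h : h <= 1 -> (mu \x @plane R)%E.-integrable setT (EFin \o H h).
Proof.
move=> h1; apply/integrable12ltyP.
  by apply/measurable_EFinP; exact: measurable_H.
apply: (@le_lt_trans _ _ (\int[mu]_t (r%:E * (\1_(`[(-1)%R, h]%classic) t)%:E))%E).
  apply: ge0_le_integral => //.
  - by move=> t _; exact: integral_ge0.
  - apply: (@measurable_fun_fubini_tonelli_F _ _ _ _ R (@plane R) (abse \o (EFin \o H h)) _ (fun=> abse_ge0 _)).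
    by apply: measurableT_comp => //; apply/measurable_EFinP; exact: measurable_H.
  - by apply: measurable_funeM; apply/measurable_EFinP; exact: measurable_indic.
  move=> t _; rewrite [in leRHS]indicE; case: (boolP (t \in _)) => [|tn]; last first.
    rewrite mule0 integral0_eq// => y _.
    by rewrite /= Hout// normr0.
  move=> tin; rewrite mule1.
  have /andP[t1 th] : -1 <= t <= h by move: tin; rewrite inE/= in_itv.
  have [] := @eN t; first by rewrite t1 (le_trans th).
  move=> e1 e2; apply: le_trans (int_shifted_le mk1 mOm OmN C0 k1C e1 e2).
  rewrite le_eqVlt; apply/orP; left; apply/eqP.
  by apply: eq_integral => y _; rewrite /= Hin.
rewrite ge0_integralZl_EFin//; last first.
  by apply/measurable_EFinP; exact: measurable_indic.
have fin : (mu `[(-1)%R, h]%classic < +oo)%E.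
  by rewrite lebesgue_measure_itv/=; case: ifPn => _; rewrite ?ltry// -EFinB ltry.
by rewrite integral_indic// setIT; apply: lte_mul_pinfty.
Qed.

(** Fubini for [H]: integrating over the plane first gives [I t], and integrating over time first
    gives, by [slice_FTC], the increment of [k] along the segment. *)
Let increment h : -1 <= h <= 1 ->
  ((V h - V (-1))%:E = \int[mu]_(t in `[(-1)%R, h]) (I t)%:E)%E.
Proof.
move=> /andP[h1 hle1]; rewrite [RHS]integral_mkcond.
have ih := integrable_H hle1.
transitivity (\int[mu]_t \int[@plane R]_y (H h (t, y))%:E)%E; last first.
  apply: eq_integral => t _; rewrite inner_H// patchE indicE.
  by case: ifPn => _; rewrite ?mulr1 ?mulr0.
have [a1 a2] : `|(e h).1| <= N /\ `|(e h).2| <= N by apply: eN; rewrite h1.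
have [b1 b2] : `|(e (-1)).1| <= N /\ `|(e (-1)).2| <= N by apply: eN; lra.
have ia := integrable_shifted mk mOm OmN C0 kC a1 a2.
have ib := integrable_shifted mk mOm OmN C0 kC b1 b2.
rewrite (Fubini ih) /V -RintegralB//.
rewrite /Rintegral fineK; last first.
  by apply: integrable_fin_num => //; exact: (integrableB measurableT ia ib).
apply: ae_eq_integral => //.
- by apply/measurable_EFinP/measurable_funB; exact: measurable_shifted.
- exact: (measurable_fubini_G ih).
(* Only for y on the row of x can the segment of points e t - y pass through the singularity; this
   row is null. *)
have := negligible_horizontal_line x.2; apply: negligibleS => y /=.
move=> /not_implyP[_]; apply: contra_notP => /eqP yx.
have [yOm|yOm] := boolP (y \in Om); last first.
  rewrite /= indicE (negbTE yOm) !mulr0 subr0 integral0_eq// => t _.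
  by rewrite /H/= indicE (negbTE yOm) mulr0 mul0r.
rewrite /= indicE yOm !mulr1 -(slice_FTC h1 yx) [LHS]integral_mkcond.
apply: eq_integral => t _; rewrite patchE; case: ifPn => th.
  by rewrite /= Hin// indicE yOm mulr1.
by rewrite /= Hout.
Qed.

Let integrable_I : mu.-integrable `[(-1)%R, 1%R] (EFin \o I).
Proof.
have /integrableS := integrable_fubini_F (integrable_H (lexx 1)).
move=> /(_ `[(-1)%R, 1%R]%classic measurableT) iF.
apply: eq_integrable (iF _ _) => // t; rewrite inE/= => t1.
by rewrite /fubini_F/= inner_H// indicE mem_set ?mulr1.
Qed.

(** The potential along the line is a constant plus the primitive of [I] from -1 by [increment], so
    continuity of [I] at the single point 0 gives the derivative. Starting at -1 makes 0 an interior
    point. *)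
Lemma partial_derivative_convolution : {for 0, continuous I} ->
  is_derive x ((1, 0) : R * R) (fun x => convolution k \1_Om x) (I 0).
Proof.
move=> cI.
have [dF F'] := continuous_FTC1_closed ltr01 integrable_I (ltrN10 R) cI.
have dF0 : is_derive (0 : R) (1 : R)
    (fun h : R => \int[mu]_(t in `[-1, h]) I t) (I 0).
  by split; [exact: dF|rewrite -derive1E; exact: F'].
have : is_derive (0 : R) (1 : R) (fun h => V h - V (-1)) (I 0).
  apply: near_eq_is_derive dF0; near=> h.
  rewrite /Rintegral -increment//; apply/andP; split.
    by apply: ltW; near: h; apply: lt_nbhsr; exact: ltrN10.
  by apply: ltW; near: h; apply: lt_nbhsl; exact: ltr01.
move=> dB; have := is_deriveD (is_derive_cst (V (-1)) (0 : R) (1 : R)) dB.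
rewrite add0r => dV.
have {}dV : is_derive (0 : R) (1 : R) V (I 0).
  rewrite (_ : V = cst (V (-1)) + (fun h => V h - V (-1)))//.
  by apply/funext => h; rewrite fctE addrC subrK.
(* The difference quotients of the convolution at x in direction (1, 0) are those of the
   one-variable function [V] at 0. *)
have E : (fun h : R => h^-1 *: ((convolution k \1_Om \o shift x) (h *: ((1, 0) : R * R))
     - convolution k \1_Om x)) =
   (fun h : R => h^-1 *: ((V \o shift 0) (h *: (1 : R)) - V 0)).
  apply/funext => h; congr (_ *: (_ - _)).
    rewrite /= addr0 /V /convolution; congr (Rintegral _ _ _).
    apply/funext => y; congr (k (_ - _) * _).
    rewrite addrC /e; congr (_ + _).
    by rewrite -[RHS]/((h * 1, 0)) -[LHS]/((h * 1, h * 0)) mulr0.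
  rewrite /V /convolution; congr (Rintegral _ _ _).
  by apply/funext => y; rewrite /e addr0.
by split; [rewrite /derivable E; case: dV|rewrite /derive E; case: dV].
Unshelve. all: by end_near. Qed.

End partial_derivative.

(** * Integration of partial derivatives over an ellipse *)

Section slice_formula.
Context (R : realType) (f f1 : R * R -> R) (a b c : R).
Hypotheses (a0 : 0 < a) (b0 : 0 < b).
Hypothesis df : forall u v : R, v != c ->
  is_derive u (1 : R) (fun t => f (t, v)) (f1 (u, v)).
Hypothesis cf1 : forall v : R, v != c -> continuous (fun t => f1 (t, v)).
Hypothesis if1 : (mu \x mu)%E.-integrable setT
  (EFin \o (fun y => f1 y * \1_(Omega a b) y)).
Hypothesis cf : continuous (fun t : R => f (a * cos t, b * sin t)).

Let g (t : R) := f (a * cos t, b * sin t) - f (- (a * cos t), b * sin t).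

Let cg : continuous g.
Proof.
move=> t; apply: continuousB; first exact: cf.
have -> : (fun t => f (- (a * cos t), b * sin t)) =
    (fun t => f (a * cos t, b * sin t)) \o (fun t => pi - t).
  by apply/funext => s /=; rewrite cosB sinB cospi sinpi !mul0r addr0 sub0r !mulN1r opprK mulrN.
apply: continuous_comp; last exact: cf.
by apply: continuousB; [exact: cst_continuous|].
Qed.

(** The value of [f] at the right end of the slice at height v minus its value at the left end, with
    v = b sin t. *)
Let D (v : R) := g (asin (v / b)).

Let pihalf : - (pi / 2) <= pi / 2 :> R.
Proof. by rewrite -subr_ge0 opprK addr_ge0// divr_ge0// pi_ge0. Qed.

Let dF (t : R) : is_derive t (1 : R) (fun s => b * sin s) (b * cos t).
Proof. by apply: is_derive_eq. Qed.

Let cD : {within `[(- b), b], continuous D}.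
Proof.
(* [asin] is continuous up to the endpoints as the inverse of a continuous function on a segment. *)
have := @segment_can_le_continuous R (- (pi / 2)) (pi / 2)
  (fun t => b * sin t) (fun v => asin (v / b)) pihalf.
rewrite sinN sin_pihalf mulrN mulr1 => cH v.
rewrite (_ : from_subspace _ D =
  g \o from_subspace `[- b, b]%classic (fun v => asin (v / b)))//.
apply: continuous_comp; last exact: cg.
apply: cH => [|t tI].
  apply: continuous_subspaceT => t; apply: continuousM; first exact: cst_continuous.
  exact: continuous_sin.
by rewrite mulrAC divff ?gt_eqF// mul1r sinK.
Qed.

Let slice (v : R) : v != c ->
  (\int[mu]_u (f1 (u, v) * \1_(Omega a b) (u, v))%:E =
   (D v * \1_(`]- b, b[%classic) v)%:E)%E.
Proof.
move=> vc; have [vb|vb] := boolP (v \in `]- b, b[%classic); last first.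
  rewrite [X in _ = (_ * X)%:E]indicE (negbTE vb) mulr0 integral0_eq// => u _.
  rewrite indicE memNset ?mulr0// => uv; move/negP : vb; apply.
  rewrite inE/= in_itv/= -ltr_norml -(@ltr_pXn2r _ 2)// ?nnegrE ?ltW//.
  rewrite real_normK ?num_real// -[ltRHS]mul1r -ltr_pdivrMr ?exprn_gt0//.
  by apply: le_lt_trans uv; rewrite lerDr divr_ge0// sqr_ge0.
rewrite [X in _ = (_ * X)%:E]indicE vb mulr1.
have {}vb : -1 < v / b < 1.
  by move: vb; rewrite inE/= in_itv/= ltr_pdivlMr// ltr_pdivrMr// mulN1r mul1r.
rewrite /D; set t := asin (v / b).
have vE : v = b * sin t.
  by rewrite asinK ?in_itv/= ?(ltW (proj1 (andP vb))) ?(ltW (proj2 (andP vb)))// mulrC divfK ?gt_eqF.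
have ct : 0 < cos t.
  apply: cos_gt0_pihalf; case/andP: vb => v1 v2.
  by rewrite asin_gtNpi2 ?v1 ?(ltW v2)// asin_ltpi2// v2 ltW.
have act : 0 < a * cos t by rewrite mulr_gt0.
(* At height v = b sin t the ellipse is cut in an open interval of half-length a cos t. *)
have Om u : Omega a b (u, v) <-> u \in `]- (a * cos t), a * cos t[.
  rewrite /Omega/= in_itv/= -ltr_norml -[X in _ <-> is_true X](@ltr_pXn2r _ 2)// ?nnegrE ?ltW//.
  rewrite real_normK ?num_real// vE exprMn [b ^+ 2 * _]mulrC mulfK; last first.
    by rewrite expf_neq0 ?gt_eqF.
  by rewrite -ltrBrDr -cos2sin2 ltr_pdivrMr ?exprn_gt0// mulrC -exprMn.
transitivity (\int[mu]_(u in `](- (a * cos t))%R, (a * cos t)%R[) (f1 (u, v))%:E)%E.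
  rewrite [RHS]integral_mkcond; apply: eq_integral => u _; rewrite patchE.
  case: ifPn => [|/negP ut].
    by rewrite inE/= => /Om uO; rewrite indicE mem_set ?mulr1.
  by rewrite indicE memNset ?mulr0// => /Om uO; apply: ut; rewrite inE.
rewrite -(integral_itv_bndoo true false); last first.
  apply: measurable_funS (measurableT) (@subsetT _ _) _.
  by apply/measurable_EFinP; apply: continuous_measurable_fun; exact: cf1.
have le_act : - (a * cos t) <= a * cos t by rewrite ge0_cp// ltW.
have dfv u : - (a * cos t) <= u <= a * cos t ->
  is_derive u (1 : R) (fun u => f (u, v)) (f1 (u, v)) by move=> _; exact: df.
rewrite (FTC_segment le_act dfv) ?/g -?vE// => u _; exact: cf1.
Qed.

Let intD : (\int[mu]_(v in `[(- b)%R, b]) (D v)%:E =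
  \int[mu]_(t in `[(- (pi / 2))%R, (pi / 2)%R])
    (b * cos t * (f (a * cos t, b * sin t) - f (- (a * cos t), b * sin t)))%:E)%E.
Proof.
have F'E : (fun s : R => b * sin s)^`()%classic = (fun t => b * cos t).
  by apply/funext => t; rewrite derive1E; apply: derive_val.
have cF' : continuous (fun t => b * cos t).
  by move=> t; apply: continuousM; [exact: cst_continuous|exact: continuous_cos].
have := @integration_by_substitution_increasing R (fun t => b * sin t) D
  (- (pi / 2)) (pi / 2) pihalf.
rewrite sinN sin_pihalf mulrN mulr1 F'E => ->.
- apply: eq_integral => t; rewrite inE/= => tI.
  have atE : asin (b * sin t / b) = t by rewrite mulrAC divff ?gt_eqF// mul1r sinK.
  by rewrite fctE/= /D atE mulrC.
- by move=> x y xI yI xy; rewrite ltr_pM2l// ltr_sin.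
- by move=> t _; exact: cF'.
- by apply: cvgP; apply: cvg_at_right_filter; exact: cF'.
- by apply: cvgP; apply: cvg_at_left_filter; exact: cF'.
- apply: derivable_segment_oo => //.
  by rewrite -subr_gt0 opprK addr_gt0// divr_gt0// pi_gt0.
- exact: cD.
Qed.

(** On almost every slice the integral of [f1] is the difference of the end values of [f]; the
    substitution v = b sin t then makes the integral over the heights one over the parameter of the
    boundary, with weight b cos t. *)
Lemma integral_slices : \int[@plane R]_y (f1 y * \1_(Omega a b) y) =
  \int[mu]_(t in `[- (pi / 2), pi / 2])
    (b * cos t * (f (a * cos t, b * sin t) - f (- (a * cos t), b * sin t))).
Proof.
rewrite /Rintegral; congr fine; rewrite -intD.
transitivity (\int[mu]_v \int[mu]_u (f1 (u, v) * \1_(Omega a b) (u, v))%:E)%E.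
  exact/esym/(integral21_prod_meas1 if1).
rewrite (integral_setT_D1 c); last exact: (measurable_fubini_G if1).
have mD : measurable_fun (`]- b, b[ : set R) D.
  apply: (@measurable_funS _ _ _ _ `[- b, b]%classic) => //.
    exact: subset_itv_oo_cc.
  by apply: subspace_continuous_measurable_fun => //; exact: cD.
transitivity (\int[mu]_(v in [set~ c]) (D v * \1_(`]- b, b[%classic) v)%:E)%E.
  by apply: eq_integral => v; rewrite inE => /eqP vc; exact: slice.
have DE : (fun v => (D v * \1_(`]- b, b[%classic) v)%:E) = (EFin \o D) \_ `]- b, b[.
  apply/funext => v; rewrite patchE indicE.
  by case: ifPn => _; rewrite ?mulr1 ?mulr0.
rewrite DE -integral_setT_D1; last first.
  by apply/(measurable_restrictT (EFin \o D)) => //; exact/measurable_EFinP.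
rewrite -integral_mkcond -(integral_itv_bndoo true false)//.
exact/measurable_EFinP.
Qed.

End slice_formula.

(** * Exchange of the coordinates: from horizontal to vertical lines *)

Definition swap_pair (R : realType) (x : R * R) : R * R := (x.2, x.1).

Lemma measurable_swap_pair (R : realType) :
  measurable_fun [set: R * R] (@swap_pair R).
Proof. by apply: measurable_fun_pair; [exact: measurable_snd|exact: measurable_fst]. Qed.

(** Tonelli in its two orders: both sides are the same iterated integral. *)
Lemma ge0_integral_swap (R : realType) (f : R * R -> \bar R) :
  measurable_fun [set: R * R] f -> (forall y, (0 <= f y)%E) ->
  (\int[@plane R]_y f (swap_pair y) = \int[@plane R]_y f y)%E.
Proof.
move=> mf f0; rewrite {1}/plane (fubini_tonelli1 (m1 := mu) (m2 := mu) (f \o @swap_pair R)) //.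
  by rewrite /plane (fubini_tonelli2 (m1 := mu) (m2 := mu) f).
  exact: (measurableT_comp mf (@measurable_swap_pair R)).
by move=> y; exact: f0.
Qed.

Lemma integral_swap (R : realType) (f : R * R -> \bar R) :
  measurable_fun [set: R * R] f ->
  (\int[@plane R]_y f (swap_pair y) = \int[@plane R]_y f y)%E.
Proof.
move=> mf; rewrite integralE [RHS]integralE; congr (_ - _)%E.
  rewrite -[RHS](ge0_integral_swap (f := f^\+%E))//; last exact: measurable_funepos.
  by apply: eq_integral => y _; rewrite !funeposE.
rewrite -[RHS](ge0_integral_swap (f := f^\-%E))//; last exact: measurable_funeneg.
by apply: eq_integral => y _; rewrite !funenegE.
Qed.

Lemma integrable_swap (R : realType) (f : R * R -> \bar R) :
  (@plane R).-integrable setT f ->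
  (@plane R).-integrable setT (f \o @swap_pair R).
Proof.
move=> /integrableP[mf fy]; apply/integrableP; split.
  exact: (measurableT_comp mf (@measurable_swap_pair R)).
by rewrite (integral_swap (f := abse \o f))//; exact: measurableT_comp.
Qed.

Lemma convolution_swap (R : realType) (k : R * R -> R) (Om : set (R * R)) x :
  measurable_fun [set: R * R] k -> measurable Om ->
  convolution (k \o @swap_pair R) \1_(Om \o @swap_pair R) (swap_pair x) =
  convolution k \1_Om x.
Proof.
move=> mk mOm; rewrite /convolution /Rintegral; congr fine.
rewrite -(integral_swap (f := EFin \o (fun y => k (x - y) * \1_Om y))).
  by apply: eq_integral => y _; rewrite /= /comp !indicE; congr (_ * _)%:E.
by apply/measurable_EFinP; exact: measurable_shifted.
Qed.

Section second_partial_derivative.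
Context (R : realType) (k k2 : R * R -> R) (Om : set (R * R)) (N C : R).
Hypotheses (mk : measurable_fun [set: R * R] k)
  (mk2 : measurable_fun [set: R * R] k2) (mOm : measurable Om).
Hypothesis OmN : forall y, Om y -> `|y.1| <= N /\ `|y.2| <= N.
Hypothesis C0 : 0 <= C.
Hypothesis kC : forall w, `|w.1| <= N *+ 2 -> `|w.2| <= N *+ 2 ->
  w.1 != 0 -> w.2 != 0 -> `|k w| <= C * (rsqrt w.1 * rsqrt w.2).
Hypothesis k2C : forall w, `|w.1| <= N *+ 2 -> `|w.2| <= N *+ 2 ->
  w.1 != 0 -> w.2 != 0 -> `|k2 w| <= C * (rsqrt w.1 * rsqrt w.2).
Hypothesis dk : forall u v : R, u != 0 ->
  is_derive v (1 : R) (fun t => k (u, t)) (k2 (u, v)).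
Hypothesis ck2 : forall u : R, u != 0 -> continuous (fun t => k2 (u, t)).
Variable x : R * R.
Hypotheses (xN1 : `|x.1| <= N) (xN2 : `|x.2| + 1 <= N).

Lemma second_partial_derivative_convolution :
  {for 0, continuous (fun t => convolution k2 \1_Om (x + (0, t)))} ->
  is_derive x ((0, 1) : R * R) (fun x => convolution k \1_Om x)
    (convolution k2 \1_Om x).
Proof.
move=> ck.
have mOm' : measurable (Om \o @swap_pair R).
  by rewrite -[_ \o _]setTI; exact: measurable_swap_pair.
have := @partial_derivative_convolution R (k \o @swap_pair R) (k2 \o @swap_pair R)
  (Om \o @swap_pair R) N C.
move=> /(_ (measurableT_comp mk (@measurable_swap_pair R))
  (measurableT_comp mk2 (@measurable_swap_pair R)) mOm').
have sC (h : R * R -> R) : (forall w, `|w.1| <= N *+ 2 -> `|w.2| <= N *+ 2 ->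
    w.1 != 0 -> w.2 != 0 -> `|h w| <= C * (rsqrt w.1 * rsqrt w.2)) ->
  forall w, `|w.1| <= N *+ 2 -> `|w.2| <= N *+ 2 ->
    w.1 != 0 -> w.2 != 0 -> `|(h \o @swap_pair R) w| <= C * (rsqrt w.1 * rsqrt w.2).
  by move=> hC w w1 w2 w10 w20; rewrite [rsqrt _ * _]mulrC; exact: hC.
move=> /(_ _ C0 (sC _ kC) (sC _ k2C) _ _ (swap_pair x) xN2 xN1).
have cE t : \int[@plane R]_y ((k2 \o @swap_pair R) (swap_pair x + (t, 0) - y) *
    \1_(Om \o @swap_pair R) y) = convolution k2 \1_Om (x + (0, t)).
  exact: (convolution_swap (x + (0, t)) mk2 mOm).
move=> H; have {H} : is_derive (swap_pair x) ((1, 0) : R * R)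
    (fun x => convolution (k \o @swap_pair R) \1_(Om \o @swap_pair R) x)
    (convolution k2 \1_Om (x + (0, 0))).
  rewrite -cE; apply: H => //.
  - by move=> y /OmN[].
  - rewrite (_ : (fun t => _) = (fun t => convolution k2 \1_Om (x + (0, t))))//.
    by apply/funext => t; exact: cE.
rewrite addr0; set F := (fun x => _) => -[dF F'].
have FE : (fun x => convolution k \1_Om x) = F \o @swap_pair R.
  by apply/funext => y; rewrite /F/= convolution_swap.
by rewrite FE; split.
Qed.

End second_partial_derivative.

Lemma Omega_swap (R : realType) (a b : R) :
  Omega b a \o @swap_pair R = Omega a b.
Proof. by apply/funext => y; rewrite /Omega/= addrC. Qed.

Section vertical_slice_formula.
Context (R : realType) (f f2 : R * R -> R) (a b c : R).
Hypotheses (a0 : 0 < a) (b0 : 0 < b).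
Hypothesis df : forall u v : R, u != c ->
  is_derive v (1 : R) (fun t => f (u, t)) (f2 (u, v)).
Hypothesis cf2 : forall u : R, u != c -> continuous (fun t => f2 (u, t)).
Hypothesis if2 : (mu \x mu)%E.-integrable setT
  (EFin \o (fun y => f2 y * \1_(Omega a b) y)).
Hypothesis cf : continuous (fun t : R => f (a * cos t, b * sin t)).

Lemma integral_vertical_slices : \int[@plane R]_y (f2 y * \1_(Omega a b) y) =
  \int[mu]_(t in `[- (pi / 2), pi / 2])
    (a * cos t * (f (a * sin t, b * cos t) - f (a * sin t, - (b * cos t)))).
Proof.
have fE y : (f2 (swap_pair y) * \1_(Omega a b) (swap_pair y)) =
    (f2 \o @swap_pair R) y * \1_(Omega b a) y.
  by rewrite -(Omega_swap b a) !indicE.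
rewrite /Rintegral -(integral_swap (f := EFin \o (fun y => f2 y * \1_(Omega a b) y))); last first.
  exact: (measurable_int _ if2).
transitivity (\int[@plane R]_y ((f2 \o @swap_pair R) y * \1_(Omega b a) y)).
  by congr fine; apply: eq_integral => y _; rewrite -fE.
apply: (@integral_slices R (f \o @swap_pair R) (f2 \o @swap_pair R) b a c) => //.
- have := integrable_swap if2; apply: eq_integrable => // y _.
  by rewrite /= -fE.
(* Exchanging the coordinates carries the parametrisation of the boundary of [Omega b a] to that of
   [Omega a b], taken at pi / 2 - t. *)
- have -> : (fun t => (f \o @swap_pair R) (b * cos t, a * sin t)) =
    (fun t => f (a * cos t, b * sin t)) \o (fun t => pi / 2 - t).
    apply/funext => t /=; rewrite cosB sinB cos_pihalf sin_pihalf.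
    by rewrite !mul0r !mul1r add0r subr0.
  move=> t; apply: continuous_comp; last exact: cf.
  by apply: continuousB; [exact: cst_continuous|].
Qed.

End vertical_slice_formula.

(** * Means over the unit circle *)

(** Componentwise, because real and imaginary parts are integrated separately; [contC_atP]
    identifies it with continuity for the norm of [R[i]]. *)
Definition contC_at (R : realType) (F : R -> R[i]) (t : R) :=
  {for t, continuous (fun t => Re (F t))} /\ {for t, continuous (fun t => Im (F t))}.

Definition contC (R : realType) (F : R -> R[i]) := forall t, contC_at F t.

Lemma ReD (R : realType) (x y : R[i]) : Re (x + y) = Re x + Re y.
Proof. by case: x; case: y. Qed.

Lemma ImD (R : realType) (x y : R[i]) : Im (x + y) = Im x + Im y.
Proof. by case: x; case: y. Qed.

Lemma ReM (R : realType) (x y : R[i]) : Re (x * y) = Re x * Re y - Im x * Im y.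
Proof. by case: x; case: y. Qed.

Lemma ImM (R : realType) (x y : R[i]) : Im (x * y) = Re x * Im y + Im x * Re y.
Proof. by case: x => ? ?; case: y => ? ?; rewrite /= addrC. Qed.

Lemma normcE (R : realType) (x : R[i]) :
  normc x = Num.sqrt (Re x ^+ 2 + Im x ^+ 2).
Proof. by case: x. Qed.

Lemma normc_ge0 (R : realType) (x : R[i]) : 0 <= normc x.
Proof. by rewrite normcE sqrtr_ge0. Qed.

Lemma normc_sqr (R : realType) (x : R[i]) : normc x ^+ 2 = Re x ^+ 2 + Im x ^+ 2.
Proof. by rewrite normcE sqr_sqrtr// addr_ge0// sqr_ge0. Qed.

Lemma mulcJ (R : realType) (x : R[i]) : x * conjc x = (normc x ^+ 2)%:C%C.
Proof.
rewrite normc_sqr; case: x => p q; apply/eqP; rewrite eq_complex /=.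
by apply/andP; split; apply/eqP; ring.
Qed.

Lemma conjcD (R : realType) (x y : R[i]) : conjc (x + y) = conjc x + conjc y.
Proof. exact: rmorphD. Qed.

Lemma conjcN (R : realType) (x : R[i]) : conjc (- x) = - conjc x.
Proof. exact: rmorphN. Qed.

Lemma conjcM (R : realType) (x y : R[i]) : conjc (x * y) = conjc x * conjc y.
Proof. exact: rmorphM. Qed.

Lemma normcX (R : realType) (x : R[i]) n : normc (x ^+ n) = normc x ^+ n.
Proof.
elim: n => [|n IH]; first by rewrite !expr0 ComplexField.Normc.normc1.
by rewrite !exprS ComplexField.Normc.normcM IH.
Qed.

Lemma normc_eq0 (R : realType) (x : R[i]) : (normc x == 0) = (x == 0).
Proof.
apply/eqP/eqP => [/ComplexField.Normc.eq0_normc//|->].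
exact: ComplexField.Normc.normc0.
Qed.

Lemma contC_at_cst (R : realType) (c : R[i]) (t : R) : contC_at (fun=> c) t.
Proof. by split; exact: cst_continuous. Qed.

Lemma contC_atD (R : realType) (F G : R -> R[i]) t : contC_at F t ->
  contC_at G t -> contC_at (fun t => F t + G t) t.
Proof.
move=> [F1 F2] [G1 G2]; split.
  rewrite (_ : (fun t => Re (F t + G t)) = (fun t => Re (F t) + Re (G t))).
    exact: continuousD.
  by apply/funext => s; rewrite ReD.
rewrite (_ : (fun t => Im (F t + G t)) = (fun t => Im (F t) + Im (G t))).
  exact: continuousD.
by apply/funext => s; rewrite ImD.
Qed.

Lemma contC_atM (R : realType) (F G : R -> R[i]) t : contC_at F t ->
  contC_at G t -> contC_at (fun t => F t * G t) t.
Proof.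
move=> [F1 F2] [G1 G2]; split.
  rewrite (_ : (fun t => Re (F t * G t)) =
    (fun t => Re (F t) * Re (G t) - Im (F t) * Im (G t))).
    by apply: continuousB; apply: continuousM.
  by apply/funext => s; rewrite ReM.
rewrite (_ : (fun t => Im (F t * G t)) =
  (fun t => Re (F t) * Im (G t) + Im (F t) * Re (G t))).
  by apply: continuousD; apply: continuousM.
by apply/funext => s; rewrite ImM.
Qed.

Lemma contC_atZ (R : realType) (c : R[i]) (F : R -> R[i]) t :
  contC_at F t -> contC_at (fun t => c * F t) t.
Proof. by move=> cF; exact: (contC_atM (contC_at_cst c t) cF). Qed.

Lemma contC_atN (R : realType) (F : R -> R[i]) t :
  contC_at F t -> contC_at (fun t => - F t) t.
Proof.
move=> cF; rewrite (_ : (fun t => - F t) = (fun t => -1 * F t)).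
  exact: contC_atZ.
by apply/funext => s; rewrite mulN1r.
Qed.

Lemma contC_atB (R : realType) (F G : R -> R[i]) t : contC_at F t ->
  contC_at G t -> contC_at (fun t => F t - G t) t.
Proof. by move=> cF /contC_atN; exact: contC_atD. Qed.

Lemma contC_atV (R : realType) (F : R -> R[i]) t :
  contC_at F t -> F t != 0 -> contC_at (fun t => (F t)^-1) t.
Proof.
move=> [F1 F2] F0.
have VE s : (F s)^-1 = Complex (Re (F s) / (Re (F s) ^+ 2 + Im (F s) ^+ 2))
    (- Im (F s) / (Re (F s) ^+ 2 + Im (F s) ^+ 2)).
  by case: (F s) => p q; rewrite mulNr.
have cV : {for t, continuous (fun s => (Re (F s) ^+ 2 + Im (F s) ^+ 2)^-1)}.
  apply: continuousV; first by rewrite -normc_sqr expf_neq0// normc_eq0.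
  by apply: continuousD; apply: continuousM.
split.
  rewrite (_ : (fun s => _) = fun s => Re (F s) * (Re (F s) ^+ 2 + Im (F s) ^+ 2)^-1).
    exact: continuousM.
  by apply/funext => s; rewrite VE.
rewrite (_ : (fun s => _) = fun s => - Im (F s) * (Re (F s) ^+ 2 + Im (F s) ^+ 2)^-1).
  by apply: continuousM; [exact: continuousN|exact: cV].
by apply/funext => s; rewrite VE.
Qed.

Lemma contC_cst (R : realType) (c : R[i]) : contC (fun _ : R => c).
Proof. by move=> t; exact: contC_at_cst. Qed.

Lemma contCD (R : realType) (F G : R -> R[i]) : contC F -> contC G ->
  contC (fun t => F t + G t).
Proof. by move=> cF cG t; exact: contC_atD. Qed.

Lemma contCM (R : realType) (F G : R -> R[i]) : contC F -> contC G ->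
  contC (fun t => F t * G t).
Proof. by move=> cF cG t; exact: contC_atM. Qed.

Lemma contCB (R : realType) (F G : R -> R[i]) : contC F -> contC G ->
  contC (fun t => F t - G t).
Proof. by move=> cF cG t; exact: contC_atB. Qed.

Lemma contCX (R : realType) (F : R -> R[i]) n : contC F -> contC (fun t => F t ^+ n).
Proof.
move=> cF; elim: n => [|n IH]; first exact: contC_cst.
by under eq_fun do rewrite exprS; exact: contCM.
Qed.

Lemma contCV (R : realType) (F : R -> R[i]) : contC F -> (forall t, F t != 0) ->
  contC (fun t => (F t)^-1).
Proof. by move=> cF F0 t; exact: contC_atV. Qed.

Section circle_mean.
Context (R : realType) (T : (R -> R[i]) -> R[i]).
Hypothesis T_lin : forall c F G, contC F -> contC G ->
  T (fun t => c * F t + G t) = c * T F + T G.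
Hypothesis T_bound : forall F, contC F -> exists K : R, forall W,
  contC W -> (forall t, normc (W t) = 1) -> normc (T (fun t => W t * F t)) <= K.

Variable w : R -> R[i].
Hypotheses (cw : contC w) (w1 : forall t, normc (w t) = 1).
Variables (gam : R[i]).
Hypothesis gam1 : normc gam < 1.

Lemma geom_neq0 t : 1 - gam * w t != 0.
Proof.
apply/negP; rewrite subr_eq0 => /eqP /(congr1 (@normc R)).
rewrite ComplexField.Normc.normc1 ComplexField.Normc.normcM w1 mulr1 => g1.
by move: gam1; rewrite -g1 ltxx.
Qed.

Lemma contC_geom F : contC F -> contC (fun t => F t / (1 - gam * w t)).
Proof.
move=> cF; apply: (contCM cF); apply: contCV; last exact: geom_neq0.
exact: (contCB (contC_cst 1) (contCM (contC_cst gam) cw)).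
Qed.

(** A geometric series without exchanging sum and mean. G = F / (1 - gam w) satisfies G = F + gam w
    G, so T (w^(n+1) G) = gam^m T (w^(n+m+1) G) for all m; the last mean is bounded in m since |w| =
    1, and gam^m tends to 0. *)
Lemma mean_geom_pos F : contC F ->
  (forall n, T (fun t => w t ^+ n.+1 * F t) = 0) ->
  forall n, T (fun t => w t ^+ n.+1 * (F t / (1 - gam * w t))) = 0.
Proof.
move=> cF TF; set G := fun t => F t / (1 - gam * w t).
have cG : contC G by exact: contC_geom.
have GE t : G t = F t + gam * (w t * G t).
  by rewrite /G; have := geom_neq0 t; move=> ?; field.
have step n : T (fun t => w t ^+ n.+1 * G t) = gam * T (fun t => w t ^+ n.+2 * G t).
  rewrite -[RHS]addr0 -(TF n) -(T_lin _ (contCM (contCX _ cw) cG) (contCM (contCX _ cw) cF)).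
  by congr T; apply/funext => t; rewrite {1}GE !exprS; ring.
have [K TK] := T_bound cG.
have iter n m : T (fun t => w t ^+ n.+1 * G t) =
    gam ^+ m * T (fun t => w t ^+ (n + m).+1 * G t).
  elim: m => [|m IH]; first by rewrite expr0 mul1r addn0.
  by rewrite IH step mulrA -exprSr addnS.
move=> n; apply/eqP; rewrite -normc_eq0 eq_le normc_ge0 andbT.
have le m : normc (T (fun t => w t ^+ n.+1 * G t)) <= normc gam ^+ m * K.
  rewrite (iter n m) ComplexField.Normc.normcM normcX ler_wpM2l//.
    by rewrite exprn_ge0// normc_ge0.
  by apply: TK => [|t]; [exact: contCX|rewrite normcX w1 expr1n].
have cvg0 : normc gam ^+ m * K @[m --> \oo] --> 0.
  rewrite -(mul0r K); apply: cvgMl; apply: cvg_expr.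
  by rewrite ger0_norm// normc_ge0.
by apply: (@cvgr_to_ge _ _ _ _ _ _ _ cvg0); near=> m; exact: le.
Unshelve. all: by end_near. Qed.

Lemma mean_geom F : contC F ->
  (forall n, T (fun t => w t ^+ n.+1 * F t) = 0) ->
  T (fun t => F t / (1 - gam * w t)) = T F.
Proof.
move=> cF TF; have cG := contC_geom cF; have TG := mean_geom_pos cF TF 0.
transitivity (T (fun t => gam * (w t ^+ 1 * (F t / (1 - gam * w t))) + F t)).
  congr T; apply/funext => t; rewrite expr1.
  by have := geom_neq0 t; move=> ?; field.
rewrite (T_lin _ (contCM (contCX 1 cw) cG) cF).
by rewrite TG mulr0 add0r.
Qed.

End circle_mean.

Definition unit_circle (R : realType) (t : R) : R[i] := Complex (cos t) (sin t).

Lemma unit_circleJ (R : realType) (t : R) :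
  unit_circle t * conjc (unit_circle t) = 1.
Proof.
rewrite /unit_circle; apply/eqP; rewrite eq_complex /=; apply/andP; split; apply/eqP.
  by rewrite mulrN opprK -!expr2 cos2Dsin2.
by rewrite mulrN mulrC addrC subrr.
Qed.

Lemma normc_unit_circle (R : realType) (t : R) : normc (unit_circle t) = 1.
Proof. by rewrite normcE /= cos2Dsin2 sqrtr1. Qed.

Lemma normcJ (R : realType) (x : R[i]) : normc (conjc x) = normc x.
Proof. by case: x => p q; rewrite !normcE /= sqrrN. Qed.

Lemma contC_unit_circle (R : realType) : contC (@unit_circle R).
Proof. by move=> t; split; [exact: continuous_cos|exact: continuous_sin]. Qed.

Lemma contC_conj (R : realType) (F : R -> R[i]) :
  contC F -> contC (fun t => conjc (F t)).
Proof.
move=> cF t; have [F1 F2] := cF t; split.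
  by rewrite (_ : (fun t => _) = (fun t => Re (F t)))//; apply/funext => s; case: (F s).
rewrite (_ : (fun t => _) = (fun t => - Im (F t))); first exact: continuousN.
by apply/funext => s; case: (F s).
Qed.

(* The mean over the unit circle is used through these properties only, because *)
(* horizontal and vertical slices produce it as two different integrals. *)
Record circle_mean (R : realType) (T : (R -> R[i]) -> R[i]) : Prop := CircleMean {
  mean_lin : forall c F G, contC F -> contC G ->
    T (fun t => c * F t + G t) = c * T F + T G;
  mean_bound : forall F, contC F -> exists K : R, forall W,
    contC W -> (forall t, normc (W t) = 1) ->
    normc (T (fun t => W t * F t)) <= K;
  mean_pos : forall n, T (fun t => unit_circle t ^+ n.+1) = 0;
  mean_neg : forall n, T (fun t => conjc (unit_circle t) ^+ n.+1) = 0;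
  mean1 : T (fun=> 1) = 1 }.

Section mean_of_rational_functions.
Context (R : realType) (T : (R -> R[i]) -> R[i]) (mT : circle_mean T).
Local Notation u := (@unit_circle R).
Local Notation v := (fun t : R => conjc (unit_circle t)).

Let cu : contC u. Proof. exact: contC_unit_circle. Qed.

Let cv : contC v. Proof. exact: contC_conj. Qed.
Let u1 t : normc (u t) = 1. Proof. exact: normc_unit_circle. Qed.

Let v1 t : normc (v t) = 1. Proof. by rewrite normcJ. Qed.
Let uv t : u t * v t = 1. Proof. exact: unit_circleJ. Qed.

Lemma mean0 : T (fun=> 0) = 0.
Proof.
have := mean_lin mT 1 (@contC_cst R 0) (@contC_cst R 0).
by under eq_fun do rewrite mulr0 addr0; rewrite mul1r => /eqP; rewrite -subr_eq0 opprD addrA subrr sub0r oppr_eq0 => /eqP.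
Qed.

Lemma meanZ c F : contC F -> T (fun t => c * F t) = c * T F.
Proof.
move=> cF; rewrite -[RHS]addr0 -mean0 -(mean_lin mT c cF (contC_cst 0)).
by congr T; apply/funext => t; rewrite addr0.
Qed.

Lemma meanD F G : contC F -> contC G -> T (fun t => F t + G t) = T F + T G.
Proof.
move=> cF cG; rewrite -[T F]mul1r -(mean_lin mT)//.
by congr T; apply/funext => t; rewrite mul1r.
Qed.

Lemma mean_cst c : T (fun=> c) = c.
Proof.
rewrite -[RHS]mulr1 -(mean1 mT) -meanZ; last exact: contC_cst.
by under [in RHS]eq_fun do rewrite mulr1.
Qed.

Section one_pole.
Variables (w w' : R -> R[i]) (b : R[i]).
Hypotheses (cw : contC w) (cw' : contC w') (w1 : forall t, normc (w t) = 1).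
Hypothesis ww' : forall t, w t * w' t = 1.
Hypothesis Tw : forall n, T (fun t => w t ^+ n.+1) = 0.
Hypothesis Tw' : forall n, T (fun t => w' t ^+ n.+1) = 0.
Hypothesis b1 : normc b < 1.

Let cE : contC (fun t => 1 / (1 - b * w t)).
Proof. by apply: (contC_geom cw w1 b1); exact: contC_cst. Qed.

(** The mean picks the coefficient of w^n in the geometric series of 1 / (1 - b w), as w' = 1 / w.
    The induction uses 1 / (1 - b w) = 1 + b w / (1 - b w). *)
Lemma mean_pole n : T (fun t => w' t ^+ n * (1 / (1 - b * w t))) = b ^+ n.
Proof.
elim: n => [|n IH].
  rewrite expr0; under eq_fun do rewrite mul1r.
  rewrite (mean_geom (mean_lin mT) (mean_bound mT) cw w1 b1); first exact: mean1.
    exact: contC_cst.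
  by move=> n; under eq_fun do rewrite mulr1; exact: Tw.
transitivity (T (fun t => b * (w' t ^+ n * (1 / (1 - b * w t))) + w' t ^+ n.+1)).
  congr T; apply/funext => t; have n0 := geom_neq0 w1 b1 t.
  rewrite exprS; transitivity (w' t * w' t ^+ n * (1 - b * w t + b * w t) / (1 - b * w t)).
    by rewrite subrK mulrA.
  by rewrite mulrDr mulrDl mulfK// addrC; congr (_ + _);
    rewrite -[X in X = _]mulr1 -[RHS]mulr1 -(ww' t); ring.
have cX m : contC (fun t => w' t ^+ m) by exact: contCX.
by rewrite (mean_lin mT b (contCM (cX n) cE) (cX n.+1)) IH Tw' addr0 exprS.
Qed.

Lemma mean_pole_pos n : T (fun t => w t ^+ n.+1 * (1 / (1 - b * w t))) = 0.
Proof.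
rewrite (mean_geom_pos (mean_lin mT) (mean_bound mT) cw w1 b1); [by []|exact: contC_cst|].
by move=> m; under eq_fun do rewrite mulr1; exact: Tw.
Qed.

End one_pole.

End mean_of_rational_functions.

Lemma subr_neq0_of_div (F : fieldType) (x y : F) : y != 0 -> 1 - x / y != 0 -> y - x != 0.
Proof.
move=> y0; apply: contra_neq => /eqP; rewrite subr_eq0 => /eqP <-.
by rewrite divff// subrr.
Qed.

(** * Means of conj w / w over the boundary of the ellipse *)

Section boundary_means.
Context (R : realType) (T : (R -> R[i]) -> R[i]) (mT : circle_mean T).
Local Notation u := (@unit_circle R).
Local Notation v := (fun t : R => conjc (unit_circle t)).

Let cu : contC u. Proof. exact: contC_unit_circle. Qed.

Let cv : contC v. Proof. exact: contC_conj. Qed.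
Let v1 t : normc (v t) = 1. Proof. by rewrite normcJ normc_unit_circle. Qed.

Let uv t : u t * v t = 1. Proof. exact: unit_circleJ. Qed.

Let quad (a0 a1 a2 : R[i]) t := a2 * v t ^+ 2 + (a1 * v t ^+ 1 + a0).

Let cquad a0 a1 a2 : contC (quad a0 a1 a2).
Proof.
apply: contCD; first by apply: contCM; [exact: contC_cst|exact: contCX].
apply: contCD; last exact: contC_cst.
by apply: contCM; [exact: contC_cst|exact: contCX].
Qed.

Let mean_quad a0 a1 a2 : T (quad a0 a1 a2) = a0.
Proof.
rewrite (mean_lin mT) ?(mean_neg mT) ?mulr0 ?add0r; [|exact: contCX|].
  rewrite (mean_lin mT) ?(mean_neg mT) ?mulr0 ?add0r ?(mean_cst mT)//.
  exact: contC_cst.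
by apply: contCD; [apply: contCM; [exact: contC_cst|exact: contCX]|exact: contC_cst].
Qed.

Let mean_quad_pos a0 a1 a2 n : T (fun t => v t ^+ n.+1 * quad a0 a1 a2 t) = 0.
Proof.
transitivity (T (fun t => a2 * v t ^+ n.+3 + (a1 * v t ^+ n.+2 + a0 * v t ^+ n.+1))).
  by congr T; apply/funext => t; rewrite /quad !exprS; ring.
have cX c m : contC (fun t => c * v t ^+ m).
  by apply: contCM; [exact: contC_cst|exact: contCX].
rewrite (mean_lin mT) ?(mean_neg mT) ?mulr0 ?add0r; [|exact: contCX|exact: contCD].
rewrite (mean_lin mT) ?(mean_neg mT) ?mulr0 ?add0r; [|exact: contCX|exact: cX].
by rewrite (meanZ mT) ?(mean_neg mT) ?mulr0//; exact: contCX.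
Qed.

(** The function is a power series in [v] = 1 / u with constant coefficient a0, and positive powers
    of [v] have mean 0. *)
Lemma mean_two_poles a0 a1 a2 g1 g2 : normc g1 < 1 -> normc g2 < 1 ->
  T (fun t => quad a0 a1 a2 t / (1 - g1 * v t) / (1 - g2 * v t)) = a0.
Proof.
move=> n1 n2.
rewrite (mean_geom (mean_lin mT) (mean_bound mT) cv v1 n2).
- rewrite (mean_geom (mean_lin mT) (mean_bound mT) cv v1 n1) ?mean_quad//.
- exact: (contC_geom cv v1 n1).
- by apply: (mean_geom_pos (mean_lin mT) (mean_bound mT) cv v1 n1) => //; exact: mean_quad_pos.
Qed.

Lemma mean_two_poles_pos a0 a1 a2 g1 g2 : normc g1 < 1 -> normc g2 < 1 ->
  T (fun t => v t * (quad a0 a1 a2 t / (1 - g1 * v t) / (1 - g2 * v t))) = 0.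
Proof.
move=> n1 n2.
have := @mean_geom_pos _ _ (mean_lin mT) (mean_bound mT) _ cv v1 _ n2
  (fun t => quad a0 a1 a2 t / (1 - g1 * v t)).
move=> /(_ (contC_geom cv v1 n1 (cquad _ _ _))) /(_ _ 0); apply.
by apply: (mean_geom_pos (mean_lin mT) (mean_bound mT) cv v1 n1) => //; exact: mean_quad_pos.
Qed.

Variables (p : R) (u1 u2 k : R[i]).
Hypotheses (p0 : p != 0) (prodR : conjc (u1 * u2) = u1 * u2).

Let lam := u1 * u2.
(** This is z - xi for z = p (u1 + u2) and xi = p (u + lam / u) on the boundary. [wwE] factors it;
    [prodR] says that lam is real, so [wwJ] factors its conjugate with the conjugate roots. *)
Let ww (t : R) : R[i] := p%:C%C * (u1 + u2 - u t - lam * v t).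
Let g (t : R) := if ww t == 0 then k else conjc (ww t) / ww t.

Let pC0 : p%:C%C != 0 :> R[i].
Proof. by apply: contra_neq p0 => -[]. Qed.

Let lamE : conjc u1 * conjc u2 = lam.
Proof. by rewrite /lam -[RHS]prodR rmorphM. Qed.

Let wwE t : ww t = - (p%:C%C * u t * (1 - u1 * v t) * (1 - u2 * v t)).
Proof.
rewrite /ww /lam; transitivity (p%:C%C * (u1 * (u t * v t) + u2 * (u t * v t)
  - u t - u1 * u2 * (u t * v t) * v t)); last by ring.
by rewrite uv !mulr1.
Qed.

Let wwJ t : conjc (ww t) =
  - (p%:C%C * u t * (v t - conjc u1) * (v t - conjc u2)).
Proof.
rewrite wwE; have := uv t; cbv beta; move: (u t) => x xv.
rewrite !(conjcN, conjcM, conjcD, conjc1, conjcK, conjc_real).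
transitivity (- (p%:C%C * conjc x * (x * conjc x - conjc u1 * x) * (x * conjc x - conjc u2 * x))).
  by rewrite xv.
transitivity (- (p%:C%C * (x * conjc x) * x * (conjc x - conjc u1) * (conjc x - conjc u2))).
  by ring.
by rewrite xv mulr1.
Qed.

Let u0 t : u t != 0.
Proof. by rewrite -normc_eq0 normc_unit_circle oner_eq0. Qed.

(** Here g is (v - conj u1) (v - conj u2) / ((1 - u1 v) (1 - u2 v)), a power series in [v]. It has
    no term in u, and its coefficient of [v] is the mean of u g. *)
Lemma boundary_means_inside : normc u1 < 1 -> normc u2 < 1 ->
  [/\ contC g, T (fun t => v t * g t) = 0
    & T (fun t => u t * g t) = lam * (u1 + u2) - conjc (u1 + u2)].
Proof.
move=> n1 n2.
have gE t : g t = quad lam (- (conjc u1 + conjc u2)) 1 t / (1 - u1 * v t) / (1 - u2 * v t).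
  have m1 := geom_neq0 v1 n1 t; have m2 := geom_neq0 v1 n2 t; have m3 := u0 t.
  have w0 : ww t != 0 by rewrite wwE oppr_eq0 !mulf_neq0.
  rewrite /g (negbTE w0) wwJ wwE /quad -lamE expr1.
  by field; rewrite m1 m2 m3 pC0.
have -> : g = (fun t => quad lam (- (conjc u1 + conjc u2)) 1 t / (1 - u1 * v t) / (1 - u2 * v t)).
  exact/funext.
split.
- by apply: (contC_geom cv v1 n2); exact: (contC_geom cv v1 n1).
- exact: mean_two_poles_pos.
(* g' = u g - lam u: removing the term in u, which has mean 0, leaves a power series in [v] with the
   wanted constant coefficient. *)
pose g' t := quad (lam * (u1 + u2) - conjc (u1 + u2)) (1 - lam ^+ 2) 0 t / (1 - u1 * v t) / (1 - u2 * v t).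
transitivity (T (fun t => lam * u t ^+ 1 + g' t)).
  congr T; apply/funext => t.
  have m1 := geom_neq0 v1 n1 t; have m2 := geom_neq0 v1 n2 t.
  have vE : v t = (u t)^-1 by apply: (mulfI (u0 t)); rewrite uv divff.
  rewrite /g' /quad conjcD expr1 /lam; move: m1 m2; cbv beta; rewrite !vE => m1 m2.
  have m3 := u0 t; have nV x := @subr_neq0_of_div _ x _ m3.
  by field; rewrite m3 ?(nV u1) ?(nV u2).
rewrite (mean_lin mT) ?(mean_pos mT) ?mulr0 ?add0r; [exact: mean_two_poles|exact: contCX|].
by apply: (contC_geom cv v1 n2); exact: (contC_geom cv v1 n1).
Qed.

(** When |u1| = 1, v - conj u1 = - conj u1 (1 - u1 v), so the pole on the circle cancels. The chosen
    k is the value of the reduced quotient at v = conj u1, where [ww] vanishes. The factors 1 - 0 v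
    stand for the cancelled pole, so that [mean_two_poles] still applies. *)
Lemma boundary_means_on : normc u1 = 1 -> normc u2 < 1 ->
  k = - conjc u1 * (conjc u1 - conjc u2) / (1 - u2 * conjc u1) ->
  [/\ contC g, T (fun t => v t * g t) = 0
    & T (fun t => u t * g t) = lam * (u1 + u2) - conjc (u1 + u2)].
Proof.
move=> n1 n2 kE; have z1 : normc (0 : R[i]) < 1 by rewrite ComplexField.Normc.normc0.
have u1J : u1 * conjc u1 = 1 by rewrite mulcJ n1 expr1n.
have gE t : g t = quad lam (- conjc u1) 0 t / (1 - 0 * v t) / (1 - u2 * v t).
  have m2 := geom_neq0 v1 n2 t; have m3 := u0 t.
  have qE : quad lam (- conjc u1) 0 t = - conjc u1 * (v t - conjc u2).
    by rewrite /quad -lamE; ring.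
  rewrite qE mul0r subr0 divr1 /g; case: ifPn => w0.
    have vE : v t = conjc u1.
      move: w0; rewrite wwE oppr_eq0 !mulf_eq0 (negbTE pC0) (negbTE m3) (negbTE m2) /= orbF.
      rewrite subr_eq0 => /eqP m1; apply: (mulfI (x := u1)); last by rewrite u1J -m1.
      by rewrite -normc_eq0 n1 oner_eq0.
    by rewrite kE -vE.
  have vE : v t - conjc u1 = - conjc u1 * (1 - u1 * v t).
    by rewrite mulrBr mulr1 mulrA mulNr [_ * u1]mulrC u1J; ring.
  have m1 : 1 - u1 * v t != 0.
    by apply: contra_neq w0 => m1; rewrite wwE m1 mulr0 mul0r oppr0.
  by rewrite wwJ wwE vE; field; rewrite m1 m2 m3 pC0.
have -> : g = (fun t => quad lam (- conjc u1) 0 t / (1 - 0 * v t) / (1 - u2 * v t)).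
  exact/funext.
split.
- by apply: (contC_geom cv v1 n2); exact: (contC_geom cv v1 z1).
- exact: mean_two_poles_pos.
pose g' t := quad (lam * u2 - conjc u1) 0 0 t / (1 - 0 * v t) / (1 - u2 * v t).
transitivity (T (fun t => lam * u t ^+ 1 + g' t)).
  congr T; apply/funext => t.
  have m2 := geom_neq0 v1 n2 t.
  have vE : v t = (u t)^-1 by apply: (mulfI (u0 t)); rewrite uv divff.
  rewrite /g' /quad expr1; move: m2; cbv beta; rewrite !vE => m2.
  have m3 := u0 t; have nV x := @subr_neq0_of_div _ x _ m3.
  by field; rewrite m3 ?(nV u1) ?(nV u2).
have cg' : contC g' by apply: (contC_geom cv v1 n2); exact: (contC_geom cv v1 z1).
rewrite (mean_lin mT lam (contCX 1 cu) cg') (mean_pos mT) mulr0 add0r (mean_two_poles _ _ _ z1 n2).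
rewrite conjcD mulrDr -[lam * u1](_ : conjc u2 = _); first by ring.
by rewrite -lamE mulrAC [_ * u1]mulrC u1J mul1r.
Qed.

(** Now 1 - u1 v = - u1 v (1 - u / u1), and 1 / (1 - u / u1) is expanded in powers of u. Thus g is a
    constant times a Laurent polynomial in u times the function [h], whose Laurent coefficients are
    explicit ([hu], [hv]). *)
Lemma boundary_means_outside : 1 < normc u1 -> normc u2 < 1 ->
  let V := conjc u1 in
  [/\ contC g,
      T (fun t => u t * g t) = V / u1 / (1 - u2 / u1) *
        ((1 + conjc u2 / V) * u2 - V^-1 - conjc u2 * u2 ^+ 2)
    & T (fun t => v t * g t) = V / u1 / (1 - u2 / u1) *
        ((1 + conjc u2 / V) / u1 - V^-1 / u1 ^+ 2 - conjc u2)].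
Proof.
move=> n1 n2 V.
have u10 : u1 != 0 by rewrite -normc_eq0 gt_eqF// (lt_trans ltr01).
have V0 : V != 0 by rewrite -normc_eq0 normcJ normc_eq0.
have nb : normc u1^-1 < 1 by rewrite ComplexField.Normc.normcV invf_lt1// (lt_trans ltr01).
have xx : 1 - u2 / u1 != 0.
  rewrite subr_eq0; apply/eqP => /(congr1 (@normc R)).
  rewrite ComplexField.Normc.normc1 ComplexField.Normc.normcM => /eqP; rewrite gt_eqF//.
  apply: (@le_lt_trans _ _ (normc u2)) => //.
  by rewrite ler_piMr ?normc_ge0// ltW.
pose E t := 1 / (1 - u1^-1 * u t); pose F t := 1 / (1 - u2 * v t).
have cE : contC E by apply: (contC_geom cu (@normc_unit_circle R) nb); exact: contC_cst.
have cF : contC F by apply: (contC_geom cv v1 n2); exact: contC_cst.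
(* Since u v = 1, h = (1 - u2 / u1) / ((1 - u / u1) (1 - u2 v)); the sum form makes its Laurent
   series the union of two geometric series. *)
pose h t := E t + F t - 1.
have ch : contC h by apply: contCB; [exact: contCD|exact: contC_cst].
have vu t : v t * u t = 1 by rewrite mulrC.
have E0 n := mean_pole mT cu cv (@normc_unit_circle R) uv (mean_pos mT) (mean_neg mT) nb n.
have Ep n := mean_pole_pos mT cu (@normc_unit_circle R) (mean_pos mT) nb n.
have F0 n := mean_pole mT cv cu v1 vu (mean_neg mT) (mean_pos mT) n2 n.
have Fp n := mean_pole_pos mT cv v1 (mean_neg mT) n2 n.
have hE w n : contC w -> T (fun t => w t ^+ n * h t) =
    T (fun t => w t ^+ n * E t) + T (fun t => w t ^+ n * F t) - T (fun t => w t ^+ n).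
  move=> cw.
  have cwE : contC (fun t => w t ^+ n * E t) by apply: contCM; [exact: contCX|exact: cE].
  have cwF : contC (fun t => w t ^+ n * F t) by apply: contCM; [exact: contCX|exact: cF].
  rewrite -(meanD mT)// addrC -mulN1r -(mean_lin mT); [|exact: contCX|exact: contCD].
  by congr T; apply/funext => t; rewrite /h; ring.
have hu n : T (fun t => u t ^+ n * h t) = u2 ^+ n.
  rewrite hE//; case: n => [|n]; last by rewrite Ep F0 (mean_pos mT) add0r subr0.
  rewrite F0 (_ : (fun t => u t ^+ 0 * E t) = (fun t => v t ^+ 0 * E t)).
    by rewrite E0 !expr0 (mean1 mT) addrK.
  by apply/funext => t; rewrite !expr0.
have hv n : T (fun t => v t ^+ n * h t) = u1^-1 ^+ n.
  rewrite hE//; case: n => [|n]; last by rewrite E0 Fp (mean_neg mT) addr0 subr0.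
  rewrite E0 (_ : (fun t => v t ^+ 0 * F t) = (fun t => u t ^+ 0 * F t)).
    by rewrite F0 !expr0 (mean1 mT) addrK.
  by apply/funext => t; rewrite !expr0.
pose c := V / u1 / (1 - u2 / u1).
have gE t : g t = c * ((1 + conjc u2 / V - V^-1 * v t - conjc u2 * u t) * h t).
  have m1 := geom_neq0 (@normc_unit_circle R) nb t; have m2 := geom_neq0 v1 n2 t.
  have m3 := u0 t.
  have vE : v t = (u t)^-1 by apply: (mulfI (u0 t)); rewrite uv divff.
  have m1' : u1 - u t != 0.
    apply: contra_neq m1 => /eqP; rewrite subr_eq0 => /eqP <-.
    by rewrite mulVf// subrr.
  have m1v : 1 - u1 * v t != 0.
    apply: contra_neq m1' => /eqP; rewrite subr_eq0 => /eqP h1.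
    by rewrite -[u t]mul1r h1 -mulrA vu mulr1 subrr.
  have w0 : ww t != 0 by rewrite wwE oppr_eq0 !mulf_neq0.
  rewrite /g (negbTE w0) wwJ wwE /c /h /E /F.
  move: m2 m1v; cbv beta; rewrite !vE => m2 m1v.
  have nV x := @subr_neq0_of_div _ x _ m3.
  have xx' := subr_neq0_of_div u10 xx.
  by field; rewrite m1' m3 u10 V0 xx' pC0 (nV u1) ?(nV u2).
have cg : contC (fun t => c * ((1 + conjc u2 / V - V^-1 * v t - conjc u2 * u t) * h t)).
  apply: contCM; first exact: contC_cst.
  apply: contCM; last exact: ch.
  apply: contCB; last exact: (contCM (contC_cst _) cu).
  exact: (contCB (contC_cst _) (contCM (contC_cst _) cv)).
have gE' := funext gE; rewrite gE'.
have lin3 (w : nat -> R -> R[i]) A B D : (forall n, contC (w n)) ->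
    T (fun t => A * (w 0 t * h t) + (B * (w 1 t * h t) + D * (w 2 t * h t))) =
    A * T (fun t => w 0 t * h t) + (B * T (fun t => w 1 t * h t) + D * T (fun t => w 2 t * h t)).
  move=> cw; have cwh n : contC (fun t => w n t * h t) by exact: contCM.
  have cwZ n x : contC (fun t => x * (w n t * h t)).
    exact: (contCM (contC_cst _) (cwh n)).
  rewrite (mean_lin mT _ (cwh 0) (contCD (contCM (contC_cst B) (cwh 1)) (cwZ 2 D))).
  by rewrite (mean_lin mT _ (cwh 1) (cwZ 2 D)) (meanZ mT _ (cwh 2)).
split=> //.
- transitivity (T (fun t => (- c / V) * (u t ^+ 0 * h t) + (c * (1 + conjc u2 / V) * (u t ^+ 1 * h t)
     + (- c * conjc u2) * (u t ^+ 2 * h t)))).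
    congr T; apply/funext => t.
    have vE : v t = (u t)^-1 by apply: (mulfI (u0 t)); rewrite uv divff.
    by cbv beta; rewrite vE; have m3 := u0 t; field; rewrite m3 V0.
  rewrite (lin3 (fun n t => u t ^+ n)); last by move=> n; exact: contCX.
  by rewrite !hu /c; ring.
- transitivity (T (fun t => (- c * conjc u2) * (v t ^+ 0 * h t) + (c * (1 + conjc u2 / V) * (v t ^+ 1 * h t)
     + (- c / V) * (v t ^+ 2 * h t)))).
    congr T; apply/funext => t.
    have vE : v t = (u t)^-1 by apply: (mulfI (u0 t)); rewrite uv divff.
    by cbv beta; rewrite vE; have m3 := u0 t; field; rewrite m3 V0.
  rewrite (lin3 (fun n t => v t ^+ n)); last by move=> n; exact: contCX.
  by rewrite !hv /c expr0 expr1 exprVn; ring.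
Qed.

End boundary_means.

(* A horizontal slice meets the ellipse at the parameters t and pi - t. *)
Definition half_turn_mean (R : realType) (f : R -> R) : R :=
  (2 * pi)^-1 * \int[mu]_(t in `[- (pi / 2), pi / 2]) (f t + f (pi - t)).

Definition half_turn_meanC (R : realType) (F : R -> R[i]) : R[i] :=
  Complex (half_turn_mean (fun t => Re (F t))) (half_turn_mean (fun t => Im (F t))).

(** * The slice integrals as means over the circle *)

Section half_turn_mean.
Context (R : realType).
Local Notation M := (@half_turn_mean R).

Lemma continuous_reflection (f : R -> R) (c : R) : continuous f ->
  continuous (fun t => f (c - t)).
Proof.
move=> cf t; apply: (@continuous_comp _ _ _ (fun t => c - t) f); last exact: cf.
by apply: continuousB; [exact: cst_continuous|].
Qed.

Let integrable_sym (f : R -> R) : continuous f ->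
  mu.-integrable `[- (pi / 2), pi / 2] (EFin \o (fun t => f t + f (pi - t))).
Proof.
move=> cf; apply: continuous_compact_integrable; first exact: segment_compact.
apply: continuous_subspaceT => t; apply: continuousD; first exact: cf.
exact: continuous_reflection.
Qed.

Lemma half_turn_mean_lin a (f g : R -> R) : continuous f -> continuous g ->
  M (fun t => a * f t + g t) = a * M f + M g.
Proof.
move=> cf cg; rewrite /half_turn_mean [a * (_ * _)]mulrCA -mulrDr; congr (_ * _).
have caf : continuous (fun t => a * f t).
  by move=> t; apply: continuousM; [exact: cst_continuous|exact: cf].
rewrite -RintegralZl//; last exact: integrable_sym.
transitivity (\int[mu]_(t in `[- (pi / 2), pi / 2])
    ((a * f t + a * f (pi - t)) + (g t + g (pi - t)))).
  by apply: eq_Rintegral => t _; rewrite addrACA.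
rewrite (RintegralD _ (integrable_sym caf) (integrable_sym cg))//.
by congr (_ + _); apply: eq_Rintegral => t _; rewrite mulrDr.
Qed.

Lemma half_turn_meanN (f : R -> R) : continuous f ->
  M (fun t => - f t) = - M f.
Proof.
move=> cf; rewrite /half_turn_mean -[RHS]mulrN; congr (_ * _).
rewrite -[RHS]mulN1r -RintegralZl//; last exact: integrable_sym.
by apply: eq_Rintegral => t _; rewrite mulN1r opprD.
Qed.

Lemma half_turn_mean_le (f g : R -> R) : continuous f -> continuous g ->
  (forall t, `|f t| <= g t) -> `|M f| <= M g.
Proof.
move=> cf cg fg; have pi0 : 0 < (2 * pi)^-1 :> R by rewrite invr_gt0 mulr_gt0// pi_gt0.
rewrite normrM gtr0_norm// ler_pM2l//.
apply: (le_trans (le_normr_Rintegral _ _)) => //; first exact: integrable_sym.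
apply: le_Rintegral => //.
- have := @integrable_abse _ _ _ mu _ _ (integrable_sym cf).
  by apply: eq_integrable.
- exact: integrable_sym.
- by move=> t _; rewrite (le_trans (ler_normD _ _))// lerD.
Qed.

Lemma half_turn_mean_cst c : M (fun=> c) = c.
Proof.
rewrite /half_turn_mean Rintegral_cst//= lebesgue_measure_itv/= lte_fin ifT; last first.
  by rewrite -subr_gt0 opprK addr_gt0// divr_gt0// pi_gt0.
have pi0 : pi != 0 :> R by rewrite gt_eqF// pi_gt0.
have gen (x : R) : x != 0 -> (2 * x)^-1 * ((c + c) * (x / 2 + - - (x / 2))) = c.
  by move=> x0; field.
by rewrite -EFinD [fine _]/=; exact: gen.
Qed.

(** The parameters t and pi - t together sweep the period from -pi / 2 to 3 pi / 2. Indeed f t + f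
    (pi - t) has primitive F t - F (pi - t), which vanishes at both ends. *)
Lemma half_turn_mean_derivative (F f : R -> R) :
  (forall t, is_derive t (1 : R) F (f t)) -> continuous f ->
  F (- (pi / 2)) = F (pi + pi / 2) -> M f = 0.
Proof.
move=> dF cf per; have h : - (pi / 2) <= pi / 2 :> R.
  by rewrite -subr_ge0 opprK addr_ge0// divr_ge0// pi_ge0.
rewrite /half_turn_mean /Rintegral.
have -> : (\int[mu]_(t in `[(- (pi / 2))%R, (pi / 2)%R]) (f t + f (pi - t))%:E =
   ((F (pi / 2) - F (pi - pi / 2)) - (F (- (pi / 2)) - F (pi - - (pi / 2))))%:E)%E.
  apply: (@FTC_segment _ (fun t => F t - F (pi - t))) => // t _.
  - have d1 (c : R) : is_derive t (1 : R) (fun s : R => c - s) (-1 : R).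
      by apply: is_derive_eq; rewrite add0r mul1r.
    have d2 := @is_derive1_comp R F (fun s => pi - s) t _ _ (dF _) (d1 pi).
    by apply: (is_derive_eq (is_deriveB (dF t) d2)); rewrite mulrN1 opprK.
  - by apply: continuousD; [exact: cf|exact: continuous_reflection].
have half (x : R) : x - x / 2 = x / 2 by field.
rewrite opprK per half.
by rewrite !subrr mulr0.
Qed.

Lemma unit_circleX n (t : R) :
  unit_circle t ^+ n = unit_circle (n%:R * t).
Proof.
elim: n => [|n IH]; first by rewrite expr0 mul0r /unit_circle cos0 sin0.
rewrite exprS IH -[n.+1%:R]natr1 mulrDl mul1r addrC /unit_circle cosD sinD.
by apply/eqP; rewrite eq_complex /= [sin t * _ + _]addrC !eqxx.
Qed.

Lemma unit_circle_per n :
  unit_circle (n%:R * - (pi / 2)) = unit_circle (n%:R * (pi + pi / 2)) :> R[i].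
Proof.
rewrite -!unit_circleX; congr (_ ^+ _).
by rewrite /unit_circle cosN sinN cosD sinD cospi sinpi cos_pihalf sin_pihalf;
  congr Complex; ring.
Qed.

Let TF := @half_turn_meanC R.

Lemma half_turn_meanC_pos n : TF (fun t => unit_circle t ^+ n.+1) = 0.
Proof.
rewrite /TF /half_turn_meanC; have n0 : n.+1%:R != 0 :> R by rewrite pnatr_eq0.
have dN (t : R) : is_derive t (1 : R) (fun s : R => n.+1%:R * s) (n.+1%:R : R).
  by apply: is_derive_eq; exact: mulr1.
have cN (t : R) : {for t, continuous (fun s : R => n.+1%:R * s)}.
  by apply: continuousM; [exact: cst_continuous|].
have /eqP := unit_circle_per n.+1; rewrite eq_complex /= => /andP[/eqP cper /eqP sper].
congr Complex.
- apply: (@half_turn_mean_derivative (fun t => n.+1%:R^-1 * sin (n.+1%:R * t))).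
  + move=> t; have d2 := @is_derive1_comp R sin _ t _ _ (is_derive_sin _) (dN t).
    apply: (is_derive_eq (is_deriveZ n.+1%:R^-1 d2)).
    by rewrite unit_circleX /GRing.scale/= mulrCA mulVf// mulr1.
  + move=> t; under eq_fun do rewrite unit_circleX.
    by apply: (@continuous_comp _ _ _ (fun s : R => n.+1%:R * s) cos); [exact: cN|exact: continuous_cos].
  + by rewrite sper.
- apply: (@half_turn_mean_derivative (fun t => - n.+1%:R^-1 * cos (n.+1%:R * t))).
  + move=> t; have d2 := @is_derive1_comp R cos _ t _ _ (is_derive_cos _) (dN t).
    apply: (is_derive_eq (is_deriveZ (- n.+1%:R^-1) d2)).
    by rewrite unit_circleX /GRing.scale/= mulNr mulNr mulrN opprK mulrCA mulVf// mulr1.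
  + move=> t; under eq_fun do rewrite unit_circleX.
    by apply: (@continuous_comp _ _ _ (fun s : R => n.+1%:R * s) sin); [exact: cN|exact: continuous_sin].
  + by rewrite cper.
Qed.

Lemma half_turn_meanCJ F : contC F -> TF (fun t => conjc (F t)) = conjc (TF F).
Proof.
move=> cF; rewrite /TF /half_turn_meanC /=; congr Complex.
  by congr half_turn_mean; apply/funext => t; case: (F t).
rewrite -half_turn_meanN; last by move=> t; case: (cF t).
by congr half_turn_mean; apply/funext => t; case: (F t).
Qed.

Lemma le_normc_ReIm (x : R[i]) : normc x <= `|Re x| + `|Im x|.
Proof.
rewrite -(@ler_pXn2r _ 2)// ?nnegrE ?normc_ge0 ?addr_ge0// normc_sqr sqrrD.
by rewrite !real_normK ?num_real// addrAC lerDl mulrn_wge0// mulr_ge0.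
Qed.

Lemma normRe_le_normc (x : R[i]) : `|Re x| <= normc x.
Proof. by rewrite normcE -sqrtr_sqr ler_wsqrtr// lerDl sqr_ge0. Qed.

Lemma normIm_le_normc (x : R[i]) : `|Im x| <= normc x.
Proof. by rewrite normcE -sqrtr_sqr ler_wsqrtr// lerDr sqr_ge0. Qed.

Lemma circle_mean_half_turn : circle_mean TF.
Proof.
split.
- move=> c F G cF cG; rewrite /TF /half_turn_meanC.
  have F1 : continuous (fun t => Re (F t)) by move=> t; case: (cF t).
  have F2 : continuous (fun t => Im (F t)) by move=> t; case: (cF t).
  have G1 : continuous (fun t => Re (G t)) by move=> t; case: (cG t).
  have G2 : continuous (fun t => Im (G t)) by move=> t; case: (cG t).
  have lin (a : R) (f g : R -> R) : continuous f -> continuous g ->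
    continuous (fun t : R => a * f t + g t :> R).
    move=> cf cg t; suff : {for t, continuous (fun s : R => a * f s + g s)} by [].
    apply: continuousD; last exact: cg.
    by apply: continuousM; [exact: cst_continuous|exact: cf].
  apply/eqP; rewrite eq_complex ReD ImD ReM ImM /=; apply/andP; split; apply/eqP.
    rewrite -mulNr -addrA -!half_turn_mean_lin//; last exact: lin.
    by congr half_turn_mean; apply/funext => t; rewrite ReD ReM mulNr addrA.
  rewrite -addrA -!half_turn_mean_lin//; last exact: lin.
  by congr half_turn_mean; apply/funext => t; rewrite ImD ImM addrA.
- move=> F cF; pose N t := `|Re (F t)| + `|Im (F t)|.
  have cN : continuous N.
    move=> t; have [c1 c2] := cF t.
    suff : {for t, continuous (fun s : R => `|Re (F s)| + `|Im (F s)|)} by [].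
    apply: continuousD.
      by apply: (continuous_comp c1); exact: norm_continuous.
    by apply: (continuous_comp c2); exact: norm_continuous.
  exists (M N + M N) => W cW W1.
  have WF t : normc (W t * F t) <= N t.
    by rewrite ComplexField.Normc.normcM W1 mul1r le_normc_ReIm.
  have cWF := contCM cW cF.
  apply: (le_trans (le_normc_ReIm _)); apply: lerD => /=; apply: half_turn_mean_le => //.
  + by move=> t; case: (cWF t).
  + by move=> t; apply: le_trans (normRe_le_normc _) (WF t).
  + by move=> t; case: (cWF t).
  + by move=> t; apply: le_trans (normIm_le_normc _) (WF t).
- exact: half_turn_meanC_pos.
- move=> n; rewrite (_ : (fun t => _) = fun t => conjc (unit_circle t ^+ n.+1)).
    rewrite half_turn_meanCJ ?half_turn_meanC_pos ?conjc0//.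
    by apply: contCX; exact: contC_unit_circle.
  by apply/funext => t; rewrite rmorphXn.
- by rewrite /TF /half_turn_meanC !half_turn_mean_cst.
Qed.

End half_turn_mean.

(** The mean produced by vertical slices, which meet the boundary at the parameters pi / 2 - t and t
    - pi / 2. *)
Definition half_turn_meanC' (R : realType) (F : R -> R[i]) : R[i] :=
  half_turn_meanC (fun t => F (pi / 2 - t)).

Lemma contC_reflection (R : realType) (F : R -> R[i]) (c : R) : contC F ->
  contC (fun t => F (c - t)).
Proof.
move=> cF t; split.
  apply: (@continuous_reflection R (fun t => Re (F t))) => s.
  by case: (cF s).
apply: (@continuous_reflection R (fun t => Im (F t))) => s.
by case: (cF s).
Qed.

(** The change of parameter sends u to i conj u, hence exchanges positive and negative powers up to
    constants. *)
Lemma circle_mean_half_turn' (R : realType) : circle_mean (@half_turn_meanC' R).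
Proof.
have mT := circle_mean_half_turn R.
have uE (t : R) : unit_circle (pi / 2 - t) = Complex 0 1 * conjc (unit_circle t).
  rewrite /unit_circle cosB sinB cos_pihalf sin_pihalf; apply/eqP.
  by rewrite eq_complex /=; apply/andP; split; apply/eqP; ring.
have vE (t : R) : conjc (unit_circle (pi / 2 - t)) = Complex 0 (-1) * unit_circle t.
  by rewrite uE conjcM conjcK.
have cX (F : R -> R[i]) n : contC F -> contC (fun t => F t ^+ n) by exact: contCX.
split.
- move=> c F G cF cG; rewrite /half_turn_meanC'.
  by rewrite -(mean_lin mT)//; exact: contC_reflection.
- move=> F cF; have [K HK] := mean_bound mT (contC_reflection (pi / 2) cF).
  by exists K => W cW W1; apply: HK => //; exact: contC_reflection.
- move=> n; rewrite /half_turn_meanC'; under eq_fun do rewrite uE exprMn.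
  rewrite (meanZ mT) ?(mean_neg mT) ?mulr0//.
  by apply: cX; apply: contC_conj; exact: contC_unit_circle.
- move=> n; rewrite /half_turn_meanC'; under eq_fun do rewrite vE exprMn.
  rewrite (meanZ mT) ?(mean_pos mT) ?mulr0//.
  by apply: cX; exact: contC_unit_circle.
- exact: (mean1 mT).
Qed.

(** * The slicing formulas for complex-valued functions *)

Section complex_slices.
Context (R : realType) (Phi K1 K2 : R * R -> R[i]) (a b c1 c2 : R).
Hypotheses (a0 : 0 < a) (b0 : 0 < b).
Let e (t : R) : R * R := (a * cos t, b * sin t).
Hypothesis cPhi : contC (fun t => Phi (e t)).

Let pi2 : 2 * pi != 0 :> R.
Proof. by rewrite gt_eqF// mulr_gt0// pi_gt0. Qed.

Let re_mean (r : R -> R) (F : R -> R[i]) :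
  (2 * pi)%:C%C * half_turn_meanC (fun t => (r t)%:C%C * F t) =
  Complex (\int[mu]_(t in `[- (pi / 2), pi / 2])
             (r t * Re (F t) + r (pi - t) * Re (F (pi - t))))
          (\int[mu]_(t in `[- (pi / 2), pi / 2])
             (r t * Im (F t) + r (pi - t) * Im (F (pi - t)))).
Proof.
rewrite /half_turn_meanC /half_turn_mean; apply/eqP; rewrite eq_complex ReM ImM /=.
rewrite !mul0r subr0 addr0 !mulrA divff// !mul1r; apply/andP; split; apply/eqP;
  by apply: eq_Rintegral => t _; rewrite ?ReM ?ImM /= !mul0r ?subr0 ?addr0.
Qed.

(** The cosine changes sign under t to pi - t, so the weighted difference of the two end values is a
    sum of one function at t and at pi - t, as in the mean. *)
Lemma complex_integral_slices :
  (forall u v : R, v != c2 ->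
    is_derive u (1 : R) (fun t => Re (Phi (t, v))) (Re (K1 (u, v)))) ->
  (forall u v : R, v != c2 ->
    is_derive u (1 : R) (fun t => Im (Phi (t, v))) (Im (K1 (u, v)))) ->
  (forall v : R, v != c2 -> contC (fun t => K1 (t, v))) ->
  (mu \x mu)%E.-integrable setT
    (EFin \o (fun y => Re (K1 y) * \1_(Omega a b) y)) ->
  (mu \x mu)%E.-integrable setT
    (EFin \o (fun y => Im (K1 y) * \1_(Omega a b) y)) ->
  Complex (\int[@plane R]_y (Re (K1 y) * \1_(Omega a b) y))
          (\int[@plane R]_y (Im (K1 y) * \1_(Omega a b) y)) =
  (2 * pi)%:C%C * half_turn_meanC (fun t => (b * cos t)%:C%C * Phi (e t)).
Proof.
move=> d1 d2 cK i1 i2; rewrite re_mean.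
rewrite (@integral_slices R (fun y => Re (Phi y)) (fun y => Re (K1 y)) a b c2)//; last 2 first.
- by move=> v vc t; case: (cK _ vc t).
- by move=> t; case: (cPhi t).
rewrite (@integral_slices R (fun y => Im (Phi y)) (fun y => Im (K1 y)) a b c2)//; last 2 first.
- by move=> v vc t; case: (cK _ vc t).
- by move=> t; case: (cPhi t).
congr Complex; apply: eq_Rintegral => t _;
  by rewrite /e cosB sinB cospi sinpi !mul0r addr0 sub0r !mulN1r opprK !mulrN mulNr mulrBr.
Qed.

Lemma complex_integral_vertical_slices :
  (forall u v : R, u != c1 ->
    is_derive v (1 : R) (fun t => Re (Phi (u, t))) (Re (K2 (u, v)))) ->
  (forall u v : R, u != c1 ->
    is_derive v (1 : R) (fun t => Im (Phi (u, t))) (Im (K2 (u, v)))) ->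
  (forall u : R, u != c1 -> contC (fun t => K2 (u, t))) ->
  (mu \x mu)%E.-integrable setT
    (EFin \o (fun y => Re (K2 y) * \1_(Omega a b) y)) ->
  (mu \x mu)%E.-integrable setT
    (EFin \o (fun y => Im (K2 y) * \1_(Omega a b) y)) ->
  Complex (\int[@plane R]_y (Re (K2 y) * \1_(Omega a b) y))
          (\int[@plane R]_y (Im (K2 y) * \1_(Omega a b) y)) =
  (2 * pi)%:C%C * half_turn_meanC' (fun t => (a * sin t)%:C%C * Phi (e t)).
Proof.
move=> d1 d2 cK i1 i2.
rewrite /half_turn_meanC' (re_mean (fun t => a * sin (pi / 2 - t)) (fun t => Phi (e (pi / 2 - t)))).
rewrite (@integral_vertical_slices R (fun y => Re (Phi y)) (fun y => Re (K2 y)) a b c1)//; last 2 first.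
- by move=> v vc t; case: (cK _ vc t).
- by move=> t; case: (cPhi t).
rewrite (@integral_vertical_slices R (fun y => Im (Phi y)) (fun y => Im (K2 y)) a b c1)//; last 2 first.
- by move=> v vc t; case: (cK _ vc t).
- by move=> t; case: (cPhi t).
congr Complex; apply: eq_Rintegral => t _;
  by rewrite /e !(cosB, sinB) cos_pihalf sin_pihalf cospi sinpi
    !(mul0r, mul1r, mulN1r, add0r, subr0, addr0, sub0r, opprK) !mulrN mulNr mulrBr.
Qed.

End complex_slices.

(** * The kernels *)

Definition nsq (R : realType) (w : R * R) : R := w.1 ^+ 2 + w.2 ^+ 2.

(* For x on the ellipse, the value k at 0 is chosen so that the restriction of *)
(* y |-> conj_ratio k (x - y) to the ellipse is continuous. *)
Definition conj_ratio (R : realType) (k : R[i]) (w : R * R) : R[i] :=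
  if w == 0 then k else conjc (toC w) / toC w.

(* kap1 and kap2 are the derivatives of conj w / w, w = x - y, with respect to *)
(* y.1 and y.2. *)
Definition kap1 (R : realType) (z : R[i]) : R[i] := conjc z / z ^+ 2 - 1 / z.

Definition kap2 (R : realType) (z : R[i]) : R[i] :=
  Complex 0 1 * (conjc z / z ^+ 2 + 1 / z).

Lemma nsq_eq0 (R : realType) (w : R * R) : (nsq w == 0) = (w == 0).
Proof.
by case: w => p q; rewrite /nsq paddr_eq0 ?sqr_ge0// !sqrf_eq0 /= xpair_eqE.
Qed.

Lemma nsq_gt0 (R : realType) (w : R * R) : w != 0 -> 0 < nsq w.
Proof. by move=> w0; rewrite lt_def nsq_eq0 w0 addr_ge0 ?sqr_ge0. Qed.

Lemma toC_eq0 (R : realType) (w : R * R) : (toC w == 0) = (w == 0).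
Proof. by case: w => p q; rewrite /toC eq_complex xpair_eqE. Qed.

Lemma toCV (R : realType) (w : R * R) :
  (toC w)^-1 = Complex (w.1 / nsq w) (- (w.2 / nsq w)).
Proof. by []. Qed.

Lemma ReIm_kernels (R : realType) (w : R * R) :
  [/\ Re (kap1 (toC w)) = - (4 * w.1 * w.2 ^+ 2 / nsq w ^+ 2),
      Im (kap1 (toC w)) = - (2 * w.2 * (w.1 ^+ 2 - w.2 ^+ 2) / nsq w ^+ 2),
      Re (kap2 (toC w)) = 4 * w.1 ^+ 2 * w.2 / nsq w ^+ 2
    & Im (kap2 (toC w)) = 2 * w.1 * (w.1 ^+ 2 - w.2 ^+ 2) / nsq w ^+ 2].
Proof.
have [->|w0] := eqVneq w 0.
  by rewrite /nsq /kap1 /kap2 /toC /= !(expr0n, mulr0, mul0r, invr0, oppr0, addr0, subr0).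
have n0 : nsq w != 0 by rewrite nsq_eq0.
rewrite /kap1 /kap2 -exprVn !toCV expr2 /toC; case: w n0 {w0} => p q; rewrite /nsq /= => n0.
by split; field.
Qed.

Lemma Re_conj_ratio (R : realType) (k : R[i]) (w : R * R) : w != 0 ->
  conj_ratio k w = Complex ((w.1 ^+ 2 - w.2 ^+ 2) / nsq w) (- (2 * w.1 * w.2 / nsq w)).
Proof.
move=> w0; have n0 : nsq w != 0 by rewrite nsq_eq0.
rewrite /conj_ratio (negbTE w0) toCV; case: w n0 {w0} => p q; rewrite /nsq /= => n0.
by apply/eqP; rewrite eq_complex /=; apply/andP; split; apply/eqP; field.
Qed.

(** Follows from 1 / conj z = conj (1 / z) and z / (conj z)^2 = conj (conj z / z^2). It transfers
    derivatives, measurability, continuity and bounds from [kap1] and [kap2] to the gradient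
    kernel. *)
Lemma ReIm_gradW (R : realType) (alpha : R) (z : R[i]) :
  Re (gradW_kernel alpha z) =
    (Re (kap1 z) - Im (kap2 z)) / 2 - alpha / 2 * Re (kap1 z) /\
  Im (gradW_kernel alpha z) =
    - (Im (kap1 z) + Re (kap2 z)) / 2 - alpha / 2 * Re (kap2 z).
Proof.
rewrite /gradW_kernel /kap1 /kap2.
have -> : 1 / conjc z = conjc (1 / z) by rewrite !div1r conjc_inv.
have -> : z / conjc z ^+ 2 = conjc (conjc z / z ^+ 2).
  by rewrite conjcM conjcK conjc_inv rmorphXn.
case: (1 / z) => b1 b2; case: (conjc z / z ^+ 2) => a1 a2 /=.
by split; field.
Qed.

(** Amounts to |w.1| |w.2| <= w.1^2 + w.2^2, after square roots and inverses. *)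
Lemma inv_normc_le_rsqrt (R : realType) (w : R * R) : w.1 != 0 -> w.2 != 0 ->
  (normc (toC w))^-1 <= rsqrt w.1 * rsqrt w.2.
Proof.
move=> p0 q0; rewrite /rsqrt -invfM -sqrtrM// normcE lef_pV2 ?posrE.
- rewrite ler_wsqrtr// /toC /= -(real_normK (num_real w.1)) -(real_normK (num_real w.2)).
  have alg (p q : R) : 0 <= p -> 0 <= q -> p * q <= p ^+ 2 + q ^+ 2.
    move=> p1 q1; have := sqr_ge0 (p - q); have := mulr_ge0 p1 q1.
    by rewrite !expr2; lra.
  exact: alg.
- by rewrite sqrtr_gt0 (@nsq_gt0 _ w)//; apply: contra_neq p0 => ->.
- by rewrite sqrtr_gt0 mulr_gt0// normr_gt0.
Qed.

Lemma le_normc_sub (R : realType) (x y : R[i]) : normc (x - y) <= normc x + normc y.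
Proof. by rewrite (le_trans (le_normcD _ _))// (normcN y). Qed.

Lemma normc_conj_div_sqr (R : realType) (z : R[i]) :
  normc (conjc z / z ^+ 2) = (normc z)^-1.
Proof.
rewrite ComplexField.Normc.normcM ComplexField.Normc.normcV normcX normcJ.
have [->|z0] := eqVneq (normc z) 0; first by rewrite mul0r invr0.
by rewrite expr2 invfM mulrA divff// mul1r.
Qed.

Lemma normc_kap1_le (R : realType) (z : R[i]) : normc (kap1 z) <= 2 * (normc z)^-1.
Proof.
apply: (le_trans (le_normc_sub _ _)); rewrite normc_conj_div_sqr div1r.
by rewrite ComplexField.Normc.normcV; lra.
Qed.

Lemma normc_kap2_le (R : realType) (z : R[i]) : normc (kap2 z) <= 2 * (normc z)^-1.
Proof.
rewrite /kap2 ComplexField.Normc.normcM (_ : normc (Complex 0 1) = 1); last first.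
  by rewrite normcE /= expr0n expr1n add0r sqrtr1.
rewrite mul1r (le_trans (le_normcD _ _))//.
by rewrite normc_conj_div_sqr div1r ComplexField.Normc.normcV; lra.
Qed.

Lemma abs_gradW_le (R : realType) (alpha : R) (z : R[i]) :
  `|Re (gradW_kernel alpha z)| <= (2 + `|alpha|) * (normc z)^-1 /\
  `|Im (gradW_kernel alpha z)| <= (2 + `|alpha|) * (normc z)^-1.
Proof.
have [-> ->] := ReIm_gradW alpha z.
have k1 := normc_kap1_le z; have k2 := normc_kap2_le z.
have r1 := le_trans (normRe_le_normc _) k1; have i1 := le_trans (normIm_le_normc _) k1.
have r2 := le_trans (normRe_le_normc _) k2; have i2 := le_trans (normIm_le_normc _) k2.
have gen (be c x y : R) : `|x| <= 2 * c -> `|y| <= 2 * c ->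
    `|(x + y) / 2 - be / 2 * x| <= (2 + `|be|) * c.
  move=> x2 y2; rewrite (le_trans (ler_normB _ _))// [leRHS]mulrDl; apply: lerD.
    by move: x2 y2; rewrite !ler_norml; lra.
  rewrite -[be / 2 * x]mulrA normrM ler_wpM2l// normrM [`|2^-1|]ger0_norm//.
  by rewrite mulrC ler_pdivrMr// mulrC.
split; first by apply: (gen alpha _ _ (- Im (kap2 z)) r1); rewrite normrN.
rewrite (_ : - _ / 2 - _ = - ((Re (kap2 z) + Im (kap1 z)) / 2 - (- alpha) / 2 * Re (kap2 z))); last by field.
by rewrite normrN -(normrN alpha); exact: gen.
Qed.

(** A crude bound of the logarithm suffices: ln y < y at r and at 1 / r gives |ln r| <= r + 1 / r.
    Everything is then put over r = |w|, which is at most 4 N. *)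
Lemma abs_W_le (R : realType) (alpha N : R) (w : R * R) :
  `|w.1| <= N *+ 2 -> `|w.2| <= N *+ 2 -> w.1 != 0 ->
  `|W alpha w| <= ((N *+ 4) ^+ 2 + 1 + `|alpha| * (N *+ 4)) * (normc (toC w))^-1.
Proof.
move=> p1 q1 p0; have w0 : w != 0 by apply: contra_neq p0 => ->.
set r := normc (toC w).
have r0 : 0 < r by rewrite lt_def normc_ge0 normc_eq0 toC_eq0 w0.
have nr : w.1 ^+ 2 + w.2 ^+ 2 = r ^+ 2 by rewrite normc_sqr.
have rN : r <= N *+ 4.
  apply: (le_trans (le_normc_ReIm _)) => /=; rewrite (_ : N *+ 4 = N *+ 2 + N *+ 2) ?lerD//.
  by rewrite -mulrnDr.
have lE : - 2^-1 * ln (r ^+ 2) = - ln r by rewrite lnXn// -mulr_natl; field.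
rewrite /W nr lE.
rewrite (le_trans (ler_normD _ _))// normrN.
have l1 : `|ln r| <= r + r^-1.
  rewrite ler_norml; apply/andP; split.
    rewrite lerNl -lnV ?posrE// (le_trans (ltW (ln_sublinear _)))//; first by rewrite invr_gt0.
    by rewrite lerDr ltW.
  by rewrite (le_trans (ltW (ln_sublinear _)))// lerDl invr_ge0 ltW.
have l2 : `|alpha * (w.1 ^+ 2 / r ^+ 2)| <= `|alpha|.
  rewrite normrM ler_piMr// ger0_norm ?divr_ge0 ?sqr_ge0//.
  by rewrite ler_pdivrMr ?exprn_gt0// mul1r -nr lerDl sqr_ge0.
apply: (le_trans (lerD l1 l2)).
rewrite (_ : r + r^-1 + `|alpha| = (r ^+ 2 + 1 + `|alpha| * r) * r^-1); last first.
  by field; rewrite gt_eqF.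
have N0 : 0 <= N *+ 4 by apply: le_trans rN; exact: ltW.
rewrite ler_wpM2r ?invr_ge0 ?(ltW r0)// lerD ?lerD//.
  by rewrite ler_pXn2r// ?nnegrE// ltW.
by rewrite ler_wpM2l.
Qed.

Lemma is_derive_inv_sqr_add (R : realType) (c s : R) : c != 0 ->
  is_derive s (1 : R) (fun s => (s ^+ 2 + c ^+ 2)^-1) (- (2 * s) / (s ^+ 2 + c ^+ 2) ^+ 2).
Proof.
move=> c0; have n0 : s ^+ 2 + c ^+ 2 != 0.
  by rewrite gt_eqF// ltr_wpDl ?sqr_ge0// lt_def sqrf_eq0 c0 sqr_ge0.
have d1 : is_derive s (1 : R) (fun s => s ^+ 2 + c ^+ 2) (2 * s).
  have d2 : is_derive s (1 : R) (fun s => s ^+ 2) (2 * s).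
    by apply: is_derive_eq; rewrite /GRing.scale/= !mulr1 mulr2n mulrDl mul1r.
  by have := is_deriveD d2 (is_derive_cst (c ^+ 2) s 1); rewrite addr0.
apply: (is_derive_eq (@is_deriveV R (fun s => s ^+ 2 + c ^+ 2) s _ _ n0 d1)).
by rewrite /GRing.scale/= -exprVn mulNr mulrC mulNr exprVn.
Qed.

Lemma is_derive_reflect (R : realType) (f : R -> R) (c t l : R) :
  is_derive (c - t) (1 : R) f l -> is_derive t (1 : R) (fun t => f (c - t)) (- l).
Proof.
move=> df; have d1 : is_derive t (1 : R) (fun s : R => c - s) (-1 : R).
  by apply: is_derive_eq; rewrite add0r mul1r.
by have := @is_derive1_comp R f (fun s => c - s) t _ _ df d1; rewrite mulrN1.
Qed.

(** * Partial derivatives of the kernels *)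

Section conj_ratio_slices.
Context (R : realType) (k : R[i]) (x : R * R).

Let lin (a b c s : R) : c != 0 ->
  is_derive s (1 : R) (fun s => a + b * (s ^+ 2 + c ^+ 2)^-1)
    (b * (- (2 * s) / (s ^+ 2 + c ^+ 2) ^+ 2)).
Proof.
move=> c0; have d := is_deriveZ b (is_derive_inv_sqr_add s c0).
by have := is_deriveD (is_derive_cst a s 1) d; rewrite add0r.
Qed.

Let mul (b c s : R) : c != 0 ->
  is_derive s (1 : R) (fun s => b * s * (s ^+ 2 + c ^+ 2)^-1)
    (b * s * (- (2 * s) / (s ^+ 2 + c ^+ 2) ^+ 2) + b * (s ^+ 2 + c ^+ 2)^-1).
Proof.
move=> c0; have d2 : is_derive s (1 : R) (fun s : R => b * s) b.
  by apply: is_derive_eq; exact: mulr1.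
apply: (is_derive_eq (is_deriveM d2 (is_derive_inv_sqr_add s c0))).
by rewrite /GRing.scale/= [_ * b]mulrC.
Qed.

Let n0 (s c : R) : c != 0 -> s ^+ 2 + c ^+ 2 != 0.
Proof.
by move=> c0; rewrite gt_eqF// ltr_wpDl ?sqr_ge0// lt_def sqrf_eq0 c0 sqr_ge0.
Qed.

Lemma is_derive_conj_ratio (u v : R) : v != x.2 ->
  is_derive u (1 : R) (fun t => Re (conj_ratio k (x - (t, v))))
    (Re (kap1 (toC (x - (u, v))))) /\
  is_derive u (1 : R) (fun t => Im (conj_ratio k (x - (t, v))))
    (Im (kap1 (toC (x - (u, v))))).
Proof.
move=> vx; have q0 : x.2 - v != 0 by rewrite subr_eq0 eq_sym.
have w0 t : x - (t, v) != 0 by apply: contra_neq q0 => /(congr1 snd).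
have [-> -> _ _] := ReIm_kernels (x - (u, v)); rewrite /nsq /=.
have m0 := n0 (x.1 - u) q0; split.
(* The real part of conj w / w is 1 - 2 q^2 / |w|^2, where q = w.2 is constant on the row. *)
- have -> : (fun t => Re (conj_ratio k (x - (t, v)))) =
      (fun t => 1 + (- 2 * (x.2 - v) ^+ 2) * ((x.1 - t) ^+ 2 + (x.2 - v) ^+ 2)^-1).
    apply/funext => t; rewrite Re_conj_ratio// /nsq /=.
    by have h := n0 (x.1 - t) q0; field.
  apply: (is_derive_eq (is_derive_reflect (lin 1 (- 2 * (x.2 - v) ^+ 2) (x.1 - u) q0))).
  by field.
- have -> : (fun t => Im (conj_ratio k (x - (t, v)))) =
      (fun t => (- 2 * (x.2 - v)) * (x.1 - t) * ((x.1 - t) ^+ 2 + (x.2 - v) ^+ 2)^-1).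
    apply/funext => t; rewrite Re_conj_ratio// /nsq /=.
    by have h := n0 (x.1 - t) q0; field.
  apply: (is_derive_eq (is_derive_reflect (mul (- 2 * (x.2 - v)) (x.1 - u) q0))).
  by field.
Qed.

Lemma is_derive_conj_ratio_vertical (u v : R) : u != x.1 ->
  is_derive v (1 : R) (fun t => Re (conj_ratio k (x - (u, t))))
    (Re (kap2 (toC (x - (u, v))))) /\
  is_derive v (1 : R) (fun t => Im (conj_ratio k (x - (u, t))))
    (Im (kap2 (toC (x - (u, v))))).
Proof.
move=> ux; have p0 : x.1 - u != 0 by rewrite subr_eq0 eq_sym.
have w0 t : x - (u, t) != 0 by apply: contra_neq p0 => /(congr1 fst).
have [_ _ -> ->] := ReIm_kernels (x - (u, v)); rewrite /nsq /= ![(x.1 - u) ^+ 2 + _]addrC.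
have m0 := n0 (x.2 - v) p0; split.
- have -> : (fun t => Re (conj_ratio k (x - (u, t)))) =
      (fun t => -1 + (2 * (x.1 - u) ^+ 2) * ((x.2 - t) ^+ 2 + (x.1 - u) ^+ 2)^-1).
    apply/funext => t; rewrite Re_conj_ratio// /nsq /= [(x.1 - u) ^+ 2 + _]addrC.
    by have h := n0 (x.2 - t) p0; field.
  apply: (is_derive_eq (is_derive_reflect (lin (-1) (2 * (x.1 - u) ^+ 2) (x.2 - v) p0))).
  by field.
- have -> : (fun t => Im (conj_ratio k (x - (u, t)))) =
      (fun t => (- 2 * (x.1 - u)) * (x.2 - t) * ((x.2 - t) ^+ 2 + (x.1 - u) ^+ 2)^-1).
    apply/funext => t; rewrite Re_conj_ratio// /nsq /= [(x.1 - u) ^+ 2 + _]addrC.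
    by have h := n0 (x.2 - t) p0; field.
  apply: (is_derive_eq (is_derive_reflect (mul (- 2 * (x.1 - u)) (x.2 - v) p0))).
  by field.
Qed.

End conj_ratio_slices.

Section W_slices.
Context (R : realType) (alpha : R).

Let ln_part (c s : R) : c != 0 ->
  is_derive s (1 : R) (fun s => - 2^-1 * ln (s ^+ 2 + c ^+ 2)) (- (s / (s ^+ 2 + c ^+ 2))).
Proof.
move=> c0; have n0 : 0 < s ^+ 2 + c ^+ 2.
  by rewrite ltr_wpDl ?sqr_ge0// lt_def sqrf_eq0 c0 sqr_ge0.
have d1 : is_derive s (1 : R) (fun s => s ^+ 2 + c ^+ 2) (2 * s).
  have d2 : is_derive s (1 : R) (fun s => s ^+ 2) (2 * s).
    by apply: is_derive_eq; rewrite /GRing.scale/= !mulr1 mulr2n mulrDl mul1r.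
  by have := is_deriveD d2 (is_derive_cst (c ^+ 2) s 1); rewrite addr0.
have d2 := @is_derive1_comp R (@ln R) (fun s => s ^+ 2 + c ^+ 2) s _ _ (is_derive1_ln n0) d1.
apply: (is_derive_eq (is_deriveZ (- 2^-1) d2)); rewrite /GRing.scale/=.
by field; rewrite gt_eqF.
Qed.

Lemma is_derive_W (u v : R) : v != 0 ->
  is_derive u (1 : R) (fun t => W alpha (t, v)) (Re (gradW_kernel alpha (toC (u, v)))).
Proof.
move=> v0; have n0 s : s ^+ 2 + v ^+ 2 != 0 :> R.
  by rewrite gt_eqF// ltr_wpDl ?sqr_ge0// lt_def sqrf_eq0 v0 sqr_ge0.
have -> : (fun t => W alpha (t, v)) = (fun t => - 2^-1 * ln (t ^+ 2 + v ^+ 2)) +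
    (fun t => alpha + (- alpha * v ^+ 2) * (t ^+ 2 + v ^+ 2)^-1).
  apply/funext => t; rewrite fctE /W /=; congr (_ + _).
  by have h := n0 t; field.
have d2 := is_deriveD (is_derive_cst alpha u 1)
  (is_deriveZ (- alpha * v ^+ 2) (is_derive_inv_sqr_add u v0)).
apply: (is_derive_eq (is_deriveD (ln_part u v0) d2)).
have [-> _] := ReIm_gradW alpha (toC (u, v)); have [-> _ _ ->] := ReIm_kernels (u, v).
by rewrite /nsq /GRing.scale/=; have h := n0 u; field.
Qed.

Lemma is_derive_W_vertical (u v : R) : u != 0 ->
  is_derive v (1 : R) (fun t => W alpha (u, t)) (Im (gradW_kernel alpha (toC (u, v)))).
Proof.
move=> u0; have n0 s : s ^+ 2 + u ^+ 2 != 0 :> R.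
  by rewrite gt_eqF// ltr_wpDl ?sqr_ge0// lt_def sqrf_eq0 u0 sqr_ge0.
have -> : (fun t => W alpha (u, t)) = (fun t => - 2^-1 * ln (t ^+ 2 + u ^+ 2)) +
    ((alpha * u ^+ 2) \*: (fun t => (t ^+ 2 + u ^+ 2)^-1)).
  apply/funext => t; rewrite fctE /W /= [u ^+ 2 + _]addrC; congr (_ + _).
  by rewrite mulrA.
have d2 := is_deriveZ (alpha * u ^+ 2) (is_derive_inv_sqr_add v u0).
apply: (is_derive_eq (is_deriveD (ln_part v u0) d2)).
have [_ ->] := ReIm_gradW alpha (toC (u, v)); have [_ -> -> _] := ReIm_kernels (u, v).
by rewrite /nsq /GRing.scale/= ![u ^+ 2 + _]addrC; have h := n0 v; field.
Qed.

End W_slices.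

(** * Continuity and measurability of the kernels *)

Section kernel_continuity.
Context (R : realType).

Lemma contC_kap1 (F : R -> R[i]) : contC F -> (forall t, F t != 0) ->
  contC (fun t => kap1 (F t)).
Proof.
move=> cF F0; apply: contCB.
  apply: contCM; first exact: contC_conj.
  by apply: contCV => [|t]; [exact: contCX|rewrite expf_neq0].
by apply: contCM; [exact: contC_cst|exact: contCV].
Qed.

Lemma contC_kap2 (F : R -> R[i]) : contC F -> (forall t, F t != 0) ->
  contC (fun t => kap2 (F t)).
Proof.
move=> cF F0; apply: contCM; first exact: contC_cst.
apply: contCD.
  apply: contCM; first exact: contC_conj.
  by apply: contCV => [|t]; [exact: contCX|rewrite expf_neq0].
by apply: contCM; [exact: contC_cst|exact: contCV].
Qed.

Lemma contC_gradW (alpha : R) (F : R -> R[i]) : contC F -> (forall t, F t != 0) ->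
  contC (fun t => gradW_kernel alpha (F t)).
Proof.
move=> cF F0; have c1 := contC_kap1 cF F0; have c2 := contC_kap2 cF F0.
have cs (c t : R) : {for t, continuous (fun _ : R => c)} by exact: cst_continuous.
move=> t; have [a1 a2] := c1 t; have [b1 b2] := c2 t; split.
  rewrite (_ : (fun t => _) = (fun t => (Re (kap1 (F t)) - Im (kap2 (F t))) * 2^-1 -
      alpha / 2 * Re (kap1 (F t)))).
    apply: continuousB; last exact: continuousM.
    by apply: continuousM => //; exact: continuousB.
  by apply/funext => s; case: (ReIm_gradW alpha (F s)).
rewrite (_ : (fun t => _) = (fun t => - (Im (kap1 (F t)) + Re (kap2 (F t))) * 2^-1 -
    alpha / 2 * Re (kap2 (F t)))).
  apply: continuousB; last exact: continuousM.
  by apply: continuousM; [apply: continuousN; exact: continuousD|exact: cs].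
by apply/funext => s; case: (ReIm_gradW alpha (F s)).
Qed.

End kernel_continuity.

Section kernel_measurability.
Context (R : realType).

Lemma measurable_inv_nsq : measurable_fun [set: R * R] (fun w => (nsq w)^-1).
Proof.
apply: (measurableT_comp (@measurable_inv R)).
by apply: measurable_funD; apply: measurable_funX.
Qed.

Lemma measurable_kernels :
  [/\ measurable_fun [set: R * R] (fun w => Re (kap1 (toC w))),
      measurable_fun [set: R * R] (fun w => Im (kap1 (toC w))),
      measurable_fun [set: R * R] (fun w => Re (kap2 (toC w)))
    & measurable_fun [set: R * R] (fun w => Im (kap2 (toC w)))].
Proof.
have m2 : measurable_fun [set: R * R] (fun w => (nsq w ^+ 2)^-1).
  by under eq_fun do rewrite -exprVn; apply: measurable_funX; exact: measurable_inv_nsq.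
have f1 : measurable_fun [set: R * R] (fun w => w.1) by exact: measurable_fst.
have f2 : measurable_fun [set: R * R] (fun w => w.2) by exact: measurable_snd.
have fs n : measurable_fun [set: R * R] (fun w => w.1 ^+ n) by exact: measurable_funX.
have ft n : measurable_fun [set: R * R] (fun w => w.2 ^+ n) by exact: measurable_funX.
have fB : measurable_fun [set: R * R] (fun w => w.1 ^+ 2 - w.2 ^+ 2) by exact: measurable_funB.
split.
- rewrite (_ : (fun w => _) = (fun w => - (4 * w.1 * w.2 ^+ 2 * (nsq w ^+ 2)^-1))).
    apply: measurable_funN; apply: measurable_funM => //.
    by apply: measurable_funM => //; exact: measurable_funM.
  by apply/funext => w; case: (ReIm_kernels w).
- rewrite (_ : (fun w => _) = (fun w => - (2 * w.2 * (w.1 ^+ 2 - w.2 ^+ 2) * (nsq w ^+ 2)^-1))).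
    apply: measurable_funN; apply: measurable_funM => //.
    by apply: measurable_funM => //; exact: measurable_funM.
  by apply/funext => w; case: (ReIm_kernels w).
- rewrite (_ : (fun w => _) = (fun w => 4 * w.1 ^+ 2 * w.2 * (nsq w ^+ 2)^-1)).
    apply: measurable_funM => //.
    by apply: measurable_funM => //; exact: measurable_funM.
  by apply/funext => w; case: (ReIm_kernels w).
- rewrite (_ : (fun w => _) = (fun w => 2 * w.1 * (w.1 ^+ 2 - w.2 ^+ 2) * (nsq w ^+ 2)^-1)).
    apply: measurable_funM => //.
    by apply: measurable_funM => //; exact: measurable_funM.
  by apply/funext => w; case: (ReIm_kernels w).
Qed.

Lemma measurable_gradW (alpha : R) :
  measurable_fun [set: R * R] (fun w => Re (gradW_kernel alpha (toC w))) /\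
  measurable_fun [set: R * R] (fun w => Im (gradW_kernel alpha (toC w))).
Proof.
have [m1 m2 m3 m4] := measurable_kernels; split.
  rewrite (_ : (fun w => _) = (fun w => (Re (kap1 (toC w)) - Im (kap2 (toC w))) * 2^-1 -
      alpha / 2 * Re (kap1 (toC w)))).
    apply: measurable_funB; last exact: measurable_funM.
    by apply: measurable_funM => //; exact: measurable_funB.
  by apply/funext => w; case: (ReIm_gradW alpha (toC w)).
rewrite (_ : (fun w => _) = (fun w => - (Im (kap1 (toC w)) + Re (kap2 (toC w))) * 2^-1 -
    alpha / 2 * Re (kap2 (toC w)))).
  apply: measurable_funB; last exact: measurable_funM.
  by apply: measurable_funM => //; apply: measurable_funN; exact: measurable_funD.
by apply/funext => w; case: (ReIm_gradW alpha (toC w)).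
Qed.

Lemma measurable_W (alpha : R) : measurable_fun [set: R * R] (W alpha).
Proof.
have fs : measurable_fun [set: R * R] (fun w => w.1 ^+ 2) by exact: measurable_funX.
have ft : measurable_fun [set: R * R] (fun w => w.2 ^+ 2) by exact: measurable_funX.
apply: measurable_funD; apply: measurable_funM => //.
  by apply: (measurableT_comp (@measurable_ln R)); exact: measurable_funD.
by apply: measurable_funM => //; exact: measurable_inv_nsq.
Qed.

Lemma measurable_Omega (a b : R) : measurable (Omega a b).
Proof.
have m : measurable_fun [set: R * R] (fun x => x.1 ^+ 2 / a ^+ 2 + x.2 ^+ 2 / b ^+ 2).
  by apply: measurable_funD; apply: measurable_funM => //; exact: measurable_funX.
have := m measurableT `]-oo, 1[%classic (measurable_itv _); rewrite setTI.
by congr measurable; apply/seteqP; split => w; rewrite /Omega /= in_itv.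
Qed.

End kernel_measurability.

Lemma contC_row (R : realType) (v : R) : contC (fun t => toC (t, v)).
Proof.
by move=> t; split; [exact: cvg_id|exact: (@cst_continuous R R v t)].
Qed.

Lemma contC_column (R : realType) (u : R) : contC (fun t => toC (u, t)).
Proof.
by move=> t; split; [exact: (@cst_continuous R R u t)|exact: cvg_id].
Qed.

Lemma Omega_bounded (R : realType) (a b : R) (y : R * R) : 0 < a -> 0 < b ->
  Omega a b y -> `|y.1| <= a /\ `|y.2| <= b.
Proof.
move=> a0 b0 yO; have h (c t : R) : 0 < c -> t ^+ 2 / c ^+ 2 <= 1 -> `|t| <= c.
  move=> c0; rewrite ler_pdivrMr ?exprn_gt0// mul1r => tc.
  by rewrite -(@ler_pXn2r _ 2)// ?nnegrE ?(ltW c0)// real_normK ?num_real.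
split; apply: h => //; apply: le_trans (ltW yO).
  by rewrite lerDl divr_ge0 ?sqr_ge0.
by rewrite lerDr divr_ge0 ?sqr_ge0.
Qed.

(** * Convolutions of the kernels with the ellipse *)

Section convolution_with_ellipse.
Context (R : realType) (alpha a b : R).
Hypotheses (a0 : 0 < a) (b0 : 0 < b).

(** Half the side of a centred square that contains the ellipse and the points within distance 1 of
    x along the axes, as [partial_derivative_convolution] requires. *)
Definition radius (x : R * R) : R := a + b + `|x.1| + `|x.2| + 1.

Let OmN x y : Omega a b y -> `|y.1| <= radius x /\ `|y.2| <= radius x.
Proof.
move=> /(Omega_bounded a0 b0)[y1 y2]; rewrite /radius.
by have := (a0, b0, normr_ge0 x.1, normr_ge0 x.2) => -[[[]]]; split; lra.
Qed.

Let xN1 (x : R * R) : `|x.1| + 1 <= radius x.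
Proof. by rewrite /radius; move: a0 b0 (normr_ge0 x.2); lra. Qed.

Let xN2 (x : R * R) : `|x.2| + 1 <= radius x.
Proof. by rewrite /radius; move: a0 b0 (normr_ge0 x.1); lra. Qed.

Let xN1' (x : R * R) : `|x.1| <= radius x.
Proof. by move: (xN1 x); lra. Qed.

Let xN2' (x : R * R) : `|x.2| <= radius x.
Proof. by move: (xN2 x); lra. Qed.

(** The sum of the constants of [abs_gradW_le] and [abs_W_le], so that one constant serves the
    potential and its derivatives. *)
Definition singularity_const (x : R * R) : R :=
  2 + `|alpha| + ((radius x *+ 4) ^+ 2 + 1 + `|alpha| * (radius x *+ 4)).

Let C0 x : 0 <= singularity_const x.
Proof.
have r0 : 0 <= radius x by apply: le_trans (xN1' x).
by rewrite /singularity_const !addr_ge0 ?sqr_ge0 ?mulr_ge0 ?mulrn_wge0.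
Qed.

Let weak (c C : R) (w : R * R) x : w.1 != 0 -> w.2 != 0 ->
  `|c| <= C * (normc (toC w))^-1 -> 0 <= C -> C <= singularity_const x ->
  `|c| <= singularity_const x * (rsqrt w.1 * rsqrt w.2).
Proof.
move=> w1 w2 cC C1 CC; apply: (le_trans cC); apply: ler_pM => //.
  by rewrite invr_ge0 normc_ge0.
exact: inv_normc_le_rsqrt.
Qed.

Let le2C x : 2 <= singularity_const x.
Proof.
have r0 : 0 <= radius x by apply: le_trans (xN1' x).
rewrite /singularity_const; have := sqr_ge0 (radius x *+ 4).
have : 0 <= `|alpha| * (radius x *+ 4) by rewrite mulr_ge0// mulrn_wge0.
by have := normr_ge0 alpha; lra.
Qed.

Let kap_weak (w : R * R) x : w.1 != 0 -> w.2 != 0 ->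
  [/\ `|Re (kap1 (toC w))| <= singularity_const x * (rsqrt w.1 * rsqrt w.2),
      `|Im (kap1 (toC w))| <= singularity_const x * (rsqrt w.1 * rsqrt w.2),
      `|Re (kap2 (toC w))| <= singularity_const x * (rsqrt w.1 * rsqrt w.2)
    & `|Im (kap2 (toC w))| <= singularity_const x * (rsqrt w.1 * rsqrt w.2)].
Proof.
move=> w1 w2; split; apply: (@weak _ 2) => //.
- exact: le_trans (normRe_le_normc _) (normc_kap1_le _).
- exact: le_trans (normIm_le_normc _) (normc_kap1_le _).
- exact: le_trans (normRe_le_normc _) (normc_kap2_le _).
- exact: le_trans (normIm_le_normc _) (normc_kap2_le _).
Qed.

Let grad_weak (w : R * R) x : w.1 != 0 -> w.2 != 0 ->
  `|Re (gradW_kernel alpha (toC w))| <= singularity_const x * (rsqrt w.1 * rsqrt w.2) /\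
  `|Im (gradW_kernel alpha (toC w))| <= singularity_const x * (rsqrt w.1 * rsqrt w.2).
Proof.
have r0 : 0 <= radius x by apply: le_trans (xN1' x).
have C2 : 2 + `|alpha| <= singularity_const x.
  rewrite lerDl !addr_ge0 ?sqr_ge0 ?mulr_ge0 ?mulrn_wge0//.
move=> w1 w2; have [g1 g2] := abs_gradW_le alpha (toC w).
by split; [apply: (weak w1 w2 g1)|apply: (weak w1 w2 g2)] => //; rewrite addr_ge0.
Qed.

Let W_weak (w : R * R) x : `|w.1| <= radius x *+ 2 -> `|w.2| <= radius x *+ 2 ->
  w.1 != 0 -> w.2 != 0 ->
  `|W alpha w| <= singularity_const x * (rsqrt w.1 * rsqrt w.2).
Proof.
have r0 : 0 <= radius x by apply: le_trans (xN1' x).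
move=> n1 n2 w1 w2; have h := abs_W_le alpha n1 n2 w1.
apply: (weak w1 w2 h); last by rewrite lerDr addr_ge0.
by rewrite !addr_ge0 ?sqr_ge0 ?mulr_ge0 ?mulrn_wge0.
Qed.

Let mO : measurable (Omega a b). Proof. exact: measurable_Omega. Qed.

Lemma convolvable_gradW x : convolvableC (gradW_kernel alpha) \1_(Omega a b) x.
Proof.
have [m1 m2] := measurable_gradW alpha; split.
  apply: (@integrable_shifted R _ _ _ _ m1 mO (OmN x) (C0 x) _ x) => //.
  by move=> w _ _ w1 w2; case: (grad_weak x w1 w2).
apply: (@integrable_shifted R _ _ _ _ m2 mO (OmN x) (C0 x) _ x) => //.
by move=> w _ _ w1 w2; case: (grad_weak x w1 w2).
Qed.

Lemma convolvable_W x : convolvable (W alpha) \1_(Omega a b) x.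
Proof.
apply: (@integrable_shifted R _ _ _ _ (measurable_W alpha) mO (OmN x) (C0 x) _ x) => //.
by move=> w w1 w2 w3 w4; exact: W_weak.
Qed.

Lemma integrable_kernels x :
  [/\ (mu \x mu)%E.-integrable setT (EFin \o (fun y => Re (kap1 (toC (x - y))) * \1_(Omega a b) y)),
      (mu \x mu)%E.-integrable setT (EFin \o (fun y => Im (kap1 (toC (x - y))) * \1_(Omega a b) y)),
      (mu \x mu)%E.-integrable setT (EFin \o (fun y => Re (kap2 (toC (x - y))) * \1_(Omega a b) y))
    & (mu \x mu)%E.-integrable setT (EFin \o (fun y => Im (kap2 (toC (x - y))) * \1_(Omega a b) y))].
Proof.
have [m1 m2 m3 m4] := measurable_kernels R; split.
- apply: (@integrable_shifted R _ _ _ _ m1 mO (OmN x) (C0 x) _ x) => //.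
  by move=> w _ _ w1 w2; case: (kap_weak x w1 w2).
- apply: (@integrable_shifted R _ _ _ _ m2 mO (OmN x) (C0 x) _ x) => //.
  by move=> w _ _ w1 w2; case: (kap_weak x w1 w2).
- apply: (@integrable_shifted R _ _ _ _ m3 mO (OmN x) (C0 x) _ x) => //.
  by move=> w _ _ w1 w2; case: (kap_weak x w1 w2).
- apply: (@integrable_shifted R _ _ _ _ m4 mO (OmN x) (C0 x) _ x) => //.
  by move=> w _ _ w1 w2; case: (kap_weak x w1 w2).
Qed.

(** The continuity hypotheses are verified only later, from the closed formulas for these
    convolutions. *)
Lemma gradient_convolution_W x :
  {for 0, continuous (fun t => convolution (fun y => Re (gradW_kernel alpha (toC y)))
     \1_(Omega a b) (x + (t, 0)))} ->
  {for 0, continuous (fun t => convolution (fun y => Im (gradW_kernel alpha (toC y)))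
     \1_(Omega a b) (x + (0, t)))} ->
  is_derive x ((1, 0) : R * R) (fun x => convolution (W alpha) \1_(Omega a b) x)
    (convolution (fun y => Re (gradW_kernel alpha (toC y))) \1_(Omega a b) x) /\
  is_derive x ((0, 1) : R * R) (fun x => convolution (W alpha) \1_(Omega a b) x)
    (convolution (fun y => Im (gradW_kernel alpha (toC y))) \1_(Omega a b) x).
Proof.
move=> c1 c2; have [m1 m2] := measurable_gradW alpha; split.
  have -> : convolution (fun y => Re (gradW_kernel alpha (toC y))) \1_(Omega a b) x =
      convolution (fun y => Re (gradW_kernel alpha (toC y))) \1_(Omega a b) (x + 0).
    by rewrite addr0.
  apply: (@partial_derivative_convolution R (W alpha) (fun y => Re (gradW_kernel alpha (toC y)))
    (Omega a b) (radius x) (singularity_const x) (measurable_W alpha) m1 mO (OmN x) (C0 x)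
    _ _ _ _ x (xN1 x) (xN2' x) c1).
  - by move=> w w1 w2 w3 w4; exact: W_weak.
  - by move=> w _ _ w1 w2; case: (grad_weak x w1 w2).
  - by move=> u v v0; exact: is_derive_W.
  - move=> v v0 t; have n0 s : toC (s, v) != 0.
      by rewrite toC_eq0; apply: contra_neq v0 => /(congr1 snd).
    exact: (proj1 (contC_gradW alpha (contC_row v) n0 t)).
apply: (@second_partial_derivative_convolution R (W alpha) (fun y => Im (gradW_kernel alpha (toC y)))
  (Omega a b) (radius x) (singularity_const x) (measurable_W alpha) m2 mO (OmN x) (C0 x)
  _ _ _ _ x (xN1' x) (xN2 x) c2).
- by move=> w w1 w2 w3 w4; exact: W_weak.
- by move=> w _ _ w1 w2; case: (grad_weak x w1 w2).
- by move=> u v v0; exact: is_derive_W_vertical.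
- move=> u u0 t; have n0 s : toC (u, s) != 0.
    by rewrite toC_eq0; apply: contra_neq u0 => /(congr1 fst).
  exact: (proj2 (contC_gradW alpha (contC_column u) n0 t)).
Qed.

End convolution_with_ellipse.

Lemma toCB (R : realType) (x y : R * R) : toC (x - y) = toC x - toC y.
Proof. by []. Qed.

Lemma toCD (R : realType) (x y : R * R) : toC (x + y) = toC x + toC y.
Proof. by []. Qed.

(** * From the two means to the convolution *)

Section convolution_of_means.
Context (R : realType) (alpha a b : R) (k A B : R[i]) (x : R * R).
Hypotheses (a0 : 0 < a) (b0 : 0 < b).
Local Notation u := (@unit_circle R).
Local Notation v := (fun t : R => conjc (unit_circle t)).
Let e (t : R) : R * R := (a * cos t, b * sin t).
Let g (t : R) : R[i] := conj_ratio k (x - e t).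
Hypothesis cg : contC g.
Hypothesis TA : forall T, circle_mean T -> T (fun t => u t * g t) = A.
Hypothesis TB : forall T, circle_mean T -> T (fun t => v t * g t) = B.

(** Horizontal slices integrate [kap1] and vertical ones [kap2]; each produces a different mean,
    which is why [TA] and [TB] are assumed for every [circle_mean]. *)
Let kernels_J :
  Complex (convolution (fun y => Re (kap1 (toC y))) \1_(Omega a b) x)
          (convolution (fun y => Im (kap1 (toC y))) \1_(Omega a b) x) =
    (pi * b)%:C%C * (A + B) /\
  Complex (convolution (fun y => Re (kap2 (toC y))) \1_(Omega a b) x)
          (convolution (fun y => Im (kap2 (toC y))) \1_(Omega a b) x) =
    (pi * a)%:C%C * (Complex 0 (-1) * (A - B)).
Proof.
have [i1 i2 i3 i4] := integrable_kernels alpha a0 b0 x.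
have cu := @contC_unit_circle R.
have cug : contC (fun t => u t * g t) by exact: contCM.
have cvg : contC (fun t => v t * g t) by exact: (contCM (contC_conj cu) cg).
split.
- etransitivity.
    apply: (@complex_integral_slices R (fun y => conj_ratio k (x - y))
      (fun y => kap1 (toC (x - y))) a b x.2 a0 b0 cg _ _ _ i1 i2).
  + by move=> s w wx; case: (is_derive_conj_ratio k s wx).
  + by move=> s w wx; case: (is_derive_conj_ratio k s wx).
  + move=> w wx; apply: contC_kap1.
      rewrite (_ : (fun t => _) = (fun t => toC x - toC (t, w))).
        exact: (contCB (contC_cst _) (contC_row w)).
      by apply/funext => t; exact: toCB.
    by move=> t; rewrite toC_eq0; apply: contra_neq wx => /(congr1 snd)/subr0_eq.
  have mT := circle_mean_half_turn R.
  (* The weight is b cos t = (b / 2) (u + v). *)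
  have -> : (fun t => (b * cos t)%:C%C * conj_ratio k (x - e t)) =
      (fun t => (b / 2)%:C%C * (u t * g t + v t * g t)).
    apply/funext => t; rewrite -mulrDl mulrA; congr (_ * _).
    by rewrite /unit_circle /=; apply/eqP; rewrite eq_complex /=; apply/andP; split; apply/eqP; field.
  rewrite (meanZ mT _ (contCD cug cvg)) (meanD mT cug cvg) (TA mT) (TB mT).
  rewrite mulrA -rmorphM; congr (_%:C%C * _).
  by move: (pi : R) => P; field.
- etransitivity.
    apply: (@complex_integral_vertical_slices R (fun y => conj_ratio k (x - y))
      (fun y => kap2 (toC (x - y))) a b x.1 a0 b0 cg _ _ _ i3 i4).
  + by move=> s w wx; case: (is_derive_conj_ratio_vertical k w wx).
  + by move=> s w wx; case: (is_derive_conj_ratio_vertical k w wx).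
  + move=> w wx; apply: contC_kap2.
      rewrite (_ : (fun t => _) = (fun t => toC x - toC (w, t))).
        exact: (contCB (contC_cst _) (contC_column w)).
      by apply/funext => t; exact: toCB.
    by move=> t; rewrite toC_eq0; apply: contra_neq wx => /(congr1 fst)/subr0_eq.
  have mT := circle_mean_half_turn' R.
  (* The weight is a sin t = (a / 2) (- i) (u - v). *)
  have -> : (fun t => (a * sin t)%:C%C * conj_ratio k (x - e t)) =
      (fun t => ((a / 2)%:C%C * Complex 0 (-1)) * (u t * g t + (-1) * (v t * g t))).
    apply/funext => t; rewrite mulN1r -mulrBl mulrA; congr (_ * _).
    by rewrite /unit_circle /=; apply/eqP; rewrite eq_complex /=; apply/andP; split; apply/eqP; field.
  have cN : contC (fun t => (-1) * (v t * g t)) by exact: (contCM (contC_cst _) cvg).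
  rewrite (meanZ mT _ (contCD cug cN)) (meanD mT cug cN) (meanZ mT _ cvg) (TA mT) (TB mT).
  rewrite mulN1r !mulrA -rmorphM; congr (_%:C%C * _ * _).
  by move: (pi : R) => P; field.
Qed.

(** Solving [kernels_J] for 1 / w and conj w / w^2, their integrals over the ellipse are - pi (p A -
    q B) and pi (p B - q A), with p = (a + b) / 2 and q = (a - b) / 2. The proof does this on real
    and imaginary parts. *)
Lemma convolution_gradW_of_means :
  convolutionC (gradW_kernel alpha) \1_(Omega a b) x =
  pi%:C%C * (conjc (((a + b) / 2)%:C%C * A - ((a - b) / 2)%:C%C * B)
    - (alpha / 2)%:C%C * (((a + b) / 2)%:C%C * A - ((a - b) / 2)%:C%C * B
        - ((a - b) / 2)%:C%C * conjc A + ((a + b) / 2)%:C%C * conjc B)).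
Proof.
have [i1 i2 i3 i4] := integrable_kernels alpha a0 b0 x.
have lin (c d : R) (f1 f2 : R * R -> R) :
    (@plane R).-integrable setT (EFin \o (fun y => f1 (x - y) * \1_(Omega a b) y)) ->
    (@plane R).-integrable setT (EFin \o (fun y => f2 (x - y) * \1_(Omega a b) y)) ->
    convolution (fun y => c * f1 y + d * f2 y) \1_(Omega a b) x =
    c * convolution f1 \1_(Omega a b) x + d * convolution f2 \1_(Omega a b) x.
  move=> j1 j2; rewrite /convolution -[@planar_lebesgue R]/(@plane R) -!RintegralZl// -RintegralD//.
  - by apply: eq_Rintegral => y _; rewrite mulrDl !mulrA.
  - exact: (integrableZl measurableT c j1).
  - exact: (integrableZl measurableT d j2).
have cE f f' : f =1 f' -> convolution f \1_(Omega a b) x = convolution f' \1_(Omega a b) x.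
  by move=> /funext ->.
have [] := kernels_J; rewrite /convolutionC.
rewrite (cE (fun y => Re (gradW_kernel alpha (toC y)))
  (fun y => (2^-1 - alpha / 2) * Re (kap1 (toC y)) + (- 2^-1) * Im (kap2 (toC y)))); last first.
  by move=> y; have [-> _] := ReIm_gradW alpha (toC y); ring.
rewrite (cE (fun y => Im (gradW_kernel alpha (toC y)))
  (fun y => (- 2^-1) * Im (kap1 (toC y)) + (- 2^-1 - alpha / 2) * Re (kap2 (toC y)))); last first.
  by move=> y; have [_ ->] := ReIm_gradW alpha (toC y); ring.
rewrite (lin _ _ (fun y => Re (kap1 (toC y))) (fun y => Im (kap2 (toC y))) i1 i4).
rewrite (lin _ _ (fun y => Im (kap1 (toC y))) (fun y => Re (kap2 (toC y))) i2 i3).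
move: (convolution _ _ _) (convolution _ _ _) (convolution _ _ _) (convolution _ _ _) => r1 s1 r2 s2.
case: A => A1 A2; case: B => B1 B2; move: (pi : R) => P.
move=> /eqP; rewrite eq_complex /= => /andP[/eqP -> /eqP ->].
move=> /eqP; rewrite eq_complex /= => /andP[/eqP -> /eqP ->].
by apply/eqP; rewrite eq_complex /=; apply/andP; split; apply/eqP; field.
Qed.

End convolution_of_means.

(** * The convolution in terms of the roots *)

(** The point is p (U + lam / U) with U = X + i Y, and the semi-axes are p (1 + lam) and p (1 -
    lam). The factor rho - 1, with rho = |U|^2, comes from (rho + lam)^2 - rho (1 + lam)^2 = (rho -
    1) (rho - lam^2) and the same identity for - lam. *)
Lemma ellipse_level (R : realType) (p lam X Y : R) : 0 < p -> `|lam| < 1 ->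
  0 < X ^+ 2 + Y ^+ 2 -> lam ^+ 2 < X ^+ 2 + Y ^+ 2 ->
  exists2 K, 0 < K &
    (p * (X * (1 + lam / (X ^+ 2 + Y ^+ 2)))) ^+ 2 / (p * (1 + lam)) ^+ 2 +
    (p * (Y * (1 - lam / (X ^+ 2 + Y ^+ 2)))) ^+ 2 / (p * (1 - lam)) ^+ 2 - 1 =
    K * (X ^+ 2 + Y ^+ 2 - 1).
Proof.
move=> p0; rewrite ltr_norml => /andP[l1 l2] rho0 rho1; set rho := X ^+ 2 + Y ^+ 2.
have m1 : 1 + lam != 0 by rewrite gt_eqF//; lra.
have m2 : 1 - lam != 0 by rewrite gt_eqF//; lra.
exists ((rho - lam ^+ 2) / rho ^+ 2 * (X ^+ 2 / (1 + lam) ^+ 2 + Y ^+ 2 / (1 - lam) ^+ 2)).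
  apply: mulr_gt0; first by rewrite divr_gt0 ?subr_gt0// exprn_gt0.
  rewrite lt_def addr_ge0 ?divr_ge0 ?sqr_ge0// andbT paddr_eq0 ?divr_ge0 ?sqr_ge0//.
  rewrite !mulf_eq0 !invr_eq0 !expf_eq0 (negbTE m1) (negbTE m2) /= !orbF !orbb.
  apply/negP => /andP[/eqP X0 /eqP Y0].
  by move: rho0; rewrite X0 Y0 !expr0n /= addr0 ltxx.
have r0 : rho != 0 by rewrite gt_eqF.
have p1 : p != 0 by rewrite gt_eqF.
transitivity (((X * (rho + lam)) ^+ 2 / (1 + lam) ^+ 2 + (Y * (rho - lam)) ^+ 2 / (1 - lam) ^+ 2
   - rho * (X ^+ 2 + Y ^+ 2)) / rho ^+ 2).
  by rewrite -/rho; move: rho r0 => r r0; field; rewrite r0 p1 m1 m2.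
by move: rho r0 => r r0; field; rewrite r0 m1 m2.
Qed.

(* U and V stand for u1 and its conjugate, so that h z = 1 / (2 * p * U). *)
Definition exterior_value (F : fieldType) (p l al U V : F) : F :=
  - (2 + al * l) * (1 / (2 * p * V)) + al * (1 / (2 * p * U))
  - al * (l * (p * (V + l / V)) - p * (U + l / U)
      + 2 * (p * (1 + l)) * (p * (1 - l)) * (1 / (2 * p * V)))
    * (- (1 / (2 * p * V)) / (p * (V - l / V))).

Definition interior_value (F : fieldType) (p l al z z' : F) : F :=
  1 / (p * (1 + l) * (p * (1 - l))) *
    ((- 1 - al * l) * z + (l + al / 2 + l ^+ 2 * (al / 2)) * z').

(** [A] and [B] are the means of [boundary_means_outside] with u2 = l / u1, and conjugation
    exchanges their arguments. Treating U and V as independent elements of a field makes this an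
    identity of rational functions. *)
Lemma exterior_value_means (F : fieldType) (p l al U V : F) :
  let A x y := y / x / (1 - l / x / x) *
    ((1 + l / y / y) * (l / x) - y^-1 - l / y * (l / x) ^+ 2) in
  let B x y := y / x / (1 - l / x / x) *
    ((1 + l / y / y) / x - y^-1 / x ^+ 2 - l / y) in
  2 != 0 :> F -> p != 0 -> 1 + l != 0 -> 1 - l != 0 -> U != 0 -> V != 0 ->
  U * U - l != 0 -> V * V - l != 0 ->
  1 / (p * (1 + l) * (p * (1 - l))) *
    ((p * A V U - p * l * B V U) - al / 2 * (p * A U V - p * l * B U V
      - p * l * A V U + p * B V U)) =
  exterior_value p l al U V.
Proof.
move=> A B n2 p0 l1 l2 U0 V0 UU VV; rewrite /exterior_value /A /B.
by field; rewrite n2 p0 l1 l2 U0 V0 UU VV.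
Qed.

(** U V = 1 expresses |u1| = 1, that is, z on the boundary. This agreement makes the gradient
    continuous across the ellipse. *)
Lemma exterior_value_on_circle (F : fieldType) (p l al U V : F) :
  2 != 0 :> F -> p != 0 -> 1 + l != 0 -> 1 - l != 0 -> U * V = 1 -> V * V - l != 0 ->
  interior_value p l al (p * (U + l / U)) (p * (V + l / V)) =
  exterior_value p l al U V.
Proof.
move=> n2 p0 l1 l2 UV VV.
have U0 : U != 0 by apply: contra_eq_neq UV => ->; rewrite mul0r eq_sym oner_eq0.
have V0 : V != 0 by apply: contra_eq_neq UV => ->; rewrite mulr0 eq_sym oner_eq0.
have -> : U = V^-1 by apply: (mulIf V0); rewrite UV mulVf.
rewrite /exterior_value /interior_value.
by rewrite !invrK; field; rewrite V0 VV p0 n2 l2 l1.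
Qed.

Section roots.
Context (R : realType) (alpha a b : R) (x : R * R) (u1 u2 : R[i]).
Hypotheses (a0 : 0 < a) (b0 : 0 < b).
Let p : R := (a + b) / 2.
Let lam : R := (a - b) / (a + b).
Hypothesis xE : toC x = p%:C%C * (u1 + u2).
Hypothesis u12 : u1 * u2 = lam%:C%C.
Hypothesis u21 : normc u2 <= normc u1.

Let p0 : 0 < p.
Proof. by rewrite /p divr_gt0// addr_gt0. Qed.

Let ab0 : a + b != 0. Proof. by rewrite gt_eqF// addr_gt0. Qed.

Let qE : p * lam = (a - b) / 2.
Proof. by rewrite /p /lam; field. Qed.

Let aE : a = p * (1 + lam).
Proof. by rewrite /p /lam; field. Qed.

Let bE : b = p * (1 - lam).
Proof. by rewrite /p /lam; field. Qed.

Let lam1 : `|lam| < 1.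
Proof.
have h1 : 0 < 1 + lam by rewrite -(pmulr_rgt0 _ p0) -aE.
have h2 : 0 < 1 - lam by rewrite -(pmulr_rgt0 _ p0) -bE.
by rewrite ltr_norml; move: lam h1 h2 => l h1 h2; apply/andP; split; lra.
Qed.

Let n12 : normc u1 * normc u2 = `|lam|.
Proof.
rewrite -ComplexField.Normc.normcM u12 normcE /= expr0n addr0 sqrtr_sqr//.
Qed.

(** The smaller of two roots whose product has modulus |lam| < 1. *)
Lemma small_root_lt1 : normc u2 < 1.
Proof.
rewrite ltNge; apply/negP => h; move: lam1; rewrite -n12 ltNge => /negP; apply.
by rewrite -[leLHS]mul1r ler_pM// (le_trans h).
Qed.

Lemma ellipse_level_roots : u1 != 0 -> exists2 K, 0 < K &
  x.1 ^+ 2 / a ^+ 2 + x.2 ^+ 2 / b ^+ 2 - 1 = K * (normc u1 ^+ 2 - 1).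
Proof.
move=> u10; rewrite normc_sqr.
have rho0 : 0 < Re u1 ^+ 2 + Im u1 ^+ 2.
  by rewrite -normc_sqr exprn_gt0// lt_def normc_ge0 normc_eq0 u10.
(* For lam nonzero, lam^2 < |lam| = |u1| |u2| <= |u1|^2. *)
have rho1 : lam ^+ 2 < Re u1 ^+ 2 + Im u1 ^+ 2.
  have [l0|l0] := eqVneq lam 0; first by rewrite l0 expr0n.
  apply: (@lt_le_trans _ _ `|lam|).
    by rewrite -(real_normK (num_real lam)) expr2 gtr_pMr// normr_gt0.
  by rewrite -normc_sqr -n12 expr2 ler_wpM2l// normc_ge0.
have [K K0 KE] := ellipse_level p0 lam1 rho0 rho1.
exists K => //; rewrite -KE -aE -bE.
(* That is, u2 = lam / u1 = lam conj u1 / |u1|^2, which brings x to the form used in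
   [ellipse_level]. *)
have u2E : u2 * (Re u1 ^+ 2 + Im u1 ^+ 2)%:C%C = lam%:C%C * conjc u1.
  by rewrite -normc_sqr -mulcJ -u12; ring.
move: (xE) u2E rho0 {KE u10 rho1}; move: (x) (u1) (u2) => [x1 x2] [X Y] [X2 Y2] /=.
move=> /eqP; rewrite eq_complex /= => /andP[/eqP -> /eqP ->].
move=> /eqP; rewrite eq_complex /= => /andP[/eqP E1 /eqP E2] r0.
have n0 : X ^+ 2 + Y ^+ 2 != 0 by rewrite gt_eqF.
have -> : X2 = lam * X / (X ^+ 2 + Y ^+ 2).
  by apply: (mulIf n0); rewrite divfK//; lra.
have -> : Y2 = - (lam * Y / (X ^+ 2 + Y ^+ 2)).
  by apply: (mulIf n0); rewrite mulNr divfK//; lra.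
by congr (_ ^+ 2 / _ + _ ^+ 2 / _ - _); field.
Qed.

Lemma Omega_root : Omega a b x <-> normc u1 < 1.
Proof.
rewrite /Omega /=; have [u10|u10] := eqVneq u1 0.
  (* If the larger root is 0 then so is the other one, and x is the centre of the ellipse. *)
  have u20 : u2 = 0.
    by apply/eqP; rewrite -normc_eq0 eq_le normc_ge0 andbT (le_trans u21)// u10 ComplexField.Normc.normc0.
  move: xE; rewrite u10 u20 addr0 mulr0 => /eqP; rewrite toC_eq0 => /eqP ->.
  by rewrite ComplexField.Normc.normc0 /= expr0n !mul0r addr0.
have [K K0 KE] := ellipse_level_roots u10.
rewrite -subr_lt0 KE pmulr_rlt0// subr_lt0 -[X in _ <-> _ < X](expr1n R 2).
by rewrite -[X in _ < X](expr1n R 2) ltr_pXn2r// ?nnegrE ?normc_ge0// expr1n.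
Qed.

Let aC : a%:C%C = p%:C%C * (1 + lam%:C%C) :> R[i].
Proof. by rewrite {1}aE rmorphM rmorphD. Qed.

Let bC : b%:C%C = p%:C%C * (1 - lam%:C%C) :> R[i].
Proof. by rewrite {1}bE rmorphM rmorphB. Qed.

Let pC0 : p%:C%C != 0 :> R[i].
Proof. by rewrite fmorph_eq0 gt_eqF. Qed.

Let l1C : 1 + lam%:C%C != 0 :> R[i].
Proof.
have : a%:C%C != 0 :> R[i] by rewrite fmorph_eq0 gt_eqF.
by rewrite aC mulf_eq0 negb_or => /andP[].
Qed.

Let l2C : 1 - lam%:C%C != 0 :> R[i].
Proof.
have : b%:C%C != 0 :> R[i] by rewrite fmorph_eq0 gt_eqF.
by rewrite bC mulf_eq0 negb_or => /andP[].
Qed.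

Let gE (k : R[i]) :
  (fun t => conj_ratio k (x - (a * cos t, b * sin t))) =
  (fun t => let w := p%:C%C * (u1 + u2 - unit_circle t - u1 * u2 * conjc (unit_circle t)) in
    if w == 0 then k else conjc w / w).
Proof.
apply/funext => t; rewrite /conj_ratio -toC_eq0.
suff -> : toC (x - (a * cos t, b * sin t)) =
  p%:C%C * (u1 + u2 - unit_circle t - u1 * u2 * conjc (unit_circle t)) by [].
rewrite toCB xE u12; transitivity (p%:C%C * (u1 + u2) -
  p%:C%C * (unit_circle t + lam%:C%C * conjc (unit_circle t))); last by ring.
congr (_ - _).
rewrite [in LHS]aE [in LHS]bE; apply/eqP; rewrite eq_complex /=.
by apply/andP; split; apply/eqP; ring.
Qed.

Let TgE (T : (R -> R[i]) -> R[i]) (k : R[i]) (f : R -> R[i]) :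
  T (fun t => f t * conj_ratio k (x - (a * cos t, b * sin t))) =
  T (fun t => f t * (let w := p%:C%C * (u1 + u2 - unit_circle t - u1 * u2 * conjc (unit_circle t)) in
    if w == 0 then k else conjc w / w)).
Proof.
by congr T; apply/funext => t; congr (_ * _); exact: (congr1 (@^~ t) (gE k)).
Qed.

Let prodR : conjc (u1 * u2) = u1 * u2.
Proof. by rewrite u12 conjc_real. Qed.

Let normalized_means (k A B : R[i]) :
  contC (fun t => conj_ratio k (x - (a * cos t, b * sin t))) ->
  (forall T, circle_mean T ->
     T (fun t => unit_circle t * conj_ratio k (x - (a * cos t, b * sin t))) = A) ->
  (forall T, circle_mean T ->
     T (fun t => conjc (unit_circle t) * conj_ratio k (x - (a * cos t, b * sin t))) = B) ->
  (1 / (pi * a * b))%:C%C * convolutionC (gradW_kernel alpha) \1_(Omega a b) x =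
  1 / (p%:C%C * (1 + lam%:C%C) * (p%:C%C * (1 - lam%:C%C))) *
    (p%:C%C * conjc A - p%:C%C * lam%:C%C * conjc B
     - alpha%:C%C / 2 * (p%:C%C * A - p%:C%C * lam%:C%C * B
         - p%:C%C * lam%:C%C * conjc A + p%:C%C * conjc B)).
Proof.
move=> cg TA TB; rewrite (convolution_gradW_of_means alpha a0 b0 cg TA TB) -qE -/p.
have -> : 1 / (pi * a * b) = 1 / (a * b) / pi :> R.
  by rewrite !div1r -mulrA invfM mulrC.
have cM (y w : R) : (y * w)%:C%C = y%:C%C * w%:C%C by rewrite rmorphM.
have cpi (y : R) (Z : R[i]) : (y / pi)%:C%C * (pi%:C%C * Z) = y%:C%C * Z.
  by rewrite mulrA -cM divfK ?gt_eqF ?pi_gt0.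
rewrite cpi.
have -> : (1 / (a * b))%:C%C = 1 / (a%:C%C * b%:C%C) by rewrite !div1r -cM; exact: fmorphV.
have -> : (alpha / 2)%:C%C = alpha%:C%C / 2.
  by rewrite cM; congr (_ * _); rewrite -(rmorph_nat (@real_complex R) 2); exact: fmorphV.
by rewrite aC bC cM conjcD conjcN !conjcM !conjc_real.
Qed.

(** The case |u1| = 1 is included, so that this formula and that of [gradW_outer] both hold on the
    boundary. The mean of g / u vanishes, which leaves an expression linear in u1 + u2 and its
    conjugate. *)
Lemma gradW_inner : normc u1 <= 1 ->
  (1 / (pi * a * b))%:C%C * convolutionC (gradW_kernel alpha) \1_(Omega a b) x =
  interior_value p%:C%C lam%:C%C alpha%:C%C (toC x) (conjc (toC x)).
Proof.
move=> n1; pose A := u1 * u2 * (u1 + u2) - conjc (u1 + u2).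
have [k [cg TA TB]] : exists k : R[i],
    [/\ contC (fun t => conj_ratio k (x - (a * cos t, b * sin t))),
      forall T, circle_mean T ->
        T (fun t => unit_circle t * conj_ratio k (x - (a * cos t, b * sin t))) = A
    & forall T, circle_mean T ->
        T (fun t => conjc (unit_circle t) * conj_ratio k (x - (a * cos t, b * sin t))) = 0].
  have n2 := small_root_lt1.
  have p1 : p != 0 by rewrite gt_eqF.
  have mc := circle_mean_half_turn R.
  move: n1; rewrite le_eqVlt => /orP[/eqP n1|n1].
    exists (- conjc u1 * (conjc u1 - conjc u2) / (1 - u2 * conjc u1)).
    set k := (X in conj_ratio X).
    split=> [|T mT|T mT].
    + by rewrite gE; case: (boundary_means_on mc p1 prodR n1 n2 (erefl k)).
    + by rewrite TgE; case: (boundary_means_on mT p1 prodR n1 n2 (erefl k)).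
    + by rewrite TgE; case: (boundary_means_on mT p1 prodR n1 n2 (erefl k)).
  exists 0; split=> [|T mT|T mT].
  + by rewrite gE; case: (boundary_means_inside mc 0 p1 prodR n1 n2).
  + by rewrite TgE; case: (boundary_means_inside mT 0 p1 prodR n1 n2).
  + by rewrite TgE; case: (boundary_means_inside mT 0 p1 prodR n1 n2).
rewrite (normalized_means cg TA TB) /A u12 xE.
have JE (y : R) (s : R[i]) : conjc (y%:C%C * s) = y%:C%C * conjc s.
  by rewrite conjcM conjc_real.
rewrite JE (_ : conjc (lam%:C%C * (u1 + u2) - conjc (u1 + u2)) =
  lam%:C%C * conjc (u1 + u2) - (u1 + u2)); last first.
  by rewrite (conjcD (lam%:C%C * (u1 + u2))) conjcN JE conjcK.
rewrite (_ : conjc 0 = 0) ?conjc0//.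
move: (u1 + u2) (conjc (u1 + u2)) => s s'; rewrite /interior_value.
move: l1C l2C pC0; move: (lam%:C)%C (p%:C)%C (alpha%:C)%C => l P al k1 k2 P0.
by field; rewrite k1 k2 P0.
Qed.

Lemma gradW_outer : 1 <= normc u1 ->
  (1 / (pi * a * b))%:C%C * convolutionC (gradW_kernel alpha) \1_(Omega a b) x =
  exterior_value p%:C%C lam%:C%C alpha%:C%C u1 (conjc u1).
Proof.
move=> n1; have n2 := small_root_lt1.
have U0 : u1 != 0 by rewrite -normc_eq0 gt_eqF// (lt_le_trans ltr01).
have V0 : conjc u1 != 0 by rewrite -normc_eq0 normcJ normc_eq0.
have u2E : u2 = lam%:C%C / u1 by rewrite -u12 mulrAC divff// mul1r.
have u2J : conjc u2 = lam%:C%C / conjc u1.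
  by rewrite u2E conjcM conjc_real conjc_inv.
have UU : u1 * u1 - lam%:C%C != 0.
  apply/eqP => /subr0_eq; rewrite -u12 => /(mulfI U0) E.
  by move: n1; rewrite E leNgt n2.
have VV : conjc u1 * conjc u1 - lam%:C%C != 0.
  have -> : conjc u1 * conjc u1 - lam%:C%C = conjc (u1 * u1 - lam%:C%C).
    by rewrite conjcD conjcN conjcM conjc_real.
  by rewrite -normc_eq0 normcJ normc_eq0.
move: n1; rewrite le_eqVlt => /orP[/eqP n1|n1].
  rewrite gradW_inner -?n1// xE conjcM conjcD conjc_real u2J u2E.
  by apply: exterior_value_on_circle => //; rewrite mulcJ -n1 expr1n.
have p1 : p != 0 by rewrite gt_eqF.
have mc := circle_mean_half_turn R.
pose A := conjc u1 / u1 / (1 - u2 / u1) *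
  ((1 + conjc u2 / conjc u1) * u2 - (conjc u1)^-1 - conjc u2 * u2 ^+ 2).
pose B := conjc u1 / u1 / (1 - u2 / u1) *
  ((1 + conjc u2 / conjc u1) / u1 - (conjc u1)^-1 / u1 ^+ 2 - conjc u2).
rewrite (@normalized_means 0 A B).
- rewrite -exterior_value_means// /A /B.
  rewrite !(conjcM, conjcD, conjcN, conjc_inv, rmorphXn, conjcK, rmorph1) u2J u2E.
  by [].
- by rewrite gE; case: (boundary_means_outside mc 0 p1 n1 n2).
- by move=> T mT; rewrite TgE; case: (boundary_means_outside mT 0 p1 n1 n2).
- by move=> T mT; rewrite TgE; case: (boundary_means_outside mT 0 p1 n1 n2).
Qed.

End roots.

(** * The branch of the square root *)

Lemma contC_atP (R : realType) (F : R -> R[i]) (t : R) :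
  contC_at F t <-> (F : R -> R[i]^o) @ t --> (F t : R[i]^o).
Proof.
have nE (y : R[i]) : `|y| = (normc y)%:C%C by [].
have FF := nbhs_filter t; split.
  move=> [c1 c2]; apply: (proj2 (@cvgrPdist_lt _ R[i]^o _ _ FF _ _)) => e e0.
  have [e1 e2] : Im e = 0 /\ 0 < Re e.
    by move: e0; rewrite ltcE /= => /andP[/eqP -> ->].
  have -> : e = (Re e)%:C%C by move: e1; case: (e) => ? ? /= ->.
  have d0 : 0 < Re e / 2 by rewrite divr_gt0.
  have h1 := proj1 (@cvgrPdist_lt R R^o _ _ FF _ _) c1 _ d0.
  have h2 := proj1 (@cvgrPdist_lt R R^o _ _ FF _ _) c2 _ d0.
  near=> r; rewrite nE ltcR; apply: (le_lt_trans (le_normc_ReIm _)).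
  rewrite ReD ImD [ltRHS]splitr; apply: ltrD.
    by near: r; move: h1; apply: filterS => r; rewrite (raddfN (@complex.Re R)).
  by near: r; move: h2; apply: filterS => r; rewrite (raddfN (@complex.Im R)).
move=> cF; have h e : 0 < e -> \forall r \near t, normc (F t - F r) < e.
  move=> e0; have e0' : 0 < e%:C%C :> R[i] by rewrite ltcR.
  have := proj1 (@cvgrPdist_lt _ R[i]^o _ _ FF _ _) cF _ e0'.
  by apply: filterS => r; rewrite nE ltcR.
split.
  apply: (proj2 (@cvgrPdist_lt R R^o _ _ FF _ _)) => e e0; move: (h _ e0).
  apply: filterS => r; apply: le_lt_trans.
  by apply: le_trans (normRe_le_normc _); rewrite raddfB.
apply: (proj2 (@cvgrPdist_lt R R^o _ _ FF _ _)) => e e0; move: (h _ e0).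
apply: filterS => r; apply: le_lt_trans.
by apply: le_trans (normIm_le_normc _); rewrite raddfB.
Unshelve. all: by end_near. Qed.

Lemma contC_at_holo (R : realType) (f : R[i] -> R[i]) (F : R -> R[i]) (t : R) :
  holo_at f (F t) -> contC_at F t -> contC_at (fun t => f (F t)) t.
Proof.
move=> hf /contC_atP cF; apply/contC_atP.
have df := proj1 (@derivable1_diffP R[i] R[i]^o (f : R[i]^o -> R[i]^o) (F t)) hf.
have cf := differentiable_continuous df.
exact: (@cvg_comp _ _ _ (F : R -> R[i]^o) (f : R[i]^o -> R[i]^o) _ _ _ cF cf).
Qed.

Section sqrt_branch.
Context (R : realType) (c : R) (s : R[i] -> R[i]).
Hypotheses (c0 : 0 <= c) (sP : is_sqrt_branch c s).

Lemma off_slit_neq0 z : ~ slit c z -> z != 0.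
Proof. by apply: contra_not_neq => ->; split => //=; rewrite oppr_le0 c0. Qed.

(** A ray from a point off the slit to infinity stays off it, so the branch can be followed along
    the ray. *)
Lemma off_slit_scale z (t : R) : ~ slit c z -> 1 <= t -> ~ slit c (t%:C%C * z).
Proof.
move=> sz t1 [] ; rewrite ReM ImM /= !mul0r subr0 addr0 => /eqP.
have t0 : 0 < t by rewrite (lt_le_trans ltr01).
rewrite mulf_eq0 gt_eqF//= => /eqP z0 zc; apply: sz; split => //.
move: zc; rewrite -!ler_norml normrM gtr0_norm//; apply: le_trans.
by rewrite ler_peMl.
Qed.

Lemma off_slit_conj z : ~ slit c z -> ~ slit c (conjc z).
Proof.
move=> sz [] /=; case: z sz => X Y /= sz X0; rewrite lerNl opprK andbC lerNl => XY.
by apply: sz; split.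
Qed.

Lemma branch_sqr z : ~ slit c z -> s z ^+ 2 = z ^+ 2 + (c ^+ 2)%:C%C.
Proof. by case: sP => _ sq _ /sq. Qed.

(** If s z = i r z with r real, then squaring gives (1 + r^2) z^2 = - c^2, which puts z on the
    slit. *)
Lemma Re_branch_neq0 z : ~ slit c z -> Re (s z / z) != 0.
Proof.
move=> sz; apply/eqP => r0; have z0 := off_slit_neq0 sz; have sq := branch_sqr sz; apply: sz.
have sE : s z = Complex 0 (Im (s z / z)) * z.
  rewrite -[LHS](divfK z0); congr (_ * _).
  by move: r0; case: (s z / z) => ? ? /= ->.
move: sq; rewrite sE; move: (Im (s z / z)) => r {sE r0 z0}.
case: z => X Y; rewrite !expr2 => /eqP; rewrite eq_complex /= => /andP[/eqP E1 /eqP E2].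
have r1 : 0 < 1 + r * r by rewrite ltr_pwDl// -expr2 sqr_ge0.
have : (1 + r * r) * (X * Y) = 0 by lra.
have E3 : (1 + r * r) * (Y * Y) = c * c + (1 + r * r) * (X * X) by lra.
move=> /eqP; rewrite !mulf_eq0 (gt_eqF r1) /= => XY.
have X0 : X = 0.
  case/orP: XY => /eqP // Y0; apply/eqP; rewrite -sqrf_eq0 eq_le sqr_ge0 andbT expr2.
  rewrite -(pmulr_rle0 _ r1); move: E3; rewrite Y0 !mulr0 => E3.
  by have := sqr_ge0 c; rewrite expr2; lra.
split => //=; rewrite -ler_norml -(ger0_norm c0) -ler_sqr ?nnegrE//.
rewrite !real_normK ?num_real// !expr2; move: E3; rewrite X0 !mulr0 addr0 => <-.
by rewrite -expr2 ler_peMl ?sqr_ge0// lerDl -expr2 sqr_ge0.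
Qed.

Let ray_continuous z (t : R) : ~ slit c z -> 1 <= t ->
  {for t, continuous (fun t : R => Re (s (t%:C%C * z) / (t%:C%C * z)))}.
Proof.
move=> sz t1; have st := off_slit_scale sz t1.
have ct : contC_at (fun t : R => t%:C%C * z) t.
  apply: contC_atM; last exact: contC_at_cst.
  by split; [exact: cvg_id|exact: (@cst_continuous R R 0 t)].
have hs : holo_at s (t%:C%C * z) by case: sP => + _ _; apply.
have n0 := off_slit_neq0 st.
by case: (contC_atM (@contC_at_holo R s (fun t => t%:C%C * z) t hs ct) (contC_atV ct n0)).
Qed.

(* Along the ray from z to infinity, Re (s / z) cannot vanish and is positive *)
(* in the end. *)
Lemma Re_branch_gt0 z : ~ slit c z -> 0 < Re (s z / z).
Proof.
move=> sz; have z0 := off_slit_neq0 sz; have nz0 : 0 < normc z.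
  by rewrite lt_def normc_eq0 z0 normc_ge0.
have [_ _ /(_ 1 ltr01)[M HM]] := sP.
(* T |z| = |z| + |M| exceeds M, so at T z the ratio is within 1 of 1 and has positive real part. *)
pose T := 1 + `|M| / normc z.
have T1 : 1 <= T by rewrite lerDl divr_ge0// normc_ge0.
have RT : 0 < Re (s (T%:C%C * z) / (T%:C%C * z)).
  have : M%:C%C < `|T%:C%C * z|.
    rewrite normrM [`|z|](_ : _ = (normc z)%:C%C)// ger0_norm; last first.
      by rewrite lecR (le_trans ler01).
    rewrite -rmorphM ltcR /T mulrDl mul1r divfK ?gt_eqF//.
    by rewrite (le_lt_trans (ler_norm M))// ltrDr.
  move=> /HM; rewrite ltcR => h; have := le_lt_trans (normRe_le_normc _) h.
  rewrite raddfB /= ltr_norml => /andP[+ _].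
  by move: (Re _) => r; lra.
rewrite ltNge; apply/negP => neg.
have f1 : (1 : R)%:C%C * z = z by rewrite mul1r.
have cw : {within `[1, T], continuous (fun t : R => Re (s (t%:C%C * z) / (t%:C%C * z)))}.
  apply: continuous_in_subspaceT => t; rewrite inE/= in_itv/= => /andP[t1 _].
  exact: ray_continuous.
have [|t] := @IVT R _ 1 T 0 T1 cw.
  by rewrite f1 ge_min neg /= le_max (ltW RT) orbT.
rewrite in_itv/= => /andP[t1 _] /eqP; apply/negP.
by apply: Re_branch_neq0; exact: off_slit_scale.
Qed.

Lemma branch_neq0 z : ~ slit c z -> s z != 0.
Proof.
by move=> /Re_branch_gt0; apply: contraTneq => ->; rewrite mul0r ltxx.
Qed.

Lemma branch_add_neq0 z : ~ slit c z -> z + s z != 0.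
Proof.
move=> sz; have := Re_branch_gt0 sz; apply: contraTneq => zs.
have -> : s z = - z by apply/eqP; rewrite -addr_eq0 addrC zs.
by rewrite mulNr divff ?off_slit_neq0//= ltrNr oppr0 ltr10.
Qed.

(** |1 - q| < |1 + q| as soon as Re q > 0, here for q = s z / z. It makes (z + s z) / (2 p) the
    larger root. *)
Lemma branch_normc_lt z : ~ slit c z -> normc (z - s z) < normc (z + s z).
Proof.
move=> sz; have z0 := off_slit_neq0 sz; have := Re_branch_gt0 sz.
have -> : z - s z = z * (1 - s z / z) by rewrite mulrBr mulr1 mulrC divfK.
have -> : z + s z = z * (1 + s z / z) by rewrite mulrDr mulr1 mulrC divfK.
rewrite !ComplexField.Normc.normcM => r0.
rewrite ltr_pM2l; last by rewrite lt_def normc_eq0 z0 normc_ge0.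
rewrite -ltr_sqr ?nnegrE ?normc_ge0// !normc_sqr; case: (s z / z) r0 => X Y /= X0.
by rewrite !expr2; lra.
Qed.

(** Both sides have the same square, and [Re_branch_gt0] excludes the opposite sign. *)
Lemma branch_conj z : ~ slit c z -> s (conjc z) = conjc (s z).
Proof.
move=> sz; have sj := off_slit_conj sz; have z0 := off_slit_neq0 sz.
have : s (conjc z) ^+ 2 = conjc (s z) ^+ 2.
  have cX (y : R[i]) : conjc (y ^+ 2) = conjc y ^+ 2 by rewrite rmorphXn.
  apply: (etrans (branch_sqr sj)); rewrite -cX -(cX (s z)).
  by have -> := branch_sqr sz; rewrite conjcD conjc_real.
move=> /eqP; rewrite eqf_sqr => /orP[/eqP//|/eqP E].
have := Re_branch_gt0 sj; rewrite E; have := Re_branch_gt0 sz.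
have -> : - conjc (s z) / conjc z = - conjc (s z / z).
  by rewrite mulNr conjcM conjc_inv.
case: (s z / z) => X Y /= X0; rewrite oppr_gt0 => X1.
by have := lt_trans X0 X1; rewrite ltxx.
Qed.

End sqrt_branch.

Section branch_derivative.
Context (R : realType) (c : R) (s : R[i] -> R[i]).
Hypotheses (c0 : 0 <= c) (sP : is_sqrt_branch c s).

Lemma off_slit_near (w : R[i]) : ~ slit c w ->
  \forall z \near (w : R[i]^o), ~ slit c (z : R[i]).
Proof.
move=> sw.
suff [e e0 He] : exists2 e : R, 0 < e & forall z, normc (w - z) < e -> ~ slit c z.
  have e0' : 0 < e%:C%C :> R[i] by rewrite ltcR.
  have h := proj1 (@cvgrPdist_lt _ R[i]^o _ _ (nbhs_filter (w : R[i]^o)) id w) cvg_id _ e0'.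
  by apply: filterS h => z; rewrite ltcR => /He.
have [w1|w1] := eqVneq (Re w) 0; last first.
  exists `|Re w|; first by rewrite normr_gt0.
  move=> z h [z1 _]; have := le_lt_trans (normRe_le_normc _) h.
  by rewrite raddfB /= z1 subr0 ltxx.
have w2 : c < `|Im w| by rewrite ltNge ler_norml; apply/negP => h; apply: sw.
exists (`|Im w| - c); first by rewrite subr_gt0.
move=> z h [_]; rewrite -ler_norml => z1.
have := le_lt_trans (normIm_le_normc _) h; rewrite raddfB /=.
have := ler_normD (Im w - Im z) (Im z); rewrite subrK.
by move: z1; move: `|_| `|_| `|_| => r1 r2 r3; lra.
Qed.

(** Differentiating s^2 = z^2 + c^2, which holds near w, gives 2 s s' = 2 z. *)
Lemma derive_branch (w : R[i]) : ~ slit c w ->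
  is_derive (w : R[i]^o) (1 : R[i]^o) (s : R[i]^o -> R[i]^o) (w / s w).
Proof.
move=> sw; have hs : holo_at s w by case: sP => + _ _; apply.
have ds : is_derive (w : R[i]^o) (1 : R[i]^o) (s : R[i]^o -> R[i]^o) ('D_1 (s : R[i]^o -> R[i]^o) w).
  exact: DeriveDef.
suff <- : 'D_1 (s : R[i]^o -> R[i]^o) w = w / s w by [].
have d1 := is_deriveD (is_deriveX 2 (is_derive_id (w : R[i]^o) (1 : R[i]^o)))
  (is_derive_cst ((c ^+ 2)%:C%C : R[i]^o) (w : R[i]^o) (1 : R[i]^o)).
have d2 := is_deriveX 2 ds.
have nE : \forall z \near (w : R[i]^o), ((s : R[i]^o -> R[i]^o) ^+ 2) z =
    ((@id (R[i]^o)) ^+ 2 + cst ((c ^+ 2)%:C%C : R[i]^o)) z.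
  by have := off_slit_near sw; apply: filterS => z sz; exact: (branch_sqr sP sz).
have := @derive_val _ _ _ _ _ _ _ (near_eq_is_derive nE d2); have -> := @derive_val _ _ _ _ _ _ _ d1.
rewrite addr0 !expr1 /GRing.scale /= mulr1 -!mulrA => E.
have {}E := mulfI _ E.
rewrite {2}E ?pnatr_eq0// mulrAC divff ?mul1r//; exact: (branch_neq0 c0 sP).
Qed.

(** Differentiate h (z + s) = 1 and use 1 + s' = (z + s) / s. *)
Lemma cderiv_inv_add_branch (w : R[i]) : ~ slit c w ->
  cderiv (fun z => 1 / (z + s z)) w = - (1 / (w + s w)) / s w.
Proof.
move=> sw; have s0 := branch_neq0 c0 sP sw; have a0 := branch_add_neq0 c0 sP sw.
have d1 := is_deriveD (is_derive_id (w : R[i]^o) (1 : R[i]^o)) (derive_branch sw).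
set h := fun z : R[i] => 1 / (z + s z).
pose h' : R[i]^o -> R[i]^o := h.
have dh : derivable h' w 1.
  apply: derivableM; first exact: derivable_cst.
  by apply: derivableV; [exact: a0|case: d1].
have d2 := is_deriveM d1 (DeriveDef dh erefl).
have nE : \forall z \near (w : R[i]^o),
    (((@id (R[i]^o)) + (s : R[i]^o -> R[i]^o)) * h') z = cst (1 : R[i]^o) z.
  have := off_slit_near sw; apply: filterS => z sz.
  by rewrite /= /h' /h [LHS]mulrC divfK//; exact: (branch_add_neq0 c0 sP).
have := @derive_val _ _ _ _ _ _ _ (near_eq_is_derive nE d2).
rewrite derive_cst /cderiv derive1E -/h' => /eqP.
rewrite eq_sym addr_eq0 => /eqP; rewrite /GRing.scale /= => E.
apply: (mulfI a0); rewrite E /h' /h.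
by field; rewrite s0 a0.
Qed.

End branch_derivative.

Lemma contC_at_conj (R : realType) (F : R -> R[i]) t : contC_at F t ->
  contC_at (fun t => conjc (F t)) t.
Proof.
move=> [c1 c2]; split.
  rewrite (_ : (fun t => _) = (fun t => Re (F t)))//.
  by apply/funext => r; case: (F r).
rewrite (_ : (fun t => _) = (fun t => - Im (F t))); first exact: continuousN.
by apply/funext => r; case: (F r).
Qed.

(** Gluing at a boundary point: near t the function follows one of two continuous functions, and
    both agree with it at t. *)
Lemma contC_at_cases (R : realType) (F1 F2 F : R -> R[i]) t :
  contC_at F1 t -> contC_at F2 t -> F t = F1 t -> F t = F2 t ->
  (\forall r \near t, F r = F1 r \/ F r = F2 r) -> contC_at F t.
Proof.
move=> /contC_atP c1 /contC_atP c2 E1 E2 E; apply/contC_atP.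
have FF := nbhs_filter t.
apply: (proj2 (@cvgrPdist_lt _ R[i]^o _ _ FF _ _)) => e e0.
have h1 := proj1 (@cvgrPdist_lt _ R[i]^o _ _ FF _ _) c1 _ e0.
have h2 := proj1 (@cvgrPdist_lt _ R[i]^o _ _ FF _ _) c2 _ e0.
apply: filterS3 h1 h2 E => r d1 d2 [->|->]; first by rewrite E1.
by rewrite E2.
Qed.

Lemma contC_at_normc_gt (R : realType) (F : R -> R[i]) t (y : R) :
  contC_at F t -> y < normc (F t) -> \forall r \near t, y < normc (F r).
Proof.
move=> /contC_atP cF yF; have FF := nbhs_filter t.
have e0 : 0 < (normc (F t) - y)%:C%C :> R[i] by rewrite ltcR subr_gt0.
have h := proj1 (@cvgrPdist_lt _ R[i]^o _ _ FF _ _) cF _ e0.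
apply: filterS h => r; rewrite ltcR => h.
have := le_normcD (F t - F r) (F r); rewrite subrK.
by move: h; move: (normc _) (normc _) (normc _) => r1 r2 r3; lra.
Qed.

(** * The gradient of the potential *)

Section potential_of_ellipse.
Context (R : realType) (alpha a b c : R) (s : R[i] -> R[i]).
Hypotheses (a0 : 0 < a) (le_ab : a <= b) (c0 : 0 <= c)
  (c2E : c ^+ 2 = b ^+ 2 - a ^+ 2) (sP : is_sqrt_branch c s).
Let p : R := (a + b) / 2.
Let lam : R := (a - b) / (a + b).
Let b0 : 0 < b. Proof. exact: lt_le_trans le_ab. Qed.

Let p0 : 0 < p. Proof. by rewrite /p divr_gt0// addr_gt0. Qed.
Let P : R[i] := p%:C%C.
Let L : R[i] := lam%:C%C.
Let al : R[i] := alpha%:C%C.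
Let P0 : P != 0. Proof. by rewrite fmorph_eq0 gt_eqF. Qed.

(** Hence z^2 + c^2 is the discriminant of p U^2 - z U + p lam, whose roots are u1 and u2. *)
Let c2C : (c ^+ 2)%:C%C = - (4 * P ^+ 2 * L).
Proof.
have -> : c ^+ 2 = - (4 * p ^+ 2 * lam).
  by rewrite c2E /p /lam; field; rewrite gt_eqF// addr_gt0.
by rewrite /P /L !(rmorphN, rmorphM, rmorphXn, rmorph_nat).
Qed.

Lemma slit_Omega x : slit c (toC x) -> Omega a b x.
Proof.
move=> [/= x1 x2]; rewrite /Omega /= x1 expr0n mul0r add0r.
rewrite ltr_pdivrMr ?exprn_gt0// mul1r; apply: (@le_lt_trans _ _ (c ^+ 2)).
  rewrite -(real_normK (num_real x.2)) ler_sqr ?nnegrE//.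
  by rewrite ler_norml.
by rewrite c2E gtrBl exprn_gt0.
Qed.

Let root1 (z : R[i]) : R[i] := (z + s z) / (2 * P).
Let root2 (z : R[i]) : R[i] := (z - s z) / (2 * P).

Let n2 : 2 != 0 :> R[i]. Proof. by rewrite pnatr_eq0. Qed.

Let roots_of (z w : R[i]) : w ^+ 2 = z ^+ 2 + (c ^+ 2)%:C%C ->
  z = P * ((z + w) / (2 * P) + (z - w) / (2 * P)) /\
  (z + w) / (2 * P) * ((z - w) / (2 * P)) = L.
Proof.
rewrite c2C => w2; split; first by field; rewrite P0.
transitivity ((z ^+ 2 - w ^+ 2) / (4 * P ^+ 2)); first by field; rewrite P0.
by rewrite w2; field; rewrite P0.
Qed.

Let branch_roots z : ~ slit c z ->
  [/\ z = P * (root1 z + root2 z), root1 z * root2 z = L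
    & normc (root2 z) <= normc (root1 z)].
Proof.
move=> sz; have [h1 h2] := roots_of (branch_sqr sP sz); split=> //.
rewrite /root1 /root2 !ComplexField.Normc.normcM ler_wpM2r ?normc_ge0//.
exact/ltW/(branch_normc_lt c0 sP sz).
Qed.

(** The ellipse contains the slit, where the values of [s] are free. So for interior points any
    square root is taken and the roots are ordered by modulus. *)
Let exists_roots (z : R[i]) : exists u1 u2 : R[i],
  [/\ z = P * (u1 + u2), u1 * u2 = L & normc u2 <= normc u1].
Proof.
have [h1 h2] := roots_of (sqr_sqrtc (z ^+ 2 + (c ^+ 2)%:C%C)).
move: h1 h2; set u1 := (X in P * (X + _)); set u2 := (X in P * (_ + X)) => h1 h2.
have [n12|/ltW n21] := leP (normc u2) (normc u1); first by exists u1, u2.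
by exists u2, u1; split=> //; [rewrite addrC|rewrite mulrC].
Qed.

Let G (x : R * R) : R[i] :=
  (1 / (pi * a * b))%:C%C * convolutionC (gradW_kernel alpha) (\1_(Omega a b)) x.

Lemma gradW_Omega x : Omega a b x ->
  G x = interior_value P L al (toC x) (conjc (toC x)).
Proof.
move=> xO; have [u1 [u2 [h1 h2 h3]]] := exists_roots (toC x).
by apply: (gradW_inner alpha a0 b0 h1 h2 h3); apply/ltW/(Omega_root a0 b0 h1 h2 h3).
Qed.

Lemma gradW_Omega_compl x : ~ Omega a b x ->
  1 <= normc (root1 (toC x)) /\
  G x = exterior_value P L al (root1 (toC x)) (conjc (root1 (toC x))).
Proof.
move=> xO; have sx : ~ slit c (toC x) by move=> /slit_Omega.
have [h1 h2 h3] := branch_roots sx.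
have n1 : 1 <= normc (root1 (toC x)).
  by rewrite leNgt; apply/negP => /(Omega_root a0 b0 h1 h2 h3).
by split=> //; exact: (gradW_outer alpha a0 b0 h1 h2 h3).
Qed.

Let contC_at_interior (F : R -> R[i]) t : contC_at F t ->
  contC_at (fun t => interior_value P L al (F t) (conjc (F t))) t.
Proof.
move=> cF; have cJ := contC_at_conj cF.
exact: (contC_atZ _ (contC_atD (contC_atZ _ cF) (contC_atZ _ cJ))).
Qed.

Let contC_at_exterior (F : R -> R[i]) t : contC_at F t ->
  F t != 0 -> conjc (F t) - L / conjc (F t) != 0 ->
  contC_at (fun t => exterior_value P L al (F t) (conjc (F t))) t.
Proof.
move=> cF F0 FL; have cJ := contC_at_conj cF.
have J0 : conjc (F t) != 0 by rewrite -normc_eq0 normcJ normc_eq0.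
have cV := contC_atZ L (contC_atV cF F0).
have cVJ := contC_atZ L (contC_atV cJ J0).
have n0 y : y != 0 -> 2 * P * y != 0 by move=> y0; rewrite !mulf_neq0.
have ch := contC_atZ 1 (contC_atV (contC_atZ (2 * P) cF) (n0 _ F0)).
have chJ := contC_atZ 1 (contC_atV (contC_atZ (2 * P) cJ) (n0 _ J0)).
have d0 : P * (conjc (F t) - L / conjc (F t)) != 0 by rewrite mulf_neq0.
have cd := contC_atV (contC_atZ P (contC_atB cJ cVJ)) d0.
have cm := contC_atB (contC_atZ L (contC_atZ P (contC_atD cJ cVJ))) (contC_atZ P (contC_atD cF cV)).
apply: (contC_atB (contC_atD (contC_atZ _ chJ) (contC_atZ _ ch))).
exact: (contC_atM (contC_atZ _ (contC_atD cm (contC_atZ _ chJ))) (contC_atM (contC_atN chJ) cd)).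
Qed.

(** The difference u1 - u2 is s z / p. It identifies the denominator in [exterior_value] and shows
    that it does not vanish off the slit. *)
Let branch_diff z : ~ slit c z -> conjc (root1 z) - L / conjc (root1 z) = conjc (s z) / P.
Proof.
move=> sz; have [_ rL _] := branch_roots sz.
have U0 : root1 z != 0.
  by rewrite mulf_neq0 ?(branch_add_neq0 c0 sP sz)// invr_eq0 mulf_neq0.
have V0 : conjc (root1 z) != 0 by rewrite -normc_eq0 normcJ normc_eq0.
have LJ : L = conjc (root1 z) * conjc (root2 z) by rewrite -conjcM rL conjc_real.
rewrite LJ mulrAC divff// mul1r -conjcN -conjcD.
have -> : root1 z - root2 z = s z / P by rewrite /root1 /root2; field; rewrite P0.
by rewrite conjcM conjc_inv conjc_real.
Qed.

(** Inside and strictly outside the ellipse one formula holds nearby. On the boundary |u1| = 1, both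
    formulas hold at the point and every nearby point obeys one of them, so [contC_at_cases]
    applies. *)
Let contC_at_gradient (g : R -> R * R) t : contC_at (fun r => toC (g r)) t ->
  contC_at (fun r => G (g r)) t.
Proof.
move=> cg; have [gO|gO] := EM (Omega a b (g t)).
  have cQ : {for t, continuous (fun r =>
      Re (toC (g r)) ^+ 2 / a ^+ 2 + Im (toC (g r)) ^+ 2 / b ^+ 2)}.
    have [g1 g2] := cg; have cc (y : R) : {for t, continuous (fun _ : R => y)}.
      exact: cst_continuous.
    by apply: continuousD; apply: continuousM => //; exact: continuousM.
  apply: (contC_at_cases (contC_at_interior cg) (contC_at_interior cg)).
  - exact: gradW_Omega.
  - exact: gradW_Omega.
  - have FF := nbhs_filter t.
    by apply: filterS (@cvgr_lt R R (nbhs t) FF _ _ cQ 1 gO) => r rO; left; exact: gradW_Omega.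
have sz : ~ slit c (toC (g t)) by move=> /slit_Omega.
have [h1 h2 h3] := branch_roots sz.
have [n1 Gt] := gradW_Omega_compl gO.
have near_off : \forall r \near t, ~ slit c (toC (g r)).
  have /contC_atP cg' := cg; exact: (cg' _ (off_slit_near sz)).
have hs : holo_at s (toC (g t)) by case: sP => + _ _; apply.
have cs := @contC_at_holo R s (fun r => toC (g r)) t hs cg.
have c1 : contC_at (fun r => root1 (toC (g r))) t.
  by apply: contC_atM; [exact: contC_atD|exact: contC_at_cst].
have U0 : root1 (toC (g t)) != 0 by rewrite -normc_eq0 gt_eqF// (lt_le_trans ltr01).
have ce : contC_at (fun r => exterior_value P L al (root1 (toC (g r)))
    (conjc (root1 (toC (g r))))) t.
  apply: (contC_at_exterior c1 U0); rewrite branch_diff// mulf_neq0 ?invr_eq0//.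
  by rewrite -normc_eq0 normcJ normc_eq0 (branch_neq0 c0 sP).
move: n1; rewrite le_eqVlt => /orP[/eqP n1|n1].
  apply: (contC_at_cases (contC_at_interior cg) ce).
  - by apply: (gradW_inner alpha a0 b0 h1 h2 h3); rewrite -n1.
  - exact: Gt.
  - apply: filterS near_off => r _; have [rO|rO] := EM (Omega a b (g r)).
      by left; exact: gradW_Omega.
    by right; case: (gradW_Omega_compl rO).
apply: (contC_at_cases ce ce) => //.
apply: filterS2 near_off (contC_at_normc_gt c1 n1) => r rs rn; left.
have [k1 k2 k3] := branch_roots rs.
suff rO : ~ Omega a b (g r) by case: (gradW_Omega_compl rO).
by move=> /(Omega_root a0 b0 k1 k2 k3); rewrite ltNge (ltW rn).
Qed.

Let N0 : pi * a * b != 0 :> R.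
Proof. by rewrite !mulf_neq0 ?gt_eqF// pi_gt0. Qed.

Let contC_at_convolution (g : R -> R * R) t : contC_at (fun r => toC (g r)) t ->
  contC_at (fun r => convolutionC (gradW_kernel alpha) \1_(Omega a b) (g r)) t.
Proof.
move=> /contC_at_gradient cG.
have -> : (fun r => convolutionC (gradW_kernel alpha) \1_(Omega a b) (g r)) =
    (fun r => (pi * a * b)%:C%C * G (g r)).
  by apply/funext => r; rewrite /G mulrA -rmorphM div1r divff// rmorph1 mul1r.
exact: contC_atZ.
Qed.

Lemma convolvable_mu_ell x : convolvable (W alpha) (mu_ell a b) x.
Proof.
have := integrableZl measurableT (1 / (pi * a * b)) (convolvable_W alpha a0 b0 x : (@plane R).-integrable _ _).
by congr integrable; apply/funext => y; rewrite /= -EFinM /mu_ell mulrCA.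
Qed.

Lemma convolution_mu_ell x : convolution (W alpha) (mu_ell a b) x =
  (1 / (pi * a * b)) * convolution (W alpha) \1_(Omega a b) x.
Proof.
rewrite /convolution -[@planar_lebesgue R]/(@plane R).
rewrite -(RintegralZl _ measurableT (convolvable_W alpha a0 b0 x : (@plane R).-integrable _ _)).
by apply: eq_Rintegral => y _; rewrite /mu_ell mulrCA.
Qed.

(** [contC_at_gradient] along the two axis directions supplies the continuity required by
    [gradient_convolution_W]; the normalising constant is then factored out. *)
Lemma gradient_potential x :
  has_gradient (convolution (W alpha) (mu_ell a b)) x /\
  gradient (convolution (W alpha) (mu_ell a b)) x = G x.
Proof.
have line (d : R * R) : contC_at (fun t => toC (x + (t * d.1, t * d.2))) 0.
  have -> : (fun t => toC (x + (t * d.1, t * d.2))) = (fun t => toC x + t%:C%C * toC d).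
    apply/funext => t; rewrite toCD; congr (_ + _); rewrite /toC /=.
    by apply/eqP; rewrite eq_complex /=; apply/andP; split; apply/eqP; ring.
  apply: contC_atD; first exact: contC_at_cst.
  apply: contC_atM; last exact: contC_at_cst.
  by split; [exact: cvg_id|exact: (@cst_continuous R R 0 0)].
have c1 : contC_at (fun t => convolutionC (gradW_kernel alpha) \1_(Omega a b) (x + (t, 0))) 0.
  apply: contC_at_convolution; have := line (1, 0).
  by congr contC_at; apply/funext => t; rewrite /= mulr1 mulr0.
have c2 : contC_at (fun t => convolutionC (gradW_kernel alpha) \1_(Omega a b) (x + (0, t))) 0.
  apply: contC_at_convolution; have := line (0, 1).
  by congr contC_at; apply/funext => t; rewrite /= mulr1 mulr0.
have [d1 d2] := gradient_convolution_W a0 b0 (proj1 c1) (proj2 c2).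
have VE : convolution (W alpha) (mu_ell a b) =
    (1 / (pi * a * b)) \*: (fun x => convolution (W alpha) \1_(Omega a b) x).
  by apply/funext => y; exact: convolution_mu_ell.
have {}d1 := is_deriveZ (1 / (pi * a * b)) d1.
have {}d2 := is_deriveZ (1 / (pi * a * b)) d2.
rewrite VE; split; first by split; [case: d1|case: d2].
rewrite /gradient (@derive_val _ _ _ _ _ _ _ d1) (@derive_val _ _ _ _ _ _ _ d2).
rewrite /G /convolutionC /GRing.scale /=.
by apply/eqP; rewrite eq_complex ReM ImM /= !mul0r subr0 addr0 !eqxx.
Qed.

Let aC : a%:C%C = P * (1 + L).
Proof.
rewrite /P /L -[1]/(1%:C%C) -rmorphD -rmorphM; congr (_%:C%C).
by rewrite /p /lam; field; rewrite gt_eqF// addr_gt0.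
Qed.

Let bC : b%:C%C = P * (1 - L).
Proof.
rewrite /P /L -[1]/(1%:C%C) -rmorphB -rmorphM; congr (_%:C%C).
by rewrite /p /lam; field; rewrite gt_eqF// addr_gt0.
Qed.

Lemma gradW_interior x : Omega a b x ->
  G x = (1 / (a * b) * (- 1 - alpha * lam))%:C%C * toC x +
    (1 / (a * b) * (lam + alpha / 2 + lam ^+ 2 * (alpha / 2)))%:C%C * conjc (toC x).
Proof.
move=> /gradW_Omega ->.
have cM (y w : R) : (y * w)%:C%C = y%:C%C * w%:C%C by rewrite rmorphM.
have cD (y w : R) : (y + w)%:C%C = y%:C%C + w%:C%C by rewrite rmorphD.
have cN (y : R) : (- y)%:C%C = - y%:C%C by rewrite rmorphN.
have h2 : (2^-1)%:C%C = 2^-1 :> R[i].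
  by rewrite -(rmorph_nat (@real_complex R) 2); exact: fmorphV.
have e0 : (1 / (a * b))%:C%C = 1 / (P * (1 + L) * (P * (1 - L))).
  by rewrite -aC -bC !div1r -cM; exact: fmorphV.
have f1 : (- 1 - alpha * lam)%:C%C = - 1 - al * L.
  by rewrite (cD (- 1)) (cN (alpha * lam)) (cN 1) (cM alpha lam).
have f2 : (lam + alpha / 2 + lam ^+ 2 * (alpha / 2))%:C%C = L + al / 2 + L ^+ 2 * (al / 2).
  by rewrite (cD (lam + _)) (cD lam) (cM (lam ^+ 2)) (cM alpha 2^-1) h2 !expr2 (cM lam lam).
rewrite (cM (1 / _)) (cM (1 / _)) e0 f1 f2 /interior_value.
by rewrite mulrDr !mulrA.
Qed.

(** Translates [exterior_value] back to z. As [branch_conj] lets [s] commute with conjugation, h at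
    conj z is 1 / (2 p conj u1), and [cderiv_inv_add_branch] with [branch_diff] gives the derivative
    there. *)
Lemma gradW_exterior x : ~ Omega a b x ->
  let h := fun z : R[i] => 1 / (z + s z) in
  let z := toC x in
  G x = - (2 + alpha * lam)%:C%C * h (conjc z) + al * h z
    - al * (L * conjc z - z + (2 * a * b)%:C%C * h (conjc z)) * cderiv h (conjc z).
Proof.
move=> xO h z; have sz : ~ slit c z by move=> /slit_Omega.
have sj := off_slit_conj sz.
have [_ ->] := gradW_Omega_compl xO; rewrite -/z.
have [zE rL _] := branch_roots sz; have sJ := branch_conj c0 sP sz.
have U0 : root1 z != 0.
  by rewrite mulf_neq0 ?(branch_add_neq0 c0 sP sz)// invr_eq0 mulf_neq0.
have V0 : conjc (root1 z) != 0 by rewrite -normc_eq0 normcJ normc_eq0.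
have mE (w : R[i]) : 2 * P * (w / (2 * P)) = w by rewrite mulrC divfK// mulf_neq0.
have hz : h z = 1 / (2 * P * root1 z) by rewrite /h /root1 mE.
have hJ : h (conjc z) = 1 / (2 * P * conjc (root1 z)).
  rewrite /h sJ -conjcD /root1 conjcM conjc_inv; congr (1 / _).
  have -> : conjc (2 * P) = 2 * P by rewrite conjcM conjc_real rmorph_nat.
  by rewrite mE.
have dh : cderiv h (conjc z) =
    - (1 / (2 * P * conjc (root1 z))) / (P * (conjc (root1 z) - L / conjc (root1 z))).
  rewrite (cderiv_inv_add_branch c0 sP sj) -/(h (conjc z)) hJ sJ branch_diff//.
  by rewrite [P * _]mulrC divfK.
have zU : z = P * (root1 z + L / root1 z).
  by rewrite [LHS]zE -rL mulrAC divff// mul1r.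
have zV : conjc z = P * (conjc (root1 z) + L / conjc (root1 z)).
  transitivity (conjc P * conjc (root1 z + L / root1 z)); first by rewrite -conjcM -zU.
  by rewrite conjc_real conjcD (conjcM L) conjc_inv conjc_real.
have e1 : (2 + alpha * lam)%:C%C = 2 + al * L by rewrite rmorphD rmorphM rmorph_nat.
have e2 : (2 * a * b)%:C%C = 2 * (P * (1 + L)) * (P * (1 - L)).
  by rewrite -aC -bC !rmorphM rmorph_nat.
rewrite e1 e2 dh hJ hz zV; move: (root1 z) zU => U zU.
by rewrite zU.
Qed.

End potential_of_ellipse.

Theorem proposition3p1 (R : realType) (alpha a b c : R) (s : R[i] -> R[i])
    (a_gt0 : 0 < a) (le_ab : a <= b)
    (c_ge0 : 0 <= c) (c2E : c ^+ 2 = b ^+ 2 - a ^+ 2)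
    (sP : is_sqrt_branch c s) :
  let lambda := (a - b) / (a + b) in
  let h := fun z : R[i] => 1 / (z + s z) in
  let V := convolution (W alpha) (mu_ell a b) in
  let G := fun x : R * R =>
    (1 / (pi * a * b))%:C%C * convolutionC (gradW_kernel alpha) (\1_(Omega a b)) x in
  [/\ forall x : R * R,
        convolvable (W alpha) (mu_ell a b) x /\
        convolvableC (gradW_kernel alpha) (\1_(Omega a b)) x,
      forall x : R * R, Omega a b x ->
        let z := toC x in
        [/\ has_gradient V x, gradient V x = G x
          & G x =
            (1 / (a * b) * (- 1 - alpha * lambda))%:C%C * z
            + (1 / (a * b)
                * (lambda + alpha / 2 + lambda ^+ 2 * (alpha / 2)))%:C%C
              * conjc z]
    & forall x : R * R, (~` Omega a b) x ->
        let z := toC x in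
        [/\ has_gradient V x, gradient V x = G x
          & G x =
            - (2 + alpha * lambda)%:C%C * h (conjc z) + alpha%:C%C * h z
            - alpha%:C%C
              * (lambda%:C%C * conjc z - z + (2 * a * b)%:C%C * h (conjc z))
              * cderiv h (conjc z)]].
Proof.
move=> lambda h V G; have b_gt0 : 0 < b by exact: lt_le_trans le_ab.
split=> [x|x xO z|x xO z].
- by split; [exact: convolvable_mu_ell|exact: convolvable_gradW].
- have [g1 g2] := gradient_potential alpha a_gt0 le_ab c_ge0 c2E sP x; split=> //.
  exact: (gradW_interior alpha a_gt0 le_ab c2E xO).
have [g1 g2] := gradient_potential alpha a_gt0 le_ab c_ge0 c2E sP x; split=> //.
exact: (gradW_exterior alpha a_gt0 le_ab c_ge0 c2E sP xO).
Qed.
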